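(* Let $n\in\mathbb N$, let $\varepsilon,h,d>0$ and $q\in(0,1)$. Let $u_0,v_0\in BUC(\mathbb R^n)$ with $u_0(x)\ge 0$ and $v_0(x)\ge 0$ for all $x\in\mathbb R^n$. Then there exists a unique pair $(u,v)$ of time-global classical solutions to (BZ) with $u,v\in C([0,\infty);BUC(\mathbb R^n))$, and $u(x,t)\ge 0$, $v(x,t)\ge 0$ for all $x\in\mathbb R^n$, $t\ge 0$.
   Context: $BUC(\mathbb R^n)$ denotes the Banach space of bounded uniformly continuous real functions on $\mathbb R^n$ with the sup norm $\|f\|_\infty$. The problem (BZ) (Keener–Tyson model of the Belousov–Zhabotinsky reaction) is $$\partial_t u=\Delta u+\frac1\varepsilon u(1-u)-hv\frac{u-q}{u+q},\qquad \partial_t v=d\Delta v-v+u\quad\text{in }\mathbb R^n\times(0,\infty),$$ $$u|_{t=0}=u_0,\quad v|_{t=0}=v_0 \text{ in }\mathbb R^n.$$ Equivalently (in the mild sense) $u(t)=e^{t\Delta}u_0+\int_0^t e^{(t-s)\Delta}\big[\varepsilon^{-1}u(s)(1-u(s))-hv(s)\frac{u(s)-q}{u(s)+q}\big]ds$ and $v(t)=e^{td\Delta}v_0+\int_0^t e^{d(t-s)\Delta}[-v(s)+u(s)]ds$, where $e^{t\Delta}$ is the heat semigroup $(e^{t\Delta}f)(x)=\int_{\mathbb R^n}(4\pi t)^{-n/2}e^{-|x-y|^2/4t}f(y)\,dy$. A classical solution is one that is $C^1$ in $t$ and $C^2$ in $x$ for $t>0$ and satisfies the equations pointwise. *)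

(* Defs.v *)
From mathcomp Require Import ssreflect ssrbool eqtype ssrnat fintype bigop.
From Stdlib Require Import Reals.
Open Scope R_scope.

Definition pt (n : nat) := 'I_n -> R.

Definition dist {n : nat} (x y : pt n) : R :=
  sqrt (\big[Rplus/0]_(i < n) ((x i - y i) ^ 2)).

Definition shift {n : nat} (x : pt n) (i : 'I_n) (r : R) : pt n :=
  fun j => if j == i then x j + r else x j.

Definition bounded {n : nat} (f : pt n -> R) : Prop :=
  exists M : R, forall x, Rabs (f x) <= M.

Definition unif_cont {n : nat} (f : pt n -> R) : Prop :=
  forall eps, 0 < eps -> exists delta, 0 < delta /\
    forall x y, dist x y < delta -> Rabs (f x - f y) < eps.

Definition BUC {n : nat} (f : pt n -> R) : Prop := bounded f /\ unif_cont f.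

Definition C_BUC {n : nat} (u : R -> pt n -> R) : Prop :=
  (forall t, 0 <= t -> BUC (u t)) /\
  (forall t, 0 <= t -> forall eps, 0 < eps -> exists delta, 0 < delta /\
     forall s, 0 <= s -> Rabs (s - t) < delta ->
       forall x, Rabs (u s x - u t x) <= eps).

Definition cont_pos {n : nat} (g : R -> pt n -> R) : Prop :=
  forall t x, 0 < t -> forall eps, 0 < eps -> exists delta, 0 < delta /\
    forall s y, 0 < s -> Rabs (s - t) < delta -> dist y x < delta ->
      Rabs (g s y - g t x) < eps.

Definition C21 {n : nat} (u : R -> pt n -> R) (ut lap : R -> pt n -> R) : Prop :=
  exists (ux : 'I_n -> R -> pt n -> R) (uxx : 'I_n -> 'I_n -> R -> pt n -> R),
    cont_pos u /\ cont_pos ut /\ (forall i, cont_pos (ux i)) /\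
    (forall i j, cont_pos (uxx i j)) /\
    (forall t x, 0 < t ->
       derivable_pt_lim (fun s => u s x) t (ut t x) /\
       (forall i, derivable_pt_lim (fun r => u t (shift x i r)) 0 (ux i t x)) /\
       (forall i j, derivable_pt_lim (fun r => ux j t (shift x i r)) 0
                                     (uxx i j t x)) /\
       lap t x = \big[Rplus/0]_(i < n) uxx i i t x).

Definition BZ_classical {n : nat} (eps h d q : R) (u0 v0 : pt n -> R)
    (u v : R -> pt n -> R) : Prop :=
  exists ut lapu vt lapv : R -> pt n -> R,
    C21 u ut lapu /\ C21 v vt lapv /\
    (forall t x, 0 < t ->
       u t x + q <> 0 /\
       ut t x = lapu t x + / eps * u t x * (1 - u t x)
                - h * v t x * ((u t x - q) / (u t x + q)) /\
       vt t x = d * lapv t x - v t x + u t x) /\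
    (forall x, u 0 x = u0 x) /\ (forall x, v 0 x = v0 x).

(* Main.v *)
From HB Require Import structures.
From mathcomp Require Import ssreflect ssrfun ssrbool eqtype ssrnat seq fintype bigop.
From Stdlib Require Import Reals Lra Classical FunctionalExtensionality ClassicalEpsilon.
From Coquelicot Require Import Coquelicot.
Require Import Defs.
Open Scope R_scope.

(** The heat semigroup is obtained as the limit, as the step tends to 0, of the semigroups generated
    by the finite-difference Laplacians, which are bounded operators. Each of these satisfies a
    maximum principle, and Bernstein's method yields the gradient bound |f|/sqrt(Dt) uniformly in
    the step; convergence follows on the dense class of functions with two bounded uniformly
    continuous derivatives, because all the operators involved commute.

    The reaction terms are truncated to [0,M] x [0,N], which makes them globally Lipschitz, and the
    mild (Duhamel) equation is solved by Picard iteration. A mild solution splits as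
    U(t) = S(r) U(t-r) + O(sqrt r) in the Lipschitz norm, so it is a limit of smooth functions in
    that norm and hence continuously differentiable; the same argument applied to its derivatives,
    now with a Lipschitz source, gives C^2, and the equation follows. The maximum principle on R^n
    shows 0 <= u <= M and 0 <= v <= N, so the truncation is inactive. For uniqueness, a second
    solution stays above -q/2 for a short time after any time at which it agrees with the first;
    there the difference contracts. *)

(** The bound 1/sqrt(t) for one derivative is integrable at t = 0, while the corresponding 1/t for
    two derivatives is not; this is why C^2 is reached in two rounds, the Lipschitz bound from the
    first making the source good enough for the second. No kernel representation of the semigroup
    enters: the operators are used through linearity, a sup bound and commutation with translations,
    which already allow them to be exchanged with derivatives and time integrals. The truncated
    problem is solved on all of [0, oo) before anything is known about signs, so the a priori bounds
    are proved for functions that are already classical. Bounds and uniqueness both apply the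
    maximum principle to classical solutions, so a competing solution never has to be rewritten in
    Duhamel form. The obstacle in uniqueness is that a competitor is not assumed nonnegative while
    the reaction is singular at u = -q: a Lipschitz bound is available only at a distance from -q,
    and this distance has to be recovered again and again along the time axis. *)

HB.instance Definition _ :=
  Monoid.isComLaw.Build R 0 Rplus
    (fun x y z => esym (Rplus_assoc x y z)) Rplus_comm Rplus_0_l.

(** * Finite sums over the coordinates *)

Lemma sum_scal {n : nat} (c : R) (F : 'I_n -> R) :
  \big[Rplus/0]_(i < n) (c * F i) = c * \big[Rplus/0]_(i < n) F i.
Proof.
elim/big_rec2: _ => [|i x y _ ->]; ring.
Qed.

Lemma sum_le {n : nat} (F G : 'I_n -> R) :
  (forall i, F i <= G i) ->
  \big[Rplus/0]_(i < n) F i <= \big[Rplus/0]_(i < n) G i.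
Proof.
move=> H; elim/big_rec2: _ => [|i x y _ Hx]; first lra.
move: (H i); lra.
Qed.

Lemma sum_const {n : nat} (c : R) : \big[Rplus/0]_(i < n) c = INR n * c.
Proof.
elim: n => [|n IH]; first by rewrite big_ord0 /=; ring.
rewrite big_ord_recl IH S_INR; ring.
Qed.

Lemma sum_abs_le {n : nat} (F : 'I_n -> R) :
  Rabs (\big[Rplus/0]_(i < n) F i) <= \big[Rplus/0]_(i < n) Rabs (F i).
Proof.
elim/big_rec2: _ => [|i x y _ Hx]; first by rewrite Rabs_R0; lra.
move: (Rabs_triang (F i) y); lra.
Qed.

Lemma sum_plus {n : nat} (F G : 'I_n -> R) :
  \big[Rplus/0]_(i < n) (F i + G i) =
  \big[Rplus/0]_(i < n) F i + \big[Rplus/0]_(i < n) G i.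
Proof. exact: big_split. Qed.

Lemma sum_minus {n : nat} (F G : 'I_n -> R) :
  \big[Rplus/0]_(i < n) (F i - G i) =
  \big[Rplus/0]_(i < n) F i - \big[Rplus/0]_(i < n) G i.
Proof.
elim/big_rec3: _ => [|i x y z _ ->]; ring.
Qed.

Lemma sum_ge0 {n : nat} (F : 'I_n -> R) :
  (forall i, 0 <= F i) -> 0 <= \big[Rplus/0]_(i < n) F i.
Proof.
move=> H; have := @sum_le n (fun _ => 0) F H.
rewrite sum_const; lra.
Qed.

Lemma sum_term_le {n : nat} (F : 'I_n -> R) (i : 'I_n) :
  (forall j, 0 <= F j) -> F i <= \big[Rplus/0]_(j < n) F j.
Proof.
move=> H; rewrite (bigD1 i) //=.
rewrite -[X in X <= _]Rplus_0_r; apply: Rplus_le_compat_l.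
by elim/big_rec: _ => [|j x _ Hx]; [lra | move: (H j); lra].
Qed.

(** * Translations *)

Definition tr {n : nat} (a : pt n) (f : pt n -> R) : pt n -> R :=
  fun x => f (fun i => x i + a i).

Definition dir {n : nat} (i : 'I_n) (r : R) : pt n := shift (fun _ => 0) i r.

Lemma shiftE {n : nat} (x : pt n) (i : 'I_n) (r : R) :
  shift x i r = fun j => x j + dir i r j.
Proof.
apply: functional_extensionality => j; rewrite /dir /shift.
by case: (j == i); ring.
Qed.

Lemma tr_dir {n : nat} (i : 'I_n) (r : R) (f : pt n -> R) :
  tr (dir i r) f = fun x => f (shift x i r).
Proof.
by apply: functional_extensionality => x; rewrite shiftE.
Qed.

Lemma shift_shift {n : nat} (x : pt n) (i : 'I_n) (r s : R) :
  shift (shift x i r) i s = shift x i (r + s).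
Proof.
apply: functional_extensionality => j; rewrite /shift.
by case: (j == i); ring.
Qed.

Lemma shift0 {n : nat} (x : pt n) (i : 'I_n) : shift x i 0 = x.
Proof.
apply: functional_extensionality => j; rewrite /shift.
by case: (j == i); ring.
Qed.

Lemma shift_comm {n : nat} (x : pt n) (i j : 'I_n) (r s : R) :
  shift (shift x i r) j s = shift (shift x j s) i r.
Proof.
apply: functional_extensionality => k; rewrite /shift.
by case: (k == i); case: (k == j); ring.
Qed.

Lemma tr_shift {n : nat} (a x : pt n) (i : 'I_n) (r : R) (f : pt n -> R) :
  tr a f (shift x i r) = f (shift (fun j => x j + a j) i r).
Proof.
rewrite /tr; congr (f _); apply: functional_extensionality => j.
by rewrite /shift; case: (j == i); ring.
Qed.

Lemma dist_shift {n : nat} (x : pt n) (i : 'I_n) (r : R) :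
  dist (shift x i r) x = Rabs r.
Proof.
rewrite /dist (bigD1 i) //= big1.
  by rewrite /shift eqxx -sqrt_Rsqr_abs /Rsqr; congr sqrt; ring.
by move=> j /negbTE; rewrite /shift => ->; ring.
Qed.

Lemma dist_tr {n : nat} (x y a : pt n) :
  dist (fun i => x i + a i) (fun i => y i + a i) = dist x y.
Proof. by rewrite /dist; congr sqrt; apply: eq_bigr => i _; ring. Qed.

(** * Bounded uniformly continuous functions *)

Lemma BUC_bound {n : nat} (f : pt n -> R) :
  BUC f -> exists M, 0 <= M /\ forall x, Rabs (f x) <= M.
Proof.
move=> [[M HM] _]; exists M; split=> //.
move: (HM (fun _ => 0)) (Rabs_pos (f (fun _ => 0))); lra.
Qed.

Lemma BUC_const {n : nat} (c : R) : BUC (fun _ : pt n => c).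
Proof.
split; first by exists (Rabs c) => x; lra.
move=> e He; exists 1; split; first lra.
move=> x y _; rewrite Rminus_diag_eq // Rabs_R0; lra.
Qed.

Lemma BUC_lin {n : nat} (a : R) (f g : pt n -> R) :
  BUC f -> BUC g -> BUC (fun x => a * f x + g x).
Proof.
move=> [[M HM] Hf] [[N HN] Hg]; split.
  exists (Rabs a * M + N) => x.
  have := Rabs_triang (a * f x) (g x); rewrite Rabs_mult.
  have := Rmult_le_compat_l _ _ _ (Rabs_pos a) (HM x).
  move: (HN x); lra.
move=> e He.
have Ha : 0 < Rabs a + 1 by move: (Rabs_pos a); lra.
have [|d1 [Hd1 H1]] := Hf (e / 2 / (Rabs a + 1)).
  by apply: Rdiv_lt_0_compat; lra.
have [|d2 [Hd2 H2]] := Hg (e / 2); first lra.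
exists (Rmin d1 d2); split; first exact: Rmin_pos.
move=> x y Hxy.
have {}H1 := H1 x y (Rlt_le_trans _ _ _ Hxy (Rmin_l _ _)).
have {}H2 := H2 x y (Rlt_le_trans _ _ _ Hxy (Rmin_r _ _)).
have -> : a * f x + g x - (a * f y + g y) = a * (f x - f y) + (g x - g y) by ring.
apply: Rle_lt_trans (Rabs_triang _ _) _; rewrite Rabs_mult.
have : Rabs a * Rabs (f x - f y) <= (Rabs a + 1) * (e / 2 / (Rabs a + 1)).
  by apply: Rmult_le_compat; try apply: Rabs_pos; lra.
have -> : (Rabs a + 1) * (e / 2 / (Rabs a + 1)) = e / 2 by field; lra.
lra.
Qed.

Lemma BUC_scal {n : nat} (a : R) (f : pt n -> R) :
  BUC f -> BUC (fun x => a * f x).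
Proof.
move=> Hf; have := BUC_lin a _ _ Hf (BUC_const 0).
by congr BUC; apply: functional_extensionality => x; ring.
Qed.

Lemma BUC_plus {n : nat} (f g : pt n -> R) :
  BUC f -> BUC g -> BUC (fun x => f x + g x).
Proof.
move=> Hf Hg; have := BUC_lin 1 _ _ Hf Hg.
by congr BUC; apply: functional_extensionality => x; ring.
Qed.

Lemma BUC_minus {n : nat} (f g : pt n -> R) :
  BUC f -> BUC g -> BUC (fun x => f x - g x).
Proof.
move=> Hf Hg; have := BUC_lin (-1) _ _ Hg Hf.
by congr BUC; apply: functional_extensionality => x; ring.
Qed.

Lemma BUC_sum {n m : nat} (F : 'I_m -> pt n -> R) :
  (forall i, BUC (F i)) -> BUC (fun x => \big[Rplus/0]_(i < m) F i x).
Proof.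
elim: m F => [|m IH] F H.
  have -> : (fun x => \big[Rplus/0]_(i < 0) F i x) = fun _ => 0.
    by apply: functional_extensionality => x; rewrite big_ord0.
  exact: BUC_const.
have -> : (fun x => \big[Rplus/0]_(i < m.+1) F i x) =
          fun x => F ord0 x + \big[Rplus/0]_(i < m) F (lift ord0 i) x.
  by apply: functional_extensionality => x; rewrite big_ord_recl.
by apply: BUC_plus => //; apply: IH.
Qed.

Lemma BUC_tr {n : nat} (a : pt n) (f : pt n -> R) : BUC f -> BUC (tr a f).
Proof.
move=> [[M HM] Hf]; split; first by exists M => x; exact: HM.
move=> e He; have [d [Hd H]] := Hf e He; exists d; split=> // x y Hxy.
by apply: H; rewrite dist_tr.
Qed.

Lemma BUC_shift {n : nat} (i : 'I_n) (r : R) (f : pt n -> R) :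
  BUC f -> BUC (fun x => f (shift x i r)).
Proof. by move=> Hf; rewrite -tr_dir; apply: BUC_tr. Qed.

Lemma BUC_uniform_limit {n : nat} (f : pt n -> R) :
  (forall e, 0 < e -> exists g, BUC g /\ forall x, Rabs (f x - g x) <= e) -> BUC f.
Proof.
move=> H; split.
  have [g [[[M HM] _] Hg]] := H 1 Rlt_0_1.
  exists (1 + M) => x; have := Rabs_triang (f x - g x) (g x).
  have -> : f x - g x + g x = f x by ring.
  move: (HM x) (Hg x); lra.
move=> e He; have [|g [[_ Hu] Hg]] := H (e / 3); first lra.
have [|d [Hd Hxy]] := Hu (e / 3); first lra.
exists d; split=> // x y Dxy.
move: (Hxy x y Dxy) (Hg x) (Hg y).
move=> /Rabs_def2 [A1 A2] /Rabs_le_between [B1 B2] /Rabs_le_between [C1 C2].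
by apply: Rabs_def1; lra.
Qed.

Lemma BUC_shift_small {n : nat} (f : pt n -> R) (e : R) :
  BUC f -> 0 < e -> exists d, 0 < d /\
    forall i r x, Rabs r < d -> Rabs (f (shift x i r) - f x) < e.
Proof.
move=> [_ Hf] He; have [d [Hd H]] := Hf e He; exists d; split=> // i r x Hr.
by apply: H; rewrite dist_shift.
Qed.

(** * Bounded translation-invariant operators *)

(** The common interface of the moving averages, the discrete semigroups and their limit.
    Commutation with every translation is what later gives preservation of uniform continuity and
    commutation with partial derivatives. *)
Definition inv_op {n : nat} (K : R) (T : (pt n -> R) -> pt n -> R) : Prop :=
  [/\ 0 <= K,
      forall a f g, BUC f -> BUC g -> forall x,
        T (fun y => a * f y + g y) x = a * T f x + T g x,
      forall f M, BUC f -> (forall x, Rabs (f x) <= M) ->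
        forall x, Rabs (T f x) <= K * M
    & forall a f, BUC f -> T (tr a f) = tr a (T f)].

Lemma inv_op_scal {n : nat} K (T : (pt n -> R) -> pt n -> R) a f x :
  inv_op K T -> BUC f -> T (fun y => a * f y) x = a * T f x.
Proof.
move=> [_ L B _] Hf.
have H0 : T (fun _ => 0) x = 0.
  have := B _ 0 (BUC_const 0) _ x; rewrite Rmult_0_r => H.
  by apply: Rabs_eq_0; apply: Rle_antisym (Rabs_pos _); apply: H => y; rewrite Rabs_R0; lra.
have := L a _ _ Hf (BUC_const 0) x; rewrite H0 Rplus_0_r => <-.
by congr (T _ x); apply: functional_extensionality => y; ring.
Qed.

Lemma inv_op_minus {n : nat} K (T : (pt n -> R) -> pt n -> R) f g x :
  inv_op K T -> BUC f -> BUC g -> T (fun y => f y - g y) x = T f x - T g x.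
Proof.
move=> [_ L _ _] Hf Hg; have := L (-1) _ _ Hg Hf x.
have -> : (fun y => -1 * g y + f y) = fun y => f y - g y.
  by apply: functional_extensionality => y; ring.
by move=> ->; ring.
Qed.

Lemma inv_op_plus {n : nat} K (T : (pt n -> R) -> pt n -> R) f g x :
  inv_op K T -> BUC f -> BUC g -> T (fun y => f y + g y) x = T f x + T g x.
Proof.
move=> [_ L _ _] Hf Hg; have := L 1 _ _ Hf Hg x.
have -> : (fun y => 1 * f y + g y) = fun y => f y + g y.
  by apply: functional_extensionality => y; ring.
by move=> ->; ring.
Qed.

Lemma inv_op_bound_minus {n : nat} K (T : (pt n -> R) -> pt n -> R) f g M x :
  inv_op K T -> BUC f -> BUC g -> (forall y, Rabs (f y - g y) <= M) ->
  Rabs (T f x - T g x) <= K * M.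
Proof.
move=> HT Hf Hg H; rewrite -(inv_op_minus K T) //.
by case: HT => _ _ B _; apply: B => //; apply: BUC_minus.
Qed.

Lemma inv_op_sum {n m : nat} K (T : (pt n -> R) -> pt n -> R) (F : 'I_m -> pt n -> R) x :
  inv_op K T -> (forall i, BUC (F i)) ->
  T (fun y => \big[Rplus/0]_(i < m) F i y) x = \big[Rplus/0]_(i < m) T (F i) x.
Proof.
move=> HT; elim: m F => [|m IH] F H.
  transitivity (0 * T (fun _ => 0) x); last by rewrite big_ord0 Rmult_0_l.
  rewrite -(inv_op_scal K) //; last exact: BUC_const.
  by congr (T _ x); apply: functional_extensionality => y; rewrite big_ord0 Rmult_0_l.
rewrite big_ord_recl -IH // -(inv_op_plus K) //; last exact: BUC_sum.
by congr (T _ x); apply: functional_extensionality => y; rewrite big_ord_recl.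
Qed.

Lemma inv_op_shift {n : nat} K (T : (pt n -> R) -> pt n -> R) f i r x :
  inv_op K T -> BUC f -> T (fun y => f (shift y i r)) x = T f (shift x i r).
Proof.
move=> [_ _ _ C] Hf; rewrite -tr_dir C //; by rewrite tr_dir.
Qed.

(** With a = x - y, translation invariance turns T f x - T f y into T (tr a f - f) y, and uniform
    continuity of f makes the argument small in sup norm. Dividing by K + 1 instead of K covers K =
    0. *)
Lemma inv_op_BUC {n : nat} K (T : (pt n -> R) -> pt n -> R) f :
  inv_op K T -> BUC f -> BUC (T f).
Proof.
move=> HT Hf; have [M [HM HfM]] := BUC_bound _ Hf.
case: (HT) => HK L B C; split; first by exists (K * M) => x; apply: B.
move=> e He.
have [|d [Hd H]] := proj2 Hf (e / (K + 1)); first by apply: Rdiv_lt_0_compat; lra.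
exists d; split=> // x y Hxy.
pose a : pt n := fun i => x i - y i.
have Ex : T f x = T (tr a f) y.
  by rewrite C // /tr; congr (T f _); apply: functional_extensionality => i; rewrite /a; ring.
rewrite Ex.
have Hb : Rabs (T (tr a f) y - T f y) <= K * (e / (K + 1)).
  apply: (inv_op_bound_minus K T) => //; first exact: BUC_tr.
  move=> z; apply: Rlt_le; apply: H.
  have -> : dist (fun i => z i + a i) z = dist x y; last by [].
  by rewrite /dist; congr sqrt; apply: eq_bigr => i _; rewrite /a; ring.
apply: Rle_lt_trans Hb _.
have -> : K * (e / (K + 1)) = e - e / (K + 1) by field; lra.
have : 0 < e / (K + 1) by apply: Rdiv_lt_0_compat; lra.
lra.
Qed.

Lemma inv_op_comp {n : nat} K L (T U : (pt n -> R) -> pt n -> R) :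
  inv_op K T -> inv_op L U -> inv_op (K * L) (fun f => T (U f)).
Proof.
move=> HT HU; case: (HT) => K0 LT BT CT; case: (HU) => L0 LU BU CU; split.
- exact: Rmult_le_pos.
- move=> a f g Hf Hg x.
  rewrite -LT; [|exact: (inv_op_BUC L)..].
  by congr (T _ x); apply: functional_extensionality => y; apply: LU.
- move=> f M Hf HM x; rewrite Rmult_assoc; apply: BT; first exact: (inv_op_BUC L).
  exact: BU.
- by move=> a f Hf; rewrite CU // CT //; exact: (inv_op_BUC L).
Qed.

(** * The discrete heat semigroup *)

(** Domination by the coefficients of M exp(c t); such a power series converges on the whole
    line. *)
Definition expbounded (M c : R) (a : nat -> R) : Prop :=
  forall k, Rabs (a k) <= M * (c ^ k / INR (Factorial.fact k)).

Lemma expbounded_abs M c a t :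
  0 <= c -> expbounded M c a ->
  ex_series (fun k => Rabs (a k * t ^ k)) /\
  Series (fun k => Rabs (a k * t ^ k)) <= M * exp (c * Rabs t).
Proof.
move=> Hc Ha.
have He := is_exp_Reals (c * Rabs t).
have HS : is_series (fun k => M * ((c * Rabs t) ^ k / INR (Factorial.fact k))) (M * exp (c * Rabs t)).
  apply: is_series_scal_l; move: He; apply: is_series_ext => k.
  rewrite /scal /= /mult /= pow_n_pow; rewrite /Rdiv; ring.
have Hle k : Rabs (a k * t ^ k) <= M * ((c * Rabs t) ^ k / INR (Factorial.fact k)).
  rewrite Rabs_mult -RPow_abs Rpow_mult_distr.
  have := Rmult_le_compat_r (Rabs t ^ k) _ _ (pow_le _ k (Rabs_pos t)) (Ha k).
  rewrite /Rdiv; lra.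
split.
  apply: (ex_series_le _ _ _ (ex_intro _ _ HS)) => k.
  by rewrite /norm /= /abs /= Rabs_Rabsolu.
rewrite -(is_series_unique _ _ HS); apply: Series_le; last by exists (M * exp (c * Rabs t)).
by move=> k; split; [exact: Rabs_pos | exact: Hle].
Qed.

Lemma expbounded_radius M c a t :
  0 <= c -> expbounded M c a -> Rbar_lt (Rabs t) (CV_radius a).
Proof.
move=> Hc Ha.
have [H _] := expbounded_abs M c a (Rabs t + 1) Hc Ha.
apply: (Rbar_lt_le_trans _ (Rabs t + 1)); first by move=> /=; lra.
by apply: (proj1 (Lub_Rbar_correct (CV_disk a))).
Qed.

Lemma expbounded_pseries M c a t :
  0 <= c -> expbounded M c a -> ex_pseries a t.
Proof.
move=> Hc Ha; apply: CV_radius_inside; exact: (expbounded_radius M c).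
Qed.

Lemma expbounded_le M c a t :
  0 <= c -> expbounded M c a -> Rabs (PSeries a t) <= M * exp (c * Rabs t).
Proof.
move=> Hc Ha; have [H1 H2] := expbounded_abs M c a t Hc Ha.
rewrite /PSeries; apply: Rle_trans (Series_Rabs _ H1) H2.
Qed.

(** The positive part of D times the difference Laplacian: [lapl] is [qop] minus the constant
    [rate], and [qop] maps 1 to [rate]. *)
Definition qop {n : nat} (D h : R) (f : pt n -> R) : pt n -> R :=
  fun x => D / h ^ 2 * \big[Rplus/0]_(i < n) (f (shift x i h) + f (shift x i (- h))).

Definition rate (n : nat) (D h : R) : R := D / h ^ 2 * (INR n * 2).

Definition lapl {n : nat} (D h : R) (f : pt n -> R) : pt n -> R :=
  fun x => D / h ^ 2 *
    \big[Rplus/0]_(i < n) (f (shift x i h) + f (shift x i (- h)) - 2 * f x).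

(** The exponential of t [lapl], with the scalar part of the generator factored out so that the
    remaining series contains only powers of the positive operator [qop]. *)
Definition dheat {n : nat} (D h t : R) (f : pt n -> R) : pt n -> R :=
  fun x => exp (- (rate n D h * t)) *
    PSeries (fun k => iter k (qop D h) f x / INR (Factorial.fact k)) t.

Lemma laplE {n} D h (f : pt n -> R) x : lapl D h f x = qop D h f x - rate n D h * f x.
Proof.
rewrite /lapl sum_minus sum_const /qop /rate; ring.
Qed.

Lemma step_gt0 D h : 0 < D -> 0 < h -> 0 < D / h ^ 2.
Proof. by move=> HD Hh; apply: Rdiv_lt_0_compat => //; apply: pow_lt. Qed.

Lemma rate_ge0 n D h : 0 < D -> 0 < h -> 0 <= rate n D h.
Proof.
move=> HD Hh; apply: Rmult_le_pos; first exact: Rlt_le (step_gt0 _ _ HD Hh).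
move: (pos_INR n); lra.
Qed.

Lemma qop_le {n} D h (f g : pt n -> R) x : 0 < D -> 0 < h ->
  (forall y, f y <= g y) -> qop D h f x <= qop D h g x.
Proof.
move=> HD Hh H; apply: Rmult_le_compat_l; first exact: Rlt_le (step_gt0 _ _ HD Hh).
by apply: sum_le => i; move: (H (shift x i h)) (H (shift x i (- h))); lra.
Qed.

Lemma qop_const {n} D h c (x : pt n) : qop D h (fun _ => c) x = rate n D h * c.
Proof. rewrite /qop sum_const /rate; ring. Qed.

Lemma qop_abs {n} D h (f : pt n -> R) M x : 0 < D -> 0 < h ->
  (forall y, Rabs (f y) <= M) -> Rabs (qop D h f x) <= rate n D h * M.
Proof.
move=> HD Hh H; apply: Rabs_le; split.
  have -> : - (rate n D h * M) = rate n D h * - M by ring.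
  rewrite -(qop_const D h (- M) x); apply: qop_le => // y.
  by move: (H y) => /Rabs_le_between; lra.
rewrite -(qop_const D h M x); apply: qop_le => // y.
by move: (H y) => /Rabs_le_between; lra.
Qed.

Lemma qop_lin {n} D h a (f g : pt n -> R) :
  qop D h (fun y => a * f y + g y) = fun x => a * qop D h f x + qop D h g x.
Proof.
apply: functional_extensionality => x; rewrite /qop.
have -> : a * (D / h ^ 2 * \big[Rplus/0]_(i < n) (f (shift x i h) + f (shift x i (- h)))) =
   D / h ^ 2 * (a * \big[Rplus/0]_(i < n) (f (shift x i h) + f (shift x i (- h)))) by ring.
rewrite -Rmult_plus_distr_l -(sum_scal a) -sum_plus; congr Rmult.
by apply: eq_bigr => i _; ring.
Qed.

Lemma qop_tr {n} D h a (f : pt n -> R) : qop D h (tr a f) = tr a (qop D h f).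
Proof.
apply: functional_extensionality => x; rewrite {2}/tr /qop; congr Rmult.
by apply: eq_bigr => i _; congr Rplus; exact: tr_shift.
Qed.

Lemma iter_qop_abs {n} D h (f : pt n -> R) M k x : 0 < D -> 0 < h ->
  (forall y, Rabs (f y) <= M) -> Rabs (iter k (qop D h) f x) <= rate n D h ^ k * M.
Proof.
move=> HD Hh H; elim: k x => [|k IH] x /=; first by rewrite Rmult_1_l.
by rewrite Rmult_assoc; apply: qop_abs.
Qed.

Lemma iter_qop_lin {n} D h a (f g : pt n -> R) k :
  iter k (qop D h) (fun y => a * f y + g y) =
  fun x => a * iter k (qop D h) f x + iter k (qop D h) g x.
Proof. by elim: k => [|k IH] //=; rewrite IH qop_lin. Qed.

Lemma iter_qop_tr {n} D h a (f : pt n -> R) k :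
  iter k (qop D h) (tr a f) = tr a (iter k (qop D h) f).
Proof. by elim: k => [|k IH] //=; rewrite IH qop_tr. Qed.

Lemma dheat_coef_bound {n} D h (f : pt n -> R) M x : 0 < D -> 0 < h ->
  (forall y, Rabs (f y) <= M) ->
  expbounded M (rate n D h) (fun k => iter k (qop D h) f x / INR (Factorial.fact k)).
Proof.
move=> HD Hh H k; have Hk := INR_fact_lt_0 k.
rewrite Rabs_div; last lra.
rewrite (Rabs_pos_eq (INR _)); last lra.
have -> : M * (rate n D h ^ k / INR (Factorial.fact k)) =
          rate n D h ^ k * M / INR (Factorial.fact k) by rewrite /Rdiv; ring.
apply: Rmult_le_compat_r; first by apply: Rlt_le; apply: Rinv_0_lt_compat.
exact: iter_qop_abs.
Qed.

(** The series is at most M exp(rate t), and the prefactor cancels this exponential exactly; hence a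
    contraction uniformly in the step h. *)
Lemma dheat_bound {n} D h t (f : pt n -> R) M x : 0 < D -> 0 < h -> 0 <= t ->
  (forall y, Rabs (f y) <= M) -> Rabs (dheat D h t f x) <= M.
Proof.
move=> HD Hh Ht H; rewrite /dheat Rabs_mult (Rabs_pos_eq (exp _)); last exact: Rlt_le (exp_pos _).
have Hb := expbounded_le _ _ _ t (rate_ge0 n D h HD Hh) (dheat_coef_bound D h f M x HD Hh H).
apply: Rle_trans (Rmult_le_compat_l _ _ _ (Rlt_le _ _ (exp_pos _)) Hb) _.
rewrite (Rabs_pos_eq t) // Rmult_comm Rmult_assoc -exp_plus.
have -> : rate n D h * t + - (rate n D h * t) = 0 by ring.
rewrite exp_0; lra.
Qed.

Lemma dheat_0 {n} D h (f : pt n -> R) : dheat D h 0 f = f.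
Proof.
apply: functional_extensionality => x.
rewrite /dheat PSeries_0 Rmult_0_r Ropp_0 exp_0 /=; field.
Qed.

Lemma dheat_lin {n} D h t a (f g : pt n -> R) x : 0 < D -> 0 < h -> bounded f -> bounded g ->
  dheat D h t (fun y => a * f y + g y) x = a * dheat D h t f x + dheat D h t g x.
Proof.
move=> HD Hh [M HM] [N HN]; rewrite /dheat.
have Hf := expbounded_pseries _ _ _ t (rate_ge0 n D h HD Hh) (dheat_coef_bound D h f M x HD Hh HM).
have Hg := expbounded_pseries _ _ _ t (rate_ge0 n D h HD Hh) (dheat_coef_bound D h g N x HD Hh HN).
rewrite -Rmult_assoc (Rmult_comm a) Rmult_assoc -Rmult_plus_distr_l; congr Rmult.
rewrite -PSeries_scal -PSeries_plus //; last first.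
  by apply: ex_pseries_scal => //; rewrite /mult /= Rmult_comm.
apply: PSeries_ext => k; rewrite iter_qop_lin /PS_plus /PS_scal /plus /scal /= /mult /=.
rewrite /Rdiv; ring.
Qed.

Lemma dheat_tr {n} D h t a (f : pt n -> R) : dheat D h t (tr a f) = tr a (dheat D h t f).
Proof.
apply: functional_extensionality => x; rewrite /dheat {2}/tr; congr Rmult.
by apply: PSeries_ext => k; rewrite iter_qop_tr.
Qed.

Lemma dheat_inv_op {n} D h t : 0 < D -> 0 < h -> 0 <= t -> inv_op 1 (@dheat n D h t).
Proof.
move=> HD Hh Ht; split; first lra.
- by move=> a f g [Hf _] [Hg _] x; apply: dheat_lin.
- by move=> f M _ H x; rewrite Rmult_1_l; apply: dheat_bound.
- by move=> a f _; apply: dheat_tr.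
Qed.

Lemma is_pseries_sum {n : nat} (a : 'I_n -> nat -> R) (l : 'I_n -> R) (t : R) :
  (forall i, is_pseries (a i) t (l i)) ->
  is_pseries (fun k => \big[Rplus/0]_(i < n) a i k) t (\big[Rplus/0]_(i < n) l i).
Proof.
elim: n a l => [|n IH] a l H.
  rewrite big_ord0; apply: (is_pseries_ext (fun _ => 0)).
    by move=> k; rewrite big_ord0.
  apply: (is_series_ext (fun _ => 0)).
    by move=> k; rewrite /scal /= /mult /=; ring.
  rewrite /is_series; apply: (filterlim_ext (fun _ => 0)); last exact: filterlim_const.
  by move=> k; rewrite sum_n_const; rewrite Rmult_0_r.
rewrite big_ord_recl.
apply: (is_pseries_ext (PS_plus (a ord0) (fun k => \big[Rplus/0]_(i < n) a (lift ord0 i) k))).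
  by move=> k; rewrite big_ord_recl.
by apply: is_pseries_plus => //; apply: IH.
Qed.

(** [qop] is a finite combination of shifts, so it passes through the convergent series term by
    term. *)
Lemma qop_dheat {n} D h t (f : pt n -> R) x : 0 < D -> 0 < h -> bounded f ->
  qop D h (dheat D h t f) x = dheat D h t (qop D h f) x.
Proof.
move=> HD Hh [M HM].
have Hc y := expbounded_pseries _ _ _ t (rate_ge0 n D h HD Hh) (dheat_coef_bound D h f M y HD Hh HM).
rewrite {1}/qop /dheat; set e := exp _.
set g := fun k y => iter k (qop D h) f y / INR (Factorial.fact k).
transitivity (e * (D / h ^ 2 * \big[Rplus/0]_(i < n)
   (PSeries (fun k => g k (shift x i h)) t + PSeries (fun k => g k (shift x i (- h))) t))).
  rewrite -Rmult_assoc (Rmult_comm e) Rmult_assoc -(sum_scal e).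
  by congr Rmult; apply: eq_bigr => i _; exact: esym (Rmult_plus_distr_l _ _ _).
congr Rmult.
have HS : is_pseries (fun k => \big[Rplus/0]_(i < n) (g k (shift x i h) + g k (shift x i (- h)))) t
   (\big[Rplus/0]_(i < n) (PSeries (fun k => g k (shift x i h)) t + PSeries (fun k => g k (shift x i (- h))) t)).
  apply: is_pseries_sum => i.
  by apply: is_pseries_plus; apply: PSeries_correct; apply: Hc.
rewrite -(is_pseries_unique _ _ _ HS) -PSeries_scal; apply: PSeries_ext => k.
rewrite /PS_scal /g -iterSr iterS {3}/qop /scal /= /mult /= /Rdiv !Rmult_assoc.
congr Rmult; congr Rmult; rewrite [RHS]Rmult_comm -sum_scal.
by apply: eq_bigr => i _; ring.
Qed.

Lemma lapl_dheat {n} D h t (f : pt n -> R) x : 0 < D -> 0 < h -> bounded f ->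
  lapl D h (dheat D h t f) x = dheat D h t (lapl D h f) x.
Proof.
move=> HD Hh Hf; rewrite laplE qop_dheat //.
have -> : lapl D h f = fun y => - rate n D h * f y + qop D h f y.
  by apply: functional_extensionality => y; rewrite laplE; ring.
rewrite dheat_lin //; first ring.
by case: Hf => M HM; exists (rate n D h * M) => y; apply: qop_abs.
Qed.

(** The generator is bounded, so the derivative exists at every real t; in particular it is
    two-sided at t = 0, as [discrete_max_principle] asks. *)
Lemma is_derive_dheat {n} D h t (f : pt n -> R) x : 0 < D -> 0 < h -> bounded f ->
  is_derive (fun s => dheat D h s f x) t (lapl D h (dheat D h t f) x).
Proof.
move=> HD Hh Hf; rewrite laplE qop_dheat //; case: Hf => M HM.
have Hr := expbounded_radius _ _ _ t (rate_ge0 n D h HD Hh) (dheat_coef_bound D h f M x HD Hh HM).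
have H1 := is_derive_PSeries _ _ Hr.
have H2 : is_derive (fun s => exp (- (rate n D h * s))) t (- rate n D h * exp (- (rate n D h * t))).
  by auto_derive => //; ring.
have := is_derive_mult _ _ t _ _ H2 H1 Rmult_comm.
rewrite /dheat.
rewrite /plus /= /mult /=.
congr is_derive.
rewrite Rplus_comm; congr Rplus; last by ring.
congr Rmult; apply: PSeries_ext => k.
rewrite /PS_derive -iterSr iterS; have -> : Factorial.fact k.+1 = (k.+1 * Factorial.fact k)%coq_nat by [].
rewrite mult_INR; field; split; [exact: INR_fact_neq_0 | exact: not_0_INR].
Qed.

(** * Maximum principle and semigroup law for the discrete equation *)

Lemma exp_le (a b : R) : a <= b -> exp a <= exp b.
Proof. by case=> [/exp_increasing /Rlt_le | ->]; [|right]. Qed.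

Lemma nonincr_derive (g dg : R -> R) (a b : R) : a <= b ->
  (forall t, a <= t <= b -> is_derive g t (dg t)) ->
  (forall t, a <= t <= b -> dg t <= 0) -> g b <= g a.
Proof.
move=> Hab Hd Hn.
have := MVT_gen g a b dg; rewrite /= Rmin_left // Rmax_right //; case.
- by move=> x Hx; apply: Hd; lra.
- move=> x Hx; apply/continuity_pt_filterlim.
  by apply: ex_derive_continuous; exists (dg x); apply: Hd; lra.
- move=> c [Hc E]; have := Hn c Hc; have : 0 <= b - a by lra.
  nra.
Qed.

Lemma abs_derive_le (g dg : R -> R) (a b A : R) : a <= b ->
  (forall t, a <= t <= b -> is_derive g t (dg t)) ->
  (forall t, a <= t <= b -> Rabs (dg t) <= A) -> Rabs (g b - g a) <= (b - a) * A.
Proof.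
move=> Hab Hd Hn; apply: Rabs_le; split.
  have := nonincr_derive (fun t => - g t - A * t) (fun t => - dg t - A * 1) a b Hab.
  have H t : a <= t <= b -> is_derive (fun t => - g t - A * t) t (- dg t - A * 1).
    move=> Ht; apply: (is_derive_minus (fun t => - g t) (fun t => A * t)).
      by apply: (is_derive_opp g); apply: Hd.
    by apply: is_derive_scal; apply: is_derive_id.
  move=> /(_ H) H2; suff : - g b - A * b <= - g a - A * a by lra.
  by apply: H2 => t /Hn /Rabs_le_between; lra.
have := nonincr_derive (fun t => g t - A * t) (fun t => dg t - A * 1) a b Hab.
have H t : a <= t <= b -> is_derive (fun t => g t - A * t) t (dg t - A * 1).
  move=> Ht; apply: (is_derive_minus g (fun t => A * t)); first exact: Hd.
  by apply: is_derive_scal; apply: is_derive_id.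
move=> /(_ H) H2; suff : g b - A * b <= g a - A * a by lra.
by apply: H2 => t /Hn /Rabs_le_between; lra.
Qed.

(* After the substitution y = e^(ct) w the inequality reads y' <= Q y with Q positive and Q 1 = c;
   iterating it turns the crude bound y <= B into y <= B (ct)^k / k! for every k. *)
Lemma discrete_max_principle {n} D h T B (w dw : R -> pt n -> R) : 0 < D -> 0 < h ->
  (forall t x, 0 <= t <= T -> is_derive (fun s => w s x) t (dw t x)) ->
  (forall t x, 0 <= t <= T -> w t x <= B) ->
  (forall t x, 0 <= t <= T -> dw t x <= lapl D h (w t) x) ->
  (forall x, w 0 x <= 0) ->
  forall t x, 0 <= t <= T -> w t x <= 0.
Proof.
move=> HD Hh Hd HB Hl H0 t x Ht.
set c := rate n D h; have Hc : 0 <= c by apply: rate_ge0.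
(* This bounds exp(c s) w on [0, T]; the maximum with 0 keeps it nonnegative when B is negative. *)
pose B' := exp (c * T) * Rmax B 0.
have HB0 : 0 <= Rmax B 0 := Rmax_r _ _.
have Hk k : forall s y, 0 <= s <= T ->
    exp (c * s) * w s y <= B' * ((c * s) ^ k / INR (Factorial.fact k)).
  elim: k => [|k IH] s y Hs.
    rewrite /= Rdiv_1_r Rmult_1_r /B'.
    apply: (Rle_trans _ (exp (c * s) * Rmax B 0)).
      apply: Rmult_le_compat_l; first exact: Rlt_le (exp_pos _).
      by apply: Rle_trans (HB s y Hs) (Rmax_l _ _).
    apply: Rmult_le_compat_r => //; apply: exp_le.
    by apply: Rmult_le_compat_l => //; lra.
  have Hf := INR_fact_lt_0 k.
  pose g r := exp (c * r) * w r y - B' * ((c * r) ^ k.+1 / INR (Factorial.fact k.+1)).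
  pose dg r := (c * exp (c * r) * w r y + exp (c * r) * dw r y) -
     B' * c * ((c * r) ^ k / INR (Factorial.fact k)).
  have Hg r : 0 <= r <= s -> is_derive g r (dg r).
    move=> Hr; apply: is_derive_minus.
      apply: (is_derive_mult (fun r => exp (c * r)) (fun r => w r y)).
      - by auto_derive => //; ring.
      - by apply: Hd; lra.
      - exact: Rmult_comm.
    have Ef : INR (Factorial.fact k.+1) = INR k.+1 * INR (Factorial.fact k).
      by rewrite -mult_INR.
    rewrite Ef; auto_derive => //.
    rewrite -/(INR k.+1); have := not_0_INR k.+1 (PeanoNat.Nat.neq_succ_0 k).
    by move: (INR k.+1) => K HK; field; split; lra.
  have Hn r : 0 <= r <= s -> dg r <= 0.
    move=> Hr; rewrite /dg.
    have Hr' : 0 <= r <= T by lra.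
    have He := exp_pos (c * r).
    have L := Rmult_le_compat_l _ _ _ (Rlt_le _ _ He) (Hl r y Hr').
    rewrite laplE -/c in L.
    have Q : exp (c * r) * qop D h (w r) y <= c * (B' * ((c * r) ^ k / INR (Factorial.fact k))).
      rewrite -(qop_const D h (B' * ((c * r) ^ k / INR (Factorial.fact k))) y).
      have <- : qop D h (fun z => exp (c * r) * w r z + 0) y = exp (c * r) * qop D h (w r) y.
        by rewrite (qop_lin D h (exp (c * r)) (w r) (fun _ => 0)) qop_const; ring.
      by apply: qop_le => // z; rewrite Rplus_0_r; apply: IH.
    lra.
  have := nonincr_derive g dg 0 s (proj1 Hs) Hg Hn.
  rewrite /g Rmult_0_r exp_0 Rmult_1_l pow_i; last exact/ltP.
  rewrite Rdiv_0_l Rmult_0_r; move: (H0 y); lra.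
suff : exp (c * t) * w t x <= 0.
  have := exp_pos (c * t); case: (Rle_lt_dec (w t x) 0) => // Hw He.
  have := Rmult_lt_0_compat _ _ He Hw; lra.
have HL : is_lim_seq (fun k => B' * ((c * t) ^ k / INR (Factorial.fact k))) (B' * 0).
  apply: (is_lim_seq_scal_l _ B' 0); apply/is_lim_seq_Reals; exact: cv_speed_pow_fact.
rewrite -(Rmult_0_r B').
apply: (is_lim_seq_le (fun _ => exp (c * t) * w t x) _ (exp (c * t) * w t x) (B' * 0)) (HL).
- by move=> k; apply: Hk.
- exact: is_lim_seq_const.
Qed.

Lemma lapl_lin {n} D h a (f g : pt n -> R) x :
  lapl D h (fun y => a * f y + g y) x = a * lapl D h f x + lapl D h g x.
Proof. rewrite !laplE qop_lin; ring. Qed.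

Lemma lapl_const {n} D h c (x : pt n) : lapl D h (fun _ => c) x = 0.
Proof. rewrite laplE qop_const; ring. Qed.

Lemma dheat_bounded {n} D h t (f : pt n -> R) : 0 < D -> 0 < h -> 0 <= t ->
  bounded f -> bounded (dheat D h t f).
Proof. by move=> HD Hh Ht [M HM]; exists M => x; apply: dheat_bound. Qed.

(** Both sides solve the discrete heat equation in t with the same datum at t = 0, so the maximum
    principle applies to their difference and to its negative; this avoids multiplying power
    series. *)
Lemma dheat_semigroup {n} D h s t (f : pt n -> R) x : 0 < D -> 0 < h -> 0 <= s -> 0 <= t ->
  bounded f -> dheat D h (t + s) f x = dheat D h t (dheat D h s f) x.
Proof.
move=> HD Hh Hs Ht Hf; have Hg := dheat_bounded D h s f HD Hh Hs Hf.
have [M HM] := Hf.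
have key a b (Hab : a = 1 /\ b = -1 \/ a = -1 /\ b = 1) :
    a * dheat D h (t + s) f x + b * dheat D h t (dheat D h s f) x <= 0.
  apply: (discrete_max_principle D h t (2 * M)
    (fun r y => a * dheat D h (r + s) f y + b * dheat D h r (dheat D h s f) y)
    (fun r y => a * lapl D h (dheat D h (r + s) f) y + b * lapl D h (dheat D h r (dheat D h s f)) y)) => //.
  - move=> r y Hr; apply: is_derive_plus; apply: is_derive_scal; last exact: is_derive_dheat.
    rewrite -[lapl _ _ _ _]Rmult_1_l.
    apply: (is_derive_comp (fun u => dheat D h u f y) (fun u => u + s)).
      exact: is_derive_dheat.
    by auto_derive => //; ring.
  - move=> r y Hr.
    have := dheat_bound D h (r + s) f M y HD Hh ltac:(lra) HM.
    have := dheat_bound D h r (dheat D h s f) M y HD Hh ltac:(lra)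
       (fun z => dheat_bound D h s f M z HD Hh Hs HM).
    move=> /Rabs_le_between A1 /Rabs_le_between A2.
    case: Hab => [] [-> ->]; lra.
  - move=> r y Hr; apply: Req_le; symmetry.
    rewrite (lapl_lin D h a (dheat D h (r + s) f) (fun y => b * dheat D h r (dheat D h s f) y)).
    congr Rplus; transitivity (b * lapl D h (dheat D h r (dheat D h s f)) y + lapl D h (fun _ => 0) y).
      by rewrite -lapl_lin; congr (lapl _ _ _ y); apply: functional_extensionality => z; ring.
    by rewrite lapl_const; ring.
  - move=> y; rewrite Rplus_0_l dheat_0; case: Hab => [] [-> ->]; lra.
  - lra.
have := key 1 (-1) (or_introl (conj erefl erefl)).
have := key (-1) 1 (or_intror (conj erefl erefl)).
lra.
Qed.

(** * Bernstein's gradient estimate, uniform in the step *)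

(** Discrete form of Lap(f^2) = 2 f Lap f + 2 |grad f|^2: the identity holds with the squares of all
    forward and backward increments, of which a single one is kept. *)
Lemma lapl_sqr_ge {n} D h (f : pt n -> R) x (i : 'I_n) : 0 < D -> 0 < h ->
  2 * f x * lapl D h f x + D / h ^ 2 * (f (shift x i h) - f x) ^ 2 <=
  lapl D h (fun y => f y ^ 2) x.
Proof.
move=> HD Hh; have Hs := step_gt0 D h HD Hh.
pose G j := (f (shift x j h) - f x) ^ 2 + (f (shift x j (- h)) - f x) ^ 2.
have E : lapl D h (fun y => f y ^ 2) x =
    2 * f x * lapl D h f x + D / h ^ 2 * \big[Rplus/0]_(j < n) G j.
  rewrite /lapl.
  have -> a b c : 2 * a * (b * c) + b * \big[Rplus/0]_(j < n) G j =
     b * (2 * a * c + \big[Rplus/0]_(j < n) G j) by ring.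
  rewrite -(sum_scal (2 * f x)) -sum_plus; congr Rmult.
  by apply: eq_bigr => j _; rewrite /G; ring.
rewrite E; apply: Rplus_le_compat_l; apply: Rmult_le_compat_l; first lra.
apply: Rle_trans (sum_term_le G i _) => [|j]; rewrite /G.
  have := pow2_ge_0 (f (shift x i (- h)) - f x); lra.
by apply: Rplus_le_le_0_compat; apply: pow2_ge_0.
Qed.

Lemma lapl_shift {n} D h (f : pt n -> R) i r x :
  lapl D h (fun y => f (shift y i r)) x = lapl D h f (shift x i r).
Proof.
rewrite /lapl; congr Rmult; apply: eq_bigr => j _.
by rewrite !(shift_comm _ j i).
Qed.

(* Bernstein's method: by [lapl_sqr_ge], (D/h^2) t p^2 + w^2 is a subsolution, where w is the
   solution and p its increment over one step. *)
Lemma dheat_increment {n} D h t (f : pt n -> R) M i x : 0 < D -> 0 < h -> 0 <= t ->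
  (forall y, Rabs (f y) <= M) ->
  D / h ^ 2 * t * (dheat D h t f (shift x i h) - dheat D h t f x) ^ 2 <= M ^ 2.
Proof.
move=> HD Hh Ht HM; have Hf : bounded f by exists M.
have Hs := step_gt0 D h HD Hh; set s := D / h ^ 2 in Hs *.
pose w r y := dheat D h r f y.
pose p r y := w r (shift y i h) - w r y.
have Hw r y : 0 <= r -> Rabs (w r y) <= M by move=> Hr; apply: dheat_bound.
have M0 : 0 <= M := Rle_trans _ _ _ (Rabs_pos _) (HM x).
have sqr_le a : Rabs a <= M -> 0 <= a ^ 2 <= M ^ 2.
  by move=> /Rabs_le_between; nra.
have Hp r y : lapl D h (p r) y = lapl D h (w r) (shift y i h) - lapl D h (w r) y.
  rewrite -(lapl_shift D h (w r)).
  have -> : p r = fun z => -1 * w r z + w r (shift z i h).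
    by apply: functional_extensionality => z; rewrite /p; ring.
  by rewrite (lapl_lin D h (-1) (w r)); ring.
have key := discrete_max_principle D h t (s * t * (4 * M ^ 2))
  (fun r y => s * r * p r y ^ 2 + (w r y ^ 2 - M ^ 2))
  (fun r y => s * (p r y ^ 2 + r * (2 * p r y * lapl D h (p r) y)) + 2 * w r y * lapl D h (w r) y) HD Hh.
suff : s * t * p t x ^ 2 + (w t x ^ 2 - M ^ 2) <= 0.
  have := pow2_ge_0 (w t x); rewrite /p /w; lra.
apply: key; last lra.
- move=> r y Hr.
  have Hdw z := is_derive_dheat D h r f z HD Hh Hf.
  have Hdp : is_derive (fun u => p u y) r (lapl D h (p r) y).
    by rewrite Hp; apply: (is_derive_minus (fun u => w u (shift y i h)) (fun u => w u y)); apply: Hdw.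
  have -> : s * (p r y ^ 2 + r * (2 * p r y * lapl D h (p r) y)) + 2 * w r y * lapl D h (w r) y =
    s * (1 * (p r y * p r y) + r * (lapl D h (p r) y * p r y + p r y * lapl D h (p r) y)) +
    (lapl D h (w r) y * w r y + w r y * lapl D h (w r) y - 0) by ring.
  apply: (is_derive_ext (fun u => s * (u * (p u y * p u y)) + (w u y * w u y - M ^ 2))).
    by move=> u /=; ring.
  apply: is_derive_plus.
    apply: is_derive_scal; apply: is_derive_mult; [exact: is_derive_id | | exact: Rmult_comm].
    by apply: is_derive_mult => //; exact: Rmult_comm.
  apply: is_derive_minus; last exact: is_derive_const.
  by apply: is_derive_mult; [apply: Hdw | apply: Hdw | exact: Rmult_comm].
- move=> r y Hr.
  have [_ H1] := sqr_le _ (Hw r y ltac:(lra)).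
  have /Rabs_le_between A1 := Hw r y ltac:(lra).
  have /Rabs_le_between A2 := Hw r (shift y i h) ltac:(lra).
  have Hpp : 0 <= p r y ^ 2 <= 4 * M ^ 2.
    split; first exact: pow2_ge_0.
    have A3 : - (2 * M) <= p r y <= 2 * M by rewrite /p; lra.
    by clear -A3; nra.
  have : s * r * p r y ^ 2 <= s * t * (4 * M ^ 2).
    apply: Rmult_le_compat; try lra; first by apply: Rmult_le_pos; lra.
    by apply: Rmult_le_compat_l; lra.
  lra.
- move=> r y Hr.
  rewrite (lapl_lin D h (s * r) (fun z => p r z ^ 2) (fun z => w r z ^ 2 - M ^ 2)).
  have -> : lapl D h (fun z => w r z ^ 2 - M ^ 2) y = lapl D h (fun z => w r z ^ 2) y.
    transitivity (1 * lapl D h (fun z => w r z ^ 2) y + lapl D h (fun _ => - M ^ 2) y).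
      by rewrite -(lapl_lin D h 1); congr (lapl _ _ _ y); apply: functional_extensionality => z; ring.
    by rewrite lapl_const; ring.
  (* The square kept in [L1] absorbs the term s p^2 that comes from differentiating the factor r;
     the one in [L2] is dropped. *)
  have L1 := lapl_sqr_ge D h (w r) y i HD Hh.
  have L2 := lapl_sqr_ge D h (p r) y i HD Hh.
  rewrite -/s in L1 L2; rewrite -/(p r y) in L1.
  have {}L2 : 2 * p r y * lapl D h (p r) y <= lapl D h (fun z => p r z ^ 2) y.
    have := Rmult_le_pos _ _ (Rlt_le _ _ Hs) (pow2_ge_0 (p r (shift y i h) - p r y)); lra.
  have Hsr : 0 <= s * r by apply: Rmult_le_pos; lra.
  have := Rmult_le_compat_l _ _ _ Hsr L2; lra.
- move=> y; rewrite Rmult_0_r Rmult_0_l /w dheat_0.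
  have := sqr_le _ (HM y); lra.
Qed.

(** Taking the root of [dheat_increment] bounds one step by M h / sqrt(D t), and m steps telescope.
    Only multiples of h are reached here; [heat_lips] adapts h to the desired displacement. *)
Lemma dheat_lipschitz {n} D h t (f : pt n -> R) M i x m : 0 < D -> 0 < h -> 0 < t ->
  (forall y, Rabs (f y) <= M) ->
  Rabs (dheat D h t f (shift x i (INR m * h)) - dheat D h t f x) <= M / sqrt (D * t) * (INR m * h).
Proof.
move=> HD Hh Ht HM.
have M0 : 0 <= M := Rle_trans _ _ _ (Rabs_pos _) (HM x).
have Hsq : 0 < sqrt (D * t) by apply: sqrt_lt_R0; apply: Rmult_lt_0_compat.
have Hss : sqrt (D * t) * sqrt (D * t) = D * t by apply: sqrt_sqrt; apply: Rlt_le; apply: Rmult_lt_0_compat.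
have H1 y : Rabs (dheat D h t f (shift y i h) - dheat D h t f y) <= M / sqrt (D * t) * h.
  have H := dheat_increment D h t f M i y HD Hh (Rlt_le _ _ Ht) HM.
  set p := _ - _ in H *.
  have E : (M / sqrt (D * t) * h) ^ 2 = M ^ 2 / (D * t) * h ^ 2.
    rewrite -{2}Hss; field; lra.
  have P0 : 0 <= M / sqrt (D * t) * h.
    apply: Rmult_le_pos; last lra; apply: Rmult_le_pos => //.
    exact: Rlt_le (Rinv_0_lt_compat _ Hsq).
  rewrite -(Rabs_pos_eq _ P0); apply: Rsqr_le_abs_0; rewrite !Rsqr_pow2 E.
  have Hk : 0 < h ^ 2 / (D * t).
    apply: Rdiv_lt_0_compat; first exact: pow_lt.
    exact: Rmult_lt_0_compat.
  have := Rmult_le_compat_r _ _ _ (Rlt_le _ _ Hk) H.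
  have -> : D / h ^ 2 * t * p ^ 2 * (h ^ 2 / (D * t)) = p ^ 2 by field; lra.
  have -> : M ^ 2 * (h ^ 2 / (D * t)) = M ^ 2 / (D * t) * h ^ 2 by field; lra.
  by [].
elim: m => [|m IH].
  by rewrite /= Rmult_0_l shift0 Rminus_diag_eq // Rabs_R0; lra.
have -> : shift x i (INR m.+1 * h) = shift (shift x i (INR m * h)) i h.
  by rewrite shift_shift; congr shift; rewrite S_INR; ring.
set a := dheat D h t f _; set b := dheat D h t f x in IH *.
set c := dheat D h t f (shift x i (INR m * h)) in IH.
have -> : a - b = (a - c) + (c - b) by ring.
apply: Rle_trans (Rabs_triang _ _) _.
have := H1 (shift x i (INR m * h)); rewrite -/a -/c S_INR; lra.
Qed.

(** * Directional derivatives *)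

(** The explicit modulus e does not depend on x, so limits taken pointwise still come with a uniform
    error bound. *)
Lemma uniform_cauchy_limit {A : Type} (g : nat -> A -> R) (e : nat -> R) (x : A) :
  is_lim_seq e 0 -> (forall m k, Rabs (g m x - g k x) <= e m + e k) ->
  is_lim_seq (fun m => g m x) (real (Lim_seq (fun m => g m x))) /\
  forall m, Rabs (g m x - real (Lim_seq (fun m => g m x))) <= e m.
Proof.
move=> He Hg.
have [l Hl] : ex_finite_lim_seq (fun m => g m x).
  apply/ex_lim_seq_cauchy_corr => eps.
  have /is_lim_seq_spec /(_ (pos_div_2 eps)) [N HN] := He.
  exists N => m k Hm Hk; apply: Rle_lt_trans (Hg m k) _.
  have := HN m Hm; have := HN k Hk => /=; rewrite !Rminus_0_r.
  move=> /Rabs_def2 [] A1 _ /Rabs_def2 [] A2 _; lra.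
rewrite (is_lim_seq_unique _ _ Hl) /=; split=> // m.
have H1 : is_lim_seq (fun k => Rabs (g m x - g k x)) (Rabs (g m x - l)).
  apply: (is_lim_seq_abs _ (Finite (g m x - l))).
  by apply: is_lim_seq_minus' => //; apply: is_lim_seq_const.
have H2 : is_lim_seq (fun k => e m + e k) (e m + 0).
  by apply: is_lim_seq_plus' => //; apply: is_lim_seq_const.
have := is_lim_seq_le _ _ _ _ (fun k => Hg m k) H1 H2; rewrite /=; lra.
Qed.

Lemma is_lim_seq_inv_S : is_lim_seq (fun m => / INR m.+1) 0.
Proof.
apply: (is_lim_seq_inv (fun m => INR m.+1) p_infty) => //.
by apply/(is_lim_seq_incr_1 INR); exact: is_lim_seq_INR.
Qed.

Lemma inv_S_pos m : 0 < / INR m.+1.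
Proof. by apply: Rinv_0_lt_compat; apply: lt_0_INR; apply/ltP. Qed.

Lemma inv_S_lt e : 0 < e -> exists m, / INR m.+1 < e.
Proof.
move=> He; have /is_lim_seq_spec /(_ (mkposreal e He)) [N HN] := is_lim_seq_inv_S.
exists N; have := HN N (le_n N); rewrite Rminus_0_r /= => /Rabs_def2; lra.
Qed.

Definition partial {n : nat} (i : 'I_n) (f g : pt n -> R) : Prop :=
  forall x, is_derive (fun r => f (shift x i r)) 0 (g x).

(** Only displacements along the axes are tested: this is what [dheat_lipschitz] provides and what
    bounds partial derivatives. *)
Definition lips {n : nat} (L : R) (f : pt n -> R) : Prop :=
  forall i r x, Rabs (f (shift x i r) - f x) <= L * Rabs r.

Lemma partial_derive {n} (i : 'I_n) f g x r : partial i f g ->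
  is_derive (fun s => f (shift x i s)) r (g (shift x i r)).
Proof.
move=> H; have := H (shift x i r); rewrite -{1}(Rminus_diag_eq r r erefl) => Hd.
apply: (is_derive_ext (fun s => f (shift (shift x i r) i (s - r)))).
  by move=> s; rewrite shift_shift; congr (f (shift x i _)); ring.
rewrite -[g _]Rmult_1_l.
apply: (is_derive_comp (fun s => f (shift (shift x i r) i s)) (fun s => s - r)) => //.
by auto_derive => //; ring.
Qed.

(** Mean value inequality for s -> f(x + s e_i) - c s, treated separately for the two signs of r. *)
Lemma partial_increment {n} (i : 'I_n) f g x r c A : partial i f g ->
  (forall s, Rabs s <= Rabs r -> Rabs (g (shift x i s) - c) <= A) ->
  Rabs (f (shift x i r) - f x - r * c) <= A * Rabs r.
Proof.
move=> H HA.
have Hd s : is_derive (fun s => f (shift x i s) - c * s) s (g (shift x i s) - c * 1).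
  apply: is_derive_minus; first exact: partial_derive.
  by apply: is_derive_scal; apply: is_derive_id.
case: (Rle_lt_dec 0 r) => Hr.
  have := abs_derive_le _ _ 0 r A Hr (fun s _ => Hd s).
  rewrite shift0 Rmult_0_r Rminus_0_r Rminus_0_r (Rabs_pos_eq r) //.
  move=> K; rewrite (Rmult_comm A).
  have -> : f (shift x i r) - f x - r * c = f (shift x i r) - c * r - f x by ring.
  apply: K => s Hs; rewrite Rmult_1_r; apply: HA.
  by rewrite !Rabs_pos_eq; lra.
have := abs_derive_le _ _ r 0 A (Rlt_le _ _ Hr) (fun s _ => Hd s).
rewrite shift0 Rmult_0_r Rminus_0_r (Rabs_left r) // => K.
rewrite -Rabs_Ropp.
have -> : - (f (shift x i r) - f x - r * c) = f x - (f (shift x i r) - c * r) by ring.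
have -> : A * - r = (0 - r) * A by ring.
apply: K => s Hs; rewrite Rmult_1_r; apply: HA.
by rewrite !Rabs_left1; lra.
Qed.

(** A uniformly continuous derivative makes difference quotients converge in sup norm, the form of
    differentiability that bounded operators preserve; [partial_intro] is the way back. *)
Lemma partial_uniform {n} (i : 'I_n) f g e : partial i f g -> BUC g -> 0 < e ->
  exists d, 0 < d /\ forall x r, Rabs r < d ->
    Rabs (f (shift x i r) - f x - r * g x) <= e * Rabs r.
Proof.
move=> H Hg He; have [d [Hd Hs]] := BUC_shift_small g e Hg He.
exists d; split=> // x r Hr; apply: (partial_increment _ _ g) => // s Hsr.
by apply: Rlt_le; apply: Hs; lra.
Qed.

Lemma partial_intro {n} (i : 'I_n) (f g : pt n -> R) :
  (forall e, 0 < e -> exists d, 0 < d /\ forall x r, Rabs r < d ->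
    Rabs (f (shift x i r) - f x - r * g x) <= e * Rabs r) -> partial i f g.
Proof.
move=> H x; apply/is_derive_Reals => e He.
have [|d [Hd Hs]] := H (e / 2); first lra.
exists (mkposreal d Hd) => r Hr0 /= Hr; rewrite Rplus_0_l shift0.
have -> : (f (shift x i r) - f x) / r - g x = (f (shift x i r) - f x - r * g x) / r by field.
rewrite Rabs_div //; have Ha := Rabs_pos_lt _ Hr0.
apply: (Rle_lt_trans _ (e / 2)); last lra.
apply/Rle_div_l => //; exact: Hs.
Qed.

Lemma partial_le_lips {n} (i : 'I_n) f g L x : partial i f g -> lips L f -> Rabs (g x) <= L.
Proof.
move=> H HL; apply: Rle_plus_epsilon => e He.
have /is_derive_Reals /(_ e He) [d Hd] := H x.
have Hp := cond_pos d.
have := Hd (d / 2) ltac:(lra) ltac:(rewrite Rabs_pos_eq; lra).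
rewrite Rplus_0_l shift0 => K.
have := HL i (d / 2) x; set a := f _ - f _ in K *.
move=> K2; have : Rabs (a / (d / 2)) <= L.
  rewrite Rabs_div; last lra.
  apply/Rle_div_l => //; apply: Rabs_pos_lt; lra.
move: K => /Rabs_def2 [K3 K4] /Rabs_le_between K5.
apply: Rabs_le; lra.
Qed.

Lemma partial_minus {n} (i : 'I_n) f g f' g' : partial i f f' -> partial i g g' ->
  partial i (fun x => f x - g x) (fun x => f' x - g' x).
Proof. by move=> H H' x; apply: (is_derive_minus (fun r => f (shift x i r))). Qed.

Lemma inv_op_partial {n} K (T : (pt n -> R) -> pt n -> R) i f g :
  inv_op K T -> BUC f -> BUC g -> partial i f g -> partial i (T f) (T g).
Proof.
move=> HT Hf Hg H; apply: partial_intro => e He.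
have K0 : 0 <= K by case: HT.
have [|d [Hd Hs]] := partial_uniform i f g (e / (K + 1)) H Hg; first by apply: Rdiv_lt_0_compat; lra.
exists d; split=> // x r Hr.
have Hfs : BUC (fun y => f (shift y i r)) by apply: BUC_shift.
have -> : T f (shift x i r) - T f x - r * T g x =
    T (fun y => f (shift y i r) - f y - r * g y) x.
  rewrite !(inv_op_minus K) //; try exact: BUC_scal; try exact: BUC_minus.
  by rewrite (inv_op_shift K) // (inv_op_scal K).
apply: (Rle_trans _ (K * (e / (K + 1) * Rabs r))).
  case: HT => _ _ B _; apply: B; last by move=> y; apply: Hs.
  by apply: BUC_minus; [apply: BUC_minus | apply: BUC_scal].
have E : e = (K + 1) * (e / (K + 1)) by field; lra.
rewrite -Rmult_assoc {2}E; apply: Rmult_le_compat_r; first exact: Rabs_pos.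
apply: Rmult_le_compat_r; last lra.
by apply: Rlt_le; apply: Rdiv_lt_0_compat; lra.
Qed.

Definition BUC1 {n : nat} (f : pt n -> R) : Prop :=
  BUC f /\ forall i, exists g, BUC g /\ partial i f g.

Definition Der {n : nat} (i : 'I_n) (f : pt n -> R) : pt n -> R :=
  fun x => Derive (fun r => f (shift x i r)) 0.

Definition BUC2 {n : nat} (f : pt n -> R) : Prop :=
  BUC1 f /\ forall i, BUC1 (Der i f).

Lemma partial_Der {n} (i : 'I_n) (f g : pt n -> R) : partial i f g -> Der i f = g.
Proof.
move=> H; apply: functional_extensionality => x; exact: is_derive_unique.
Qed.

Lemma BUC1_Der {n} (i : 'I_n) (f : pt n -> R) : BUC1 f -> BUC (Der i f) /\ partial i f (Der i f).
Proof. by move=> [_ /(_ i) [g [Hg H]]]; rewrite (partial_Der i f g). Qed.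

Lemma Der_minus {n} (f g : pt n -> R) i : BUC1 f -> BUC1 g ->
  Der i (fun x => f x - g x) = fun x => Der i f x - Der i g x.
Proof.
move=> Hf Hg; have [A1 A2] := BUC1_Der i f Hf; have [B1 B2] := BUC1_Der i g Hg.
by apply: partial_Der; apply: partial_minus.
Qed.

Lemma inv_op_BUC1 {n} K (T : (pt n -> R) -> pt n -> R) f :
  inv_op K T -> BUC1 f -> BUC1 (T f).
Proof.
move=> HT Hf; split; first by apply: (inv_op_BUC K) => //; case: Hf.
move=> i; have [A1 A2] := BUC1_Der i f Hf; exists (T (Der i f)); split.
  exact: (inv_op_BUC K).
by apply: (inv_op_partial K) => //; case: Hf.
Qed.

Lemma inv_op_Der {n} K (T : (pt n -> R) -> pt n -> R) f i :
  inv_op K T -> BUC1 f -> Der i (T f) = T (Der i f).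
Proof.
move=> HT Hf; have [A1 A2] := BUC1_Der i f Hf.
by apply: partial_Der; apply: (inv_op_partial K) => //; case: Hf.
Qed.

(** Completeness of C^1 for the Lipschitz seminorm: derivatives of two approximants differ by at
    most the Lipschitz constant of their difference, so they form a uniform Cauchy sequence. The
    second conclusion is the quantitative version, used for continuity in time. *)
Lemma BUC1_closure {n} (f : pt n -> R) : BUC f ->
  (forall e, 0 < e -> exists g, BUC1 g /\ lips e (fun x => f x - g x)) ->
  BUC1 f /\ forall e g i x, BUC1 g -> lips e (fun x => f x - g x) ->
    Rabs (Der i f x - Der i g x) <= e.
Proof.
move=> Hf H.
have HB : BUC1 f.
  split=> // i.
  pose F m := proj1_sig (constructive_indefinite_description _ (H (/ INR m.+1) (inv_S_pos m))).
  have HF m : BUC1 (F m) /\ lips (/ INR m.+1) (fun x => f x - F m x).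
    exact: (proj2_sig (constructive_indefinite_description _ (H (/ INR m.+1) (inv_S_pos m)))).
  have HC x m k : Rabs (Der i (F m) x - Der i (F k) x) <= / INR m.+1 + / INR k.+1.
    have [Hm Lm] := HF m; have [Hk Lk] := HF k.
    apply: (partial_le_lips i (fun x => F m x - F k x) (fun x => Der i (F m) x - Der i (F k) x)).
      by apply: partial_minus; [exact: (proj2 (BUC1_Der i _ Hm)) | exact: (proj2 (BUC1_Der i _ Hk))].
    move=> j r y; move: (Lm j r y) (Lk j r y).
    move=> /Rabs_le_between A1 /Rabs_le_between A2; apply: Rabs_le; lra.
  pose g x := real (Lim_seq (fun m => Der i (F m) x)).
  have Hg x m : Rabs (Der i (F m) x - g x) <= / INR m.+1.
    exact: (proj2 (uniform_cauchy_limit (fun m => Der i (F m)) _ x is_lim_seq_inv_S (HC x)) m).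
  exists g; split.
    apply: BUC_uniform_limit => e /inv_S_lt [m Hm]; exists (Der i (F m)); split.
      exact: (proj1 (BUC1_Der i _ (proj1 (HF m)))).
    move=> x; rewrite Rabs_minus_sym; have := Hg x m; lra.
  apply: partial_intro => e He.
  have [|m Hm] := inv_S_lt (e / 3); first lra.
  have [H1 L1] := HF m.
  have [D1 D2] := BUC1_Der i _ H1.
  have [|d [Hd Hs]] := partial_uniform i _ _ (e / 3) D2 D1; first lra.
  exists d; split=> // x r Hr.
  move: (Hs x r Hr) (L1 i r x) (Hg x m).
  (* The remainder of f is that of the approximant, plus the increment of f - [F m] (Lipschitz
     bound), plus r times the error in the derivative; each is at most e/3 times |r|. *)
  set a := F m _ - F m _ - _; set b := _ - _ - (_ - _); set c := Der i (F m) x - g x.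
  have -> : f (shift x i r) - f x - r * g x = a + b + r * c by rewrite /a /b /c; ring.
  move=> A1 A2 A3.
  apply: Rle_trans (Rabs_triang _ _) _.
  have := Rabs_triang a b; rewrite Rabs_mult.
  have Hr0 := Rabs_pos r.
  have := Rmult_le_compat_l _ _ _ Hr0 A3.
  have := Rmult_le_compat_l _ _ _ Hr0 (Rlt_le _ _ Hm).
  lra.
split=> // e g i x Hg HL.
apply: (partial_le_lips i (fun y => f y - g y) (fun y => Der i f y - Der i g y)) => //.
by apply: partial_minus; [exact: (proj2 (BUC1_Der i _ HB)) | exact: (proj2 (BUC1_Der i _ Hg))].
Qed.

(** * Mollification *)

Definition avg {n : nat} (d : R) (i : 'I_n) (f : pt n -> R) : pt n -> R :=
  fun x => / d * RInt (fun r => f (shift x i r)) 0 d.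

Lemma continuous_abs (f : R -> R) (a : R) :
  (forall e, 0 < e -> exists d, 0 < d /\ forall s, Rabs (s - a) < d -> Rabs (f s - f a) <= e) ->
  continuous f a.
Proof.
move=> H; apply/continuity_pt_filterlim => e He.
have [|d [Hd Hs]] := H (e / 2); first lra.
exists d; split=> // s [_ Hsd]; rewrite /dist /= /R_dist.
have := Hs s Hsd; lra.
Qed.

Lemma continuous_shift {n} (f : pt n -> R) x i r : BUC f ->
  continuous (fun s => f (shift x i s)) r.
Proof.
move=> Hf; apply: continuous_abs => e He; have [d [Hd Hs]] := BUC_shift_small f e Hf He.
exists d; split=> // s Hsr; apply: Rlt_le.
have -> : shift x i s = shift (shift x i r) i (s - r) by rewrite shift_shift; congr shift; ring.
exact: Hs.
Qed.

Lemma ex_RInt_shift {n} (f : pt n -> R) x i a b : BUC f ->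
  ex_RInt (fun s => f (shift x i s)) a b.
Proof. by move=> Hf; apply: ex_RInt_continuous => z _; apply: continuous_shift. Qed.

Lemma inv_op_avg {n} d (i : 'I_n) : 0 < d -> inv_op 1 (avg d i).
Proof.
move=> Hd; have Hi := Rinv_0_lt_compat _ Hd; split; first lra.
- move=> a f g Hf Hg x; rewrite /avg.
  have H1 := ex_RInt_shift f x i 0 d Hf; have H2 := ex_RInt_shift g x i 0 d Hg.
  rewrite (RInt_plus (fun r => a * f (shift x i r)) (fun r => g (shift x i r))) //; last first.
    exact: (ex_RInt_scal (fun r => f (shift x i r))).
  rewrite (RInt_scal (fun r => f (shift x i r))) // /plus /scal /= /mult /=; ring.
- move=> f M Hf HM x; rewrite /avg Rabs_mult (Rabs_pos_eq (/ d)); last lra.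
  have := abs_RInt_le_const (fun r => f (shift x i r)) 0 d M (Rlt_le _ _ Hd)
    (ex_RInt_shift f x i 0 d Hf) (fun r _ => HM _).
  rewrite Rminus_0_r => /(Rmult_le_compat_l (/ d) _ _ (Rlt_le _ _ Hi)).
  by rewrite -Rmult_assoc Rinv_l ?Rmult_1_l; last lra; move=> ?; lra.
- move=> a f Hf; apply: functional_extensionality => x; rewrite {2}/tr /avg; congr Rmult.
  by apply: RInt_ext => r _; exact: tr_shift.
Qed.

Definition dquot {n : nat} (d : R) (i : 'I_n) (f : pt n -> R) : pt n -> R :=
  fun x => / d * (f (shift x i d) - f x).

Lemma dquot_BUC {n} d (i : 'I_n) f : BUC f -> BUC (dquot d i f).
Proof. by move=> Hf; apply: BUC_scal; apply: BUC_minus => //; apply: BUC_shift. Qed.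

Lemma inv_op_dquot {n} K (T : (pt n -> R) -> pt n -> R) d i f :
  inv_op K T -> BUC f -> T (dquot d i f) = dquot d i (T f).
Proof.
move=> HT Hf; apply: functional_extensionality => x; rewrite /dquot.
have Hs : BUC (fun y => f (shift y i d)) by apply: BUC_shift.
rewrite (inv_op_scal K T (/ d) (fun y => f (shift y i d) - f y)) //; last exact: BUC_minus.
by rewrite (inv_op_minus K) // (inv_op_shift K).
Qed.

Lemma partial_dquot {n} d (i j : 'I_n) f g : partial j f g -> partial j (dquot d i f) (dquot d i g).
Proof.
move=> H x; apply: is_derive_scal; apply: is_derive_minus; last exact: H.
apply: (is_derive_ext (fun r => f (shift (shift x i d) j r))) => [r|]; last exact: H.
by rewrite shift_comm.
Qed.

(** After a change of variable the average is a difference P(s + d) - P(s) of a primitive, so its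
    derivative is a difference quotient of f, which is again in BUC. *)
Lemma partial_avg {n} d (i : 'I_n) f : BUC f -> partial i (avg d i f) (dquot d i f).
Proof.
move=> Hf x; apply: is_derive_scal.
pose P s := RInt (fun r => f (shift x i r)) 0 s.
have HP s : is_derive P s (f (shift x i s)).
  apply: (is_derive_RInt (fun r => f (shift x i r)) P 0); last exact: continuous_shift.
  by apply: filter_forall => b; apply: RInt_correct; apply: ex_RInt_shift.
apply: (is_derive_ext (fun s => P (s + d) - P s)).
  move=> s; rewrite /P.
  have := RInt_Chasles (fun r => f (shift x i r)) 0 s (s + d)
    (ex_RInt_shift f x i _ _ Hf) (ex_RInt_shift f x i _ _ Hf).
  rewrite /plus /= => <-.
  have := RInt_comp_lin (fun r => f (shift x i r)) 1 s 0 d (ex_RInt_shift f x i _ _ Hf).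
  rewrite Rmult_0_r Rplus_0_l Rmult_1_l (Rplus_comm d) => <-.
  rewrite Rplus_comm /Rminus Rplus_assoc Rplus_opp_r Rplus_0_r.
  by apply: RInt_ext => r _; rewrite /scal /= /mult /= !Rmult_1_l shift_shift Rplus_comm.
apply: is_derive_minus; last first.
  by have := HP 0; rewrite shift0.
have := HP d; rewrite -{1}(Rplus_0_l d) => HP'.
rewrite -[f _]Rmult_1_l; apply: (is_derive_comp P (fun s => s + d)) => //.
by auto_derive => //; ring.
Qed.

Definition mollify {n : nat} (d : R) (L : seq 'I_n) (f : pt n -> R) : pt n -> R :=
  foldr (avg d) f L.

Lemma inv_op_id {n} : inv_op 1 (fun f : pt n -> R => f).
Proof. by split=> // [|f M _ HM x]; [lra | rewrite Rmult_1_l]. Qed.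

Lemma inv_op_mollify {n} d (L : seq 'I_n) : 0 < d -> inv_op 1 (mollify d L).
Proof.
move=> Hd; elim: L => [|i L IH]; first exact: inv_op_id.
rewrite -(Rmult_1_l 1); exact: (inv_op_comp 1 1 (avg d i) (mollify d L) (inv_op_avg d i Hd) IH).
Qed.

(** Differentiating in direction i uses up one average in that direction; the averages outside it
    commute with difference quotients and with derivatives. *)
Lemma partial_mollify {n} d (L : seq 'I_n) f i : 0 < d -> BUC f -> i \in L ->
  partial i (mollify d L f) (dquot d i (mollify d (rem i L) f)).
Proof.
move=> Hd Hf; elim: L => [//|k L IH]; rewrite in_cons /=.
have HB L' : BUC (mollify d L' f) by apply: (inv_op_BUC 1) => //; apply: inv_op_mollify.
case: (k =P i) => [-> _|Hki /orP [/eqP E|Hi]].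
- exact: partial_avg.
- by case: Hki.
- rewrite /= -(inv_op_dquot 1 (avg d k)) //; last exact: inv_op_avg.
  apply: (inv_op_partial 1) => //; [exact: inv_op_avg | exact: dquot_BUC | exact: IH].
Qed.

Lemma mollify_BUC2 {n} d (f : pt n -> R) : 0 < d -> BUC f ->
  BUC2 (mollify d (enum 'I_n ++ enum 'I_n) f).
Proof.
move=> Hd Hf; set L := _ ++ _.
have HB L' : BUC (mollify d L' f) by apply: (inv_op_BUC 1) => //; apply: inv_op_mollify.
have H1 i : i \in L by rewrite mem_cat mem_enum.
(* Each direction occurs twice in [L], so every j survives the removal of one i, even when j = i;
   hence two derivatives are available. *)
have H2 i j : j \in rem i L.
  rewrite -has_pred1 has_count count_mem_rem /L count_cat !count_uniq_mem ?enum_uniq // mem_enum.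
  by case: (_ == _).
have P1 i := partial_mollify d L f i Hd Hf (H1 i).
split.
  split=> // i; exists (dquot d i (mollify d (rem i L) f)); split=> //; exact: dquot_BUC.
move=> i; rewrite (partial_Der i _ _ (P1 i)); split; first exact: dquot_BUC.
move=> j; exists (dquot d i (dquot d j (mollify d (rem j (rem i L)) f))); split.
  by apply: dquot_BUC; apply: dquot_BUC.
by apply: partial_dquot; apply: partial_mollify.
Qed.

Lemma avg_close {n} d (i : 'I_n) f e x : 0 < d -> BUC f ->
  (forall r y, Rabs r <= d -> Rabs (f (shift y i r) - f y) <= e) ->
  Rabs (avg d i f x - f x) <= e.
Proof.
move=> Hd Hf He.
have E : avg d i f x - f x = / d * RInt (fun r => f (shift x i r) - f x) 0 d.
  rewrite (RInt_minus (fun r => f (shift x i r)) (fun _ => f x)); first last.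
  - exact: ex_RInt_const.
  - exact: ex_RInt_shift.
  rewrite RInt_const /avg /minus /plus /opp /scal /= /mult /=; field; lra.
rewrite E Rabs_mult Rabs_pos_eq; last by apply: Rlt_le; apply: Rinv_0_lt_compat.
have K : Rabs (RInt (fun r => f (shift x i r) - f x) 0 d) <= (d - 0) * e.
  apply: abs_RInt_le_const; first lra.
    apply: (ex_RInt_minus (fun r => f (shift x i r)) (fun _ => f x)); last exact: ex_RInt_const.
    exact: ex_RInt_shift.
  by move=> t Ht; apply: He; rewrite Rabs_pos_eq; lra.
have Hi := Rinv_0_lt_compat _ Hd.
have := Rmult_le_compat_l _ _ _ (Rlt_le _ _ Hi) K.
rewrite Rminus_0_r -Rmult_assoc Rinv_l; lra.
Qed.

Lemma BUC2_dense {n} (f : pt n -> R) e : BUC f -> 0 < e ->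
  exists g, BUC2 g /\ forall x, Rabs (f x - g x) <= e.
Proof.
move=> Hf He; set L := enum 'I_n ++ enum 'I_n.
set N := INR (size L) + 1; have HN : 0 < N by rewrite /N; move: (pos_INR (size L)); lra.
have [|d [Hd Hs]] := BUC_shift_small f (e / N) Hf; first exact: Rdiv_lt_0_compat.
have Hd2 : 0 < d / 2 by lra.
exists (mollify (d / 2) L f); split; first exact: mollify_BUC2.
(* Averages are contractions, so the error e/N of each one simply adds up along the list. *)
have key L' x : Rabs (mollify (d / 2) L' f x - f x) <= INR (size L') * (e / N).
  elim: L' x => [|i L' IH] x.
    by rewrite /= Rminus_diag_eq // Rabs_R0; lra.
  have HB : BUC (mollify (d / 2) L' f) by apply: (inv_op_BUC 1) => //; apply: inv_op_mollify.
  have H1 := inv_op_bound_minus 1 (avg (d / 2) i) _ _ _ x (inv_op_avg _ i Hd2) HB Hf IH.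
  have H2 := avg_close (d / 2) i f (e / N) x Hd2 Hf.
  have {}H2 := H2 (fun r y Hr => Rlt_le _ _ (Hs i r y ltac:(lra))).
  rewrite [size _]/= S_INR.
  have -> : mollify (d / 2) (i :: L') f x - f x =
    (avg (d / 2) i (mollify (d / 2) L' f) x - avg (d / 2) i f x) + (avg (d / 2) i f x - f x).
    by rewrite /=; ring.
  apply: Rle_trans (Rabs_triang _ _) _; lra.
move=> x; rewrite Rabs_minus_sym; apply: Rle_trans (key L x) _.
have E : e = N * (e / N) by field; lra.
rewrite {2}E; apply: Rmult_le_compat_r; last exact: Rlt_le (Rlt_plus_1 _).
by apply: Rlt_le; apply: Rdiv_lt_0_compat.
Qed.

(** * The heat semigroup *)

Definition DLap {n : nat} (D : R) (f : pt n -> R) : pt n -> R :=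
  fun x => D * \big[Rplus/0]_(i < n) Der i (Der i f) x.

Lemma DLap_BUC {n} D (f : pt n -> R) : BUC2 f -> BUC (DLap D f).
Proof.
move=> [_ H]; apply: BUC_scal; apply: BUC_sum => i.
exact: (proj1 (BUC1_Der i _ (H i))).
Qed.

(** Mean value inequality for s -> f(x + s e_i) + f(x - s e_i) - c s^2. Its derivative is the sum of
    two first-order remainders of [Der i f], each at most e h, whence the factor 2. *)
Lemma second_difference {n} (i : 'I_n) f x h e : BUC2 f -> 0 <= h ->
  (forall s, Rabs s <= h -> Rabs (Der i (Der i f) (shift x i s) - Der i (Der i f) x) <= e) ->
  Rabs (f (shift x i h) + f (shift x i (- h)) - 2 * f x - h ^ 2 * Der i (Der i f) x) <= 2 * e * h ^ 2.
Proof.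
move=> [H1 H2] Hh He.
set c := Der i (Der i f) x in He *.
have [_ P1] := BUC1_Der i f H1; have [_ P2] := BUC1_Der i _ (H2 i).
have Hd s : is_derive (fun s => f (shift x i s) + f (shift x i (- s)) - c * s ^ 2) s
    (Der i f (shift x i s) - Der i f (shift x i (- s)) - 2 * c * s).
  have A1 := partial_derive i f _ x s P1.
  have A2 : is_derive (fun s => f (shift x i (- s))) s (- 1 * Der i f (shift x i (- s))).
    apply: (is_derive_comp (fun s => f (shift x i s)) (fun s => - s)); first exact: partial_derive.
    by auto_derive => //; ring.
  have A3 : is_derive (fun s => c * s ^ 2) s (2 * c * s) by auto_derive => //; ring.
  have -> : Der i f (shift x i s) - Der i f (shift x i (- s)) - 2 * c * s =
    Der i f (shift x i s) + - 1 * Der i f (shift x i (- s)) - 2 * c * s by ring.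
  by apply: is_derive_minus => //; apply: is_derive_plus.
have K := abs_derive_le _ _ 0 h (2 * e * h) Hh (fun s _ => Hd s).
have -> : f (shift x i h) + f (shift x i (- h)) - 2 * f x - h ^ 2 * c =
  f (shift x i h) + f (shift x i (- h)) - c * h ^ 2 -
  (f (shift x i 0) + f (shift x i (- 0)) - c * 0 ^ 2) by rewrite Ropp_0 shift0; ring.
have -> : 2 * e * h ^ 2 = (h - 0) * (2 * e * h) by ring.
apply: K => s Hs.
have B1 := partial_increment i _ _ x s c e P2.
have B2 := partial_increment i _ _ x (- s) c e P2.
have Hsh : Rabs s <= h by rewrite Rabs_pos_eq; lra.
have Hsh' : Rabs (- s) <= h by rewrite Rabs_Ropp.
have {}B1 := B1 (fun r Hr => He r (Rle_trans _ _ _ Hr Hsh)).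
have {}B2 := B2 (fun r Hr => He r (Rle_trans _ _ _ Hr Hsh')).
rewrite (Rabs_Ropp s) in B2; rewrite (Rabs_pos_eq s) in B1 B2; try lra.
have E0 : 0 <= e := Rle_trans _ _ _ (Rabs_pos _) (He 0 ltac:(rewrite Rabs_R0; lra)).
have := Rmult_le_compat_l _ _ _ E0 (proj2 Hs).
move: B1 B2 => /Rabs_le_between B1 /Rabs_le_between B2 B3.
apply: Rabs_le; lra.
Qed.

Lemma lapl_consistent {n} D (f : pt n -> R) e : 0 < D -> BUC2 f -> 0 < e ->
  exists eta, 0 < eta /\ forall h x, 0 < h < eta -> Rabs (lapl D h f x - DLap D f x) <= e.
Proof.
move=> HD Hf He.
have Hn : 0 < 2 * D * INR n + 1.
  have := pos_INR n => Hn; have := Rmult_le_pos _ _ (Rlt_le _ _ HD) Hn; lra.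
have He' : 0 < e / (2 * D * INR n + 1) by apply: Rdiv_lt_0_compat.
(* One modulus serves all second derivatives: the minimum of the n individual ones and 1. *)
have [d [Hd Hs]] : exists d, 0 < d /\ forall (i : 'I_n) s x, Rabs s < d ->
    Rabs (Der i (Der i f) (shift x i s) - Der i (Der i f) x) <= e / (2 * D * INR n + 1).
  pose P (i : 'I_n) d := 0 < d /\ forall s x, Rabs s < d ->
    Rabs (Der i (Der i f) (shift x i s) - Der i (Der i f) x) <= e / (2 * D * INR n + 1).
  have HP i : exists d, P i d.
    have [B _] := BUC1_Der i _ (proj2 Hf i).
    have [d [Hd H]] := BUC_shift_small _ _ B He'.
    by exists d; split=> // s x Hs; apply: Rlt_le; apply: H.
  pose d0 i := proj1_sig (constructive_indefinite_description _ (HP i)).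
  have H0 i : P i (d0 i) := proj2_sig (constructive_indefinite_description _ (HP i)).
  exists (\big[Rmin/1]_i d0 i); split.
    by elim/big_ind: _ => [|a b Ha Hb|i _]; [lra | exact: Rmin_pos | case: (H0 i)].
  move=> i s x Hx; apply: (proj2 (H0 i)); apply: Rlt_le_trans Hx _.
  have : i \in index_enum _ by rewrite mem_index_enum.
  elim: (index_enum _) => [//|j L IH]; rewrite in_cons big_cons => /orP [/eqP <-|/IH H].
    exact: Rmin_l.
  exact: Rle_trans (Rmin_r _ _) H.
exists d; split=> // h x [Hh Hhd].
have Hst := step_gt0 D h HD Hh.
have Hh2 : 0 < h ^ 2 by apply: pow_lt.
have -> : lapl D h f x - DLap D f x =
   D / h ^ 2 * \big[Rplus/0]_(i < n) (f (shift x i h) + f (shift x i (- h)) - 2 * f x - h ^ 2 * Der i (Der i f) x).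
  by rewrite sum_minus sum_scal /lapl /DLap; field; lra.
rewrite Rabs_mult (Rabs_pos_eq (D / h ^ 2)); last lra.
apply: (Rle_trans _ (D / h ^ 2 * (INR n * (2 * (e / (2 * D * INR n + 1)) * h ^ 2)))).
  apply: Rmult_le_compat_l; first lra.
  rewrite -sum_const; apply: Rle_trans (sum_abs_le _) _; apply: sum_le => i.
  by apply: second_difference => //; [lra | move=> s Hs'; apply: Hs; lra].
have -> : D / h ^ 2 * (INR n * (2 * (e / (2 * D * INR n + 1)) * h ^ 2)) =
   e - e / (2 * D * INR n + 1) by field; lra.
lra.
Qed.

(** With L_h the difference Laplacian and S_k the semigroup of step k, the difference of the
    semigroups solves the L_h equation with source (L_h - L_k) S_k f = S_k (L_h f - L_k f).
    Consistency makes this at most e, so the difference is at most e t. *)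
Lemma dheat_cauchy_smooth {n} D (f : pt n -> R) e : 0 < D -> BUC2 f -> 0 < e ->
  exists eta, 0 < eta /\ forall h k t x, 0 < h < eta -> 0 < k < eta -> 0 <= t ->
    Rabs (dheat D h t f x - dheat D k t f x) <= e * t.
Proof.
move=> HD Hf He; have [|eta [Heta Hl]] := lapl_consistent D f (e / 2) HD Hf; first lra.
have [Hfb _] : BUC f by case: Hf => [[]].
exists eta; split=> //.
suff key h k t x : 0 < h < eta -> 0 < k < eta -> 0 <= t ->
    dheat D h t f x - dheat D k t f x <= e * t.
  move=> h k t x Hh Hk Ht; apply: Rabs_le.
  have := key h k t x Hh Hk Ht; have := key k h t x Hk Hh Ht; lra.
move=> Hh Hk Ht; have [M HM] := Hfb.
pose w s y := 1 * dheat D h s f y + (-1 * dheat D k s f y + - e * s).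
suff : w t x <= 0 by rewrite /w; lra.
apply: (discrete_max_principle D h t (2 * M) w
  (fun s y => 1 * lapl D h (dheat D h s f) y + (-1 * lapl D k (dheat D k s f) y + - e * 1))); try lra.
- move=> s y _; rewrite /w.
  by apply: is_derive_plus; [|apply: is_derive_plus]; apply: is_derive_scal;
    try (apply: is_derive_dheat => //; lra); apply: is_derive_id.
- move=> s y [Hs _].
  have /Rabs_le_between A1 := dheat_bound D h s f M y HD (proj1 Hh) Hs HM.
  have /Rabs_le_between A2 := dheat_bound D k s f M y HD (proj1 Hk) Hs HM.
  have := Rmult_le_pos _ _ (Rlt_le _ _ He) Hs.
  rewrite /w; lra.
- move=> s y [Hs _].
  rewrite (lapl_lin D h 1 (dheat D h s f)) (lapl_lin D h (-1) (dheat D k s f) (fun _ => - e * s)) lapl_const.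
  suff : lapl D h (dheat D k s f) y - lapl D k (dheat D k s f) y <= e by lra.
  have lapl_bounded j : 0 < j -> bounded (lapl D j f).
    move=> Hj; exists (rate n D j * M + rate n D j * M) => z; rewrite laplE.
    apply: Rle_trans (Rabs_triang _ _) _; apply: Rplus_le_compat; first exact: qop_abs.
    rewrite Rabs_Ropp Rabs_mult Rabs_pos_eq; last by apply: rate_ge0.
    by apply: Rmult_le_compat_l => //; apply: rate_ge0.
  (* Different steps h and k also commute, because [lapl] is built from shifts and [dheat] is
     translation invariant. *)
  have -> : lapl D h (dheat D k s f) y = dheat D k s (lapl D h f) y.
    rewrite laplE.
    have -> : lapl D h f = fun z => - rate n D h * f z + qop D h f z.
      by apply: functional_extensionality => z; rewrite laplE; ring.
    rewrite dheat_lin //; try lra; last by exists (rate n D h * M) => z; apply: qop_abs => //; lra.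
    suff -> : qop D h (dheat D k s f) y = dheat D k s (qop D h f) y by ring.
    have Hinv := @dheat_inv_op n D k s HD (proj1 Hk) Hs.
    have HfB : BUC f by case: Hf => [[]].
    have HS i : BUC (fun z => f (shift z i h) + f (shift z i (- h))).
      by apply: BUC_plus; apply: BUC_shift.
    rewrite /qop (inv_op_scal 1 (dheat D k s) _ (fun z => \big[Rplus/0]_(i < n) (f (shift z i h) + f (shift z i (- h))))) //.
      rewrite (inv_op_sum 1 (dheat D k s) (fun i z => f (shift z i h) + f (shift z i (- h)))) //.
      congr Rmult; apply: eq_bigr => i _.
      rewrite (inv_op_plus 1 (dheat D k s) (fun z => f (shift z i h)) (fun z => f (shift z i (- h)))) //;
        try exact: BUC_shift.
      by rewrite !(inv_op_shift 1 (dheat D k s)).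
    exact: BUC_sum.
  rewrite (lapl_dheat D k) //; last lra.
  have -> : dheat D k s (lapl D h f) y - dheat D k s (lapl D k f) y =
    dheat D k s (fun z => -1 * lapl D k f z + lapl D h f z) y.
    rewrite dheat_lin //; [ring | lra | apply: lapl_bounded; lra | apply: lapl_bounded; lra].
  apply: (Rle_trans _ _ _ (Rle_abs _)); apply: dheat_bound => //; first lra.
  move=> z; have /Rabs_le_between B1 := Hl h z Hh; have /Rabs_le_between B2 := Hl k z Hk.
  apply: Rabs_le; lra.
- move=> y; rewrite /w !dheat_0; lra.
Qed.

Lemma dheat_cauchy {n} D (f : pt n -> R) T e : 0 < D -> BUC f -> 0 < e ->
  exists eta, 0 < eta /\ forall h k t x, 0 < h < eta -> 0 < k < eta -> 0 <= t <= T ->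
    Rabs (dheat D h t f x - dheat D k t f x) <= e.
Proof.
move=> HD Hf He.
have [|g [Hg Hfg]] := BUC2_dense f (e / 3) Hf; first lra.
have HT : 0 < Rmax T 1 by move: (Rmax_r T 1); lra.
have [|eta [Heta H]] := dheat_cauchy_smooth D g (e / 3 / Rmax T 1) HD Hg.
  by apply: Rdiv_lt_0_compat; lra.
exists eta; split=> // h k t x Hh Hk Ht.
have HgB : BUC g by case: Hg => [[]].
have A1 := inv_op_bound_minus 1 _ f g _ x (dheat_inv_op D h t HD (proj1 Hh) (proj1 Ht)) Hf HgB Hfg.
have A2 := inv_op_bound_minus 1 _ f g _ x (dheat_inv_op D k t HD (proj1 Hk) (proj1 Ht)) Hf HgB Hfg.
have A3 := H h k t x Hh Hk (proj1 Ht).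
have A4 : e / 3 / Rmax T 1 * t <= e / 3.
  have -> : e / 3 / Rmax T 1 * t = e / 3 * (t / Rmax T 1) by field; lra.
  rewrite -[X in _ <= X]Rmult_1_r; apply: Rmult_le_compat_l; first lra.
  apply/Rle_div_l => //; rewrite Rmult_1_l; move: (Rmax_l T 1); lra.
move: A1 A2 A3 => /Rabs_le_between A1 /Rabs_le_between A2 /Rabs_le_between A3.
apply: Rabs_le; lra.
Qed.

(** Time is frozen at 0 for t <= 0, where the operator is the identity on f; curves built from it
    are thus defined and continuous on all of R. *)
Definition heat {n : nat} (D t : R) (f : pt n -> R) : pt n -> R :=
  fun x => real (Lim_seq (fun m => dheat D (/ INR m.+1) (Rmax 0 t) f x)).

Lemma heat_lim {n} D t (f : pt n -> R) x : 0 < D -> BUC f ->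
  is_lim_seq (fun m => dheat D (/ INR m.+1) (Rmax 0 t) f x) (heat D t f x).
Proof.
move=> HD Hf.
have [l Hl] : ex_finite_lim_seq (fun m => dheat D (/ INR m.+1) (Rmax 0 t) f x).
  apply/ex_lim_seq_cauchy_corr => e.
  have He := cond_pos e.
  have [|eta [Heta H]] := dheat_cauchy D f (Rmax 0 t) (e / 2) HD Hf; first lra.
  have /is_lim_seq_spec /(_ (mkposreal eta Heta)) [N HN] := is_lim_seq_inv_S.
  have HN' m : (N <= m)%coq_nat -> 0 < / INR m.+1 < eta.
    move=> /HN; rewrite Rminus_0_r /= => /Rabs_def2 [A _]; split=> //; exact: inv_S_pos.
  exists N => m k /HN' Hm /HN' Hk.
  have := H _ _ (Rmax 0 t) x Hm Hk (conj (Rmax_l _ _) (Rle_refl _)); lra.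
by rewrite /heat (is_lim_seq_unique _ _ Hl).
Qed.

(** Convergence for arbitrary h tending to 0, not only along reciprocals of integers. This lets one
    step be shared by several approximations, or be fitted to a given displacement. *)
Lemma heat_approx {n} D (f : pt n -> R) T e : 0 < D -> BUC f -> 0 < e ->
  exists eta, 0 < eta /\ forall h t x, 0 < h < eta -> 0 <= t <= T ->
    Rabs (dheat D h t f x - heat D t f x) <= e.
Proof.
move=> HD Hf He; have [eta [Heta H]] := dheat_cauchy D f T e HD Hf He.
exists eta; split=> // h t x Hh Ht.
have HL := heat_lim D t f x HD Hf; rewrite Rmax_right in HL; last lra.
have H1 : is_lim_seq (fun m => Rabs (dheat D h t f x - dheat D (/ INR m.+1) t f x))
   (Rabs (dheat D h t f x - heat D t f x)).
  apply: (is_lim_seq_abs _ (Finite (_ - _))).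
  by apply: is_lim_seq_minus' => //; apply: is_lim_seq_const.
have /is_lim_seq_spec /(_ (mkposreal eta Heta)) [N HN] := is_lim_seq_inv_S.
apply: (is_lim_seq_le_loc _ _ (Finite _) (Finite e) _ H1 (is_lim_seq_const e)).
exists N => m Hm; apply: H => //; split; first exact: inv_S_pos.
have := HN m Hm; rewrite Rminus_0_r /= => /Rabs_def2; lra.
Qed.

Lemma heat_neg {n} D t (f : pt n -> R) : t <= 0 -> heat D t f = heat D 0 f.
Proof. by move=> Ht; rewrite /heat !Rmax_left //; lra. Qed.

Lemma heat_0 {n} D (f : pt n -> R) : heat D 0 f = f.
Proof.
apply: functional_extensionality => x; rewrite /heat Rmax_left; last lra.
rewrite (Lim_seq_ext _ (fun _ => f x)) ?Lim_seq_const //.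
by move=> m; rewrite dheat_0.
Qed.

Lemma heat_inv_op {n} D t : 0 < D -> inv_op 1 (@heat n D t).
Proof.
move=> HD; have Ht := Rmax_l 0 t; split; first lra.
- move=> a f g Hf Hg x.
  have L1 := heat_lim D t f x HD Hf; have L2 := heat_lim D t g x HD Hg.
  have L3 := heat_lim D t _ x HD (BUC_lin a f g Hf Hg).
  have L4 := is_lim_seq_plus' _ _ _ _ (is_lim_seq_scal_l _ a _ L1) L2.
  have : is_lim_seq (fun m => dheat D (/ INR m.+1) (Rmax 0 t) (fun y => a * f y + g y) x)
      (a * heat D t f x + heat D t g x).
    move: L4; apply: is_lim_seq_ext => m; rewrite dheat_lin //; first exact: inv_S_pos.
      by case: Hf.
    by case: Hg.
  by move/is_lim_seq_unique; rewrite (is_lim_seq_unique _ _ L3) => [[]].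
- move=> f M Hf HM x; rewrite Rmult_1_l.
  have L := is_lim_seq_abs _ _ (heat_lim D t f x HD Hf).
  apply: (is_lim_seq_le _ _ (Finite _) (Finite M) _ L (is_lim_seq_const M)) => m.
  by apply: dheat_bound => //; apply: inv_S_pos.
- move=> a f Hf; apply: functional_extensionality => x; rewrite /heat {2}/tr.
  by congr real; apply: Lim_seq_ext => m; rewrite dheat_tr.
Qed.

Lemma heat_BUC {n} D t (f : pt n -> R) : 0 < D -> BUC f -> BUC (heat D t f).
Proof. by move=> HD; apply: (inv_op_BUC 1); apply: heat_inv_op. Qed.

Lemma heat_bound {n} D t (f : pt n -> R) M x : 0 < D -> BUC f ->
  (forall y, Rabs (f y) <= M) -> Rabs (heat D t f x) <= M.
Proof.
by move=> HD Hf HM; case: (@heat_inv_op n D t HD) => _ _ H _; rewrite -(Rmult_1_l M); apply: H.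
Qed.

Lemma heat_bound_minus {n} D t (f g : pt n -> R) M x : 0 < D -> BUC f -> BUC g ->
  (forall y, Rabs (f y - g y) <= M) -> Rabs (heat D t f x - heat D t g x) <= M.
Proof.
move=> HD Hf Hg HM; rewrite -(Rmult_1_l M).
by apply: (inv_op_bound_minus 1) => //; apply: heat_inv_op.
Qed.

Lemma heat_semigroup {n} D s t (f : pt n -> R) : 0 < D -> 0 <= s -> 0 <= t -> BUC f ->
  heat D (t + s) f = heat D t (heat D s f).
Proof.
move=> HD Hs Ht Hf; apply: functional_extensionality => x.
have Hg := heat_BUC D s f HD Hf.
apply: Rminus_diag_uniq; apply: Rabs_eq_0; apply: Rle_antisym (Rabs_pos _).
apply: Rle_plus_epsilon => e He; rewrite Rplus_0_l.
have [|e1 [He1 H1]] := heat_approx D f (t + s) (e / 3) HD Hf; first lra.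
have [|e2 [He2 H2]] := heat_approx D (heat D s f) t (e / 3) HD Hg; first lra.
have Hm := Rmin_pos _ _ He1 He2; pose h := Rmin e1 e2 / 2.
have Hh1 : 0 < h < e1 by have := Rmin_l e1 e2; rewrite /h; lra.
have Hh2 : 0 < h < e2 by have := Rmin_r e1 e2; rewrite /h; lra.
have A1 := H1 h (t + s) x Hh1 ltac:(lra).
have A2 := H2 h t x Hh2 ltac:(lra).
rewrite dheat_semigroup // in A1; try lra; last by case: Hf.
have Hi := @dheat_inv_op n D h s HD (proj1 Hh1) Hs.
have A3 := inv_op_bound_minus 1 _ (dheat D h s f) (heat D s f) (e / 3) x (dheat_inv_op D h t HD (proj1 Hh1) Ht)
  (inv_op_BUC 1 _ _ Hi Hf) Hg (fun y => H1 h s y Hh1 ltac:(lra)).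
move: A1 A2 A3 => /Rabs_le_between A1 /Rabs_le_between A2 /Rabs_le_between A3.
apply: Rabs_le; lra.
Qed.

(** Mean value form of d/dt S(t) f = S(t) (D Lap f), proved for [dheat] and passed to the limit. The
    free constant c is 0 for modulus of continuity estimates and the value of the Laplacian for the
    time derivative of a mild solution. *)
Lemma heat_generator {n} D (f : pt n -> R) r c A x : 0 < D -> BUC2 f -> 0 <= r ->
  (forall s, 0 <= s <= r -> Rabs (heat D s (DLap D f) x - c) <= A) ->
  Rabs (heat D r f x - f x - r * c) <= r * A.
Proof.
move=> HD Hf Hr HA; apply: Rle_plus_epsilon => e He.
have HfB : BUC f by case: Hf => [[]].
have HL := DLap_BUC D f Hf.
have He' : 0 < e / 3 / (r + 1) by apply: Rdiv_lt_0_compat; lra.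
have [|e1 [He1 H1]] := heat_approx D f r (e / 3) HD HfB; first lra.
have [e2 [He2 H2]] := heat_approx D (DLap D f) r (e / 3 / (r + 1)) HD HL He'.
have [e3 [He3 H3]] := lapl_consistent D f (e / 3 / (r + 1)) HD Hf He'.
pose h := Rmin e1 (Rmin e2 e3) / 2.
have Hm := Rmin_pos _ _ He1 (Rmin_pos _ _ He2 He3).
have Hh1 : 0 < h < e1 by have := Rmin_l e1 (Rmin e2 e3); rewrite /h; lra.
have Hh2 : 0 < h < e2.
  have := Rmin_r e1 (Rmin e2 e3); have := Rmin_l e2 e3; rewrite /h; lra.
have Hh3 : 0 < h < e3.
  have := Rmin_r e1 (Rmin e2 e3); have := Rmin_r e2 e3; rewrite /h; lra.
have lapl_BUC : BUC (lapl D h f).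
  apply: BUC_scal; apply: BUC_sum => i; apply: BUC_minus; last exact: BUC_scal.
  by apply: BUC_plus; apply: BUC_shift.
have K : Rabs (dheat D h r f x - c * r - (dheat D h 0 f x - c * 0)) <= (r - 0) * (A + 2 * (e / 3 / (r + 1))).
  apply: (abs_derive_le (fun s => dheat D h s f x - c * s) (fun s => lapl D h (dheat D h s f) x - c * 1)) => // s Hs.
    apply: is_derive_minus; first by apply: is_derive_dheat => //; [lra | case: HfB].
    by apply: is_derive_scal; apply: is_derive_id.
  rewrite lapl_dheat //; [|lra|by case: HfB].
  have B1 := inv_op_bound_minus 1 _ (lapl D h f) (DLap D f) _ x (dheat_inv_op D h s HD (proj1 Hh1) (proj1 Hs))
    lapl_BUC HL (fun y => H3 h y Hh3).
  have B2 := H2 h s x Hh2 Hs.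
  have B3 := HA s Hs.
  move: B1 B2 B3 => /Rabs_le_between B1 /Rabs_le_between B2 /Rabs_le_between B3.
  apply: Rabs_le; lra.
rewrite dheat_0 in K.
have K2 := H1 h r x Hh1 ltac:(lra).
have E : (r - 0) * (A + 2 * (e / 3 / (r + 1))) <= r * A + 2 * (e / 3).
  have -> : (r - 0) * (A + 2 * (e / 3 / (r + 1))) = r * A + 2 * (e / 3) - 2 * (e / 3 / (r + 1)) by field; lra.
  lra.
move: K K2 => /Rabs_le_between K /Rabs_le_between K2.
apply: Rabs_le; lra.
Qed.

(** On smooth g the curve is Lipschitz in time with constant sup |D Lap g|; density and contraction
    extend this to f, with a modulus independent of the times. *)
Lemma heat_time {n} D (f : pt n -> R) e : 0 < D -> BUC f -> 0 < e ->
  exists d, 0 < d /\ forall t s x, Rabs (t - s) < d -> Rabs (heat D t f x - heat D s f x) <= e.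
Proof.
move=> HD Hf He.
have [|g [Hg Hfg]] := BUC2_dense f (e / 3) Hf; first lra.
have HgB : BUC g by case: Hg => [[]].
have HL := DLap_BUC D g Hg.
have [B [HB HgL]] := BUC_bound _ HL.
have Hsm r y : 0 <= r -> Rabs (heat D r g y - g y) <= r * B.
  move=> Hr; have := heat_generator D g r 0 B y HD Hg Hr.
  rewrite Rmult_0_r Rminus_0_r; apply => s Hs; rewrite Rminus_0_r; exact: heat_bound.
have Hst t s x : 0 <= s <= t -> Rabs (heat D t g x - heat D s g x) <= (t - s) * B.
  move=> Hs; have -> : t = s + (t - s) by ring.
  rewrite heat_semigroup //; try lra; have -> : s + (t - s) - s = t - s by ring.
  by apply: heat_bound_minus => //; [exact: heat_BUC | move=> y; apply: Hsm; lra].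
have Hmax t s x : s <= t -> Rabs (heat D t g x - heat D s g x) <= (t - s) * B.
  move=> Hst'; case: (Rle_lt_dec 0 s) => Hs; first by apply: Hst.
  rewrite (heat_neg D s); last lra.
  case: (Rle_lt_dec 0 t) => Ht.
    apply: Rle_trans (Hst t 0 x _) _; first lra.
    by apply: Rmult_le_compat_r => //; lra.
  rewrite (heat_neg D t); last lra.
  rewrite Rminus_diag_eq // Rabs_R0; apply: Rmult_le_pos => //; lra.
have Hd : 0 < e / 3 / (B + 1) by apply: Rdiv_lt_0_compat; lra.
exists (e / 3 / (B + 1)); split=> // t s x Hts.
have A1 := heat_bound_minus D t f g _ x HD Hf HgB Hfg.
have A2 := heat_bound_minus D s f g _ x HD Hf HgB Hfg.
have A3 : Rabs (heat D t g x - heat D s g x) <= e / 3.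
  apply: (Rle_trans _ (Rabs (t - s) * B)).
    case: (Rle_lt_dec s t) => Hts'; first by rewrite (Rabs_pos_eq (t - s)); [apply: Hmax | lra].
    rewrite Rabs_minus_sym (Rabs_minus_sym t s) (Rabs_pos_eq (s - t)); [apply: Hmax|]; lra.
  have -> : e / 3 = e / 3 / (B + 1) * (B + 1) by field; lra.
  by apply: Rmult_le_compat; try lra; exact: Rabs_pos.
move: A1 A2 A3 => /Rabs_le_between A1 /Rabs_le_between A2 /Rabs_le_between A3.
apply: Rabs_le; lra.
Qed.

Lemma heat_lips {n} D t (f : pt n -> R) M : 0 < D -> 0 < t -> BUC f ->
  (forall y, Rabs (f y) <= M) -> lips (M / sqrt (D * t)) (heat D t f).
Proof.
move=> HD Ht Hf HM.
have key i r x : 0 < r -> Rabs (heat D t f (shift x i r) - heat D t f x) <= M / sqrt (D * t) * r.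
  move=> Hr; apply: Rle_plus_epsilon => e He.
  have [|eta [Heta H]] := heat_approx D f t (e / 2) HD Hf; first lra.
  have [|m Hm] := inv_S_lt (eta / r); first exact: Rdiv_lt_0_compat.
  (* The step divides r exactly, so the displacement r is [m.+1] grid steps. *)
  pose h := r * / INR m.+1.
  have Hh : 0 < h < eta.
    split; first by apply: Rmult_lt_0_compat => //; exact: inv_S_pos.
    have := Rmult_lt_compat_l _ _ _ Hr Hm.
    by have -> : r * (eta / r) = eta by field; lra.
  have A1 := dheat_lipschitz D h t f M i x m.+1 HD (proj1 Hh) Ht HM.
  have E : INR m.+1 * h = r.
    rewrite /h; field; exact: not_0_INR.
  rewrite E in A1.
  have A2 := H h t x Hh ltac:(lra).
  have A3 := H h t (shift x i r) Hh ltac:(lra).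
  move: A1 A2 A3 => /Rabs_le_between A1 /Rabs_le_between A2 /Rabs_le_between A3.
  apply: Rabs_le; lra.
move=> i r x; case: (Rtotal_order r 0) => [Hr|[->|Hr]].
- have := key i (- r) (shift x i r) ltac:(lra).
  rewrite shift_shift Rplus_opp_r shift0 Rabs_minus_sym => K.
  by rewrite (Rabs_left r).
- by rewrite shift0 Rminus_diag_eq // Rabs_R0; lra.
- by rewrite (Rabs_pos_eq r); [apply: key | lra].
Qed.

(** * Continuous curves of bounded uniformly continuous functions *)

(** Compactness of [a, b] as an induction principle: a property of intervals that is stable under
    concatenation and holds near each point holds globally, by a supremum argument. It serves for
    uniform bounds, for commutation with integrals and for the continuation in uniqueness. *)
Lemma interval_cover (P : R -> R -> Prop) (a b : R) : a <= b ->
  (forall s c t, s <= c <= t -> P s c -> P c t -> P s t) ->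
  (forall t, a <= t <= b -> exists d, 0 < d /\
     forall s r, a <= s <= t -> t <= r <= b -> r - s < d -> P s r) -> P a b.
Proof.
move=> Hab Hadd Hloc.
pose E c := a <= c <= b /\ P a c.
have Ea : E a.
  split; first lra; have [d [Hd H]] := Hloc a ltac:(lra); apply: H; lra.
have [m [Hub Hleast]] : {m | is_lub E m}.
  by apply: completeness; [exists b => c [Hc _]; lra | exists a].
have Hm : a <= m <= b.
  by split; [apply: Hub | apply: Hleast => c [Hc _]; lra].
have [d [Hd H]] := Hloc m Hm.
have [c [[Hc Pc] Hcm]] : exists c, E c /\ m - d / 2 < c.
  apply: NNPP => Hn; have : m <= m - d / 2; last lra.
  apply: Hleast => c Ec; apply: Rnot_lt_le => Hlt; apply: Hn; exists c; split=> //; lra.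
have Hcm' : c <= m by apply: Hub.
pose r := Rmin b (m + d / 4).
have Hr1 : r <= b by apply: Rmin_l.
have Hr2 : r <= m + d / 4 by apply: Rmin_r.
have Hr3 : m <= r by apply: Rmin_glb; lra.
have Pr : P a r by apply: (Hadd a c r) => //; [lra | apply: H; lra].
have Hrm : r <= m by apply: Hub; split=> //; lra.
suff -> : b = r by [].
by move: Hrm; rewrite /r /Rmin; case: Rle_dec => //; lra.
Qed.

(** Curves over the whole real line instead of [0, oo), so that continuity and integrals need no
    endpoint conditions; data given for t >= 0 are extended by [Rmax 0 t]. *)
Definition CB {n : nat} (F : R -> pt n -> R) : Prop :=
  (forall t, BUC (F t)) /\
  (forall t e, 0 < e -> exists d, 0 < d /\
     forall s, Rabs (s - t) < d -> forall x, Rabs (F s x - F t x) <= e).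

Lemma CB_uniform {n} (F : R -> pt n -> R) a b e : CB F -> a <= b -> 0 < e ->
  exists d, 0 < d /\ forall t s, a <= t <= b -> Rabs (s - t) < d ->
    forall x, Rabs (F s x - F t x) <= e.
Proof.
move=> [_ HF] Hab He.
apply: (interval_cover (fun a b => exists d, 0 < d /\ forall t s, a <= t <= b ->
   Rabs (s - t) < d -> forall x, Rabs (F s x - F t x) <= e)) => //.
  move=> s c t Hc [d1 [Hd1 H1]] [d2 [Hd2 H2]].
  exists (Rmin d1 d2); split; first exact: Rmin_pos.
  move=> r r' Hr Hrr x; case: (Rle_lt_dec r c) => Hrc.
    by apply: H1; [lra | apply: Rlt_le_trans Hrr (Rmin_l _ _)].
  by apply: H2; [lra | apply: Rlt_le_trans Hrr (Rmin_r _ _)].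
move=> t Ht; have [|d [Hd H]] := HF t (e / 2); first lra.
exists (d / 2); split; first lra.
move=> s r Hs Hr Hsr; exists (d / 2); split; first lra.
move=> p p' Hp Hpp x.
have /Rabs_le_between A1 := H p ltac:(apply: Rabs_def1; lra) x.
move/Rabs_def2: Hpp => Hpp.
have /Rabs_le_between A2 := H p' ltac:(apply: Rabs_def1; lra) x.
apply: Rabs_le; lra.
Qed.

Lemma CB_bound {n} (F : R -> pt n -> R) a b : CB F -> a <= b ->
  exists M, 0 <= M /\ forall t x, a <= t <= b -> Rabs (F t x) <= M.
Proof.
move=> [HB HF] Hab.
apply: (interval_cover (fun a b => exists M, 0 <= M /\ forall t x, a <= t <= b -> Rabs (F t x) <= M)) => //.
  move=> s c t Hc [M [HM H]] [N [HN H']].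
  exists (Rmax M N); split; first by apply: Rle_trans HM (Rmax_l _ _).
  move=> r x Hr; case: (Rle_lt_dec r c) => Hrc.
    by apply: Rle_trans (H r x _) (Rmax_l _ _); lra.
  by apply: Rle_trans (H' r x _) (Rmax_r _ _); lra.
move=> t Ht; have [d [Hd H]] := HF t 1 Rlt_0_1; have [M [HM HtM]] := BUC_bound _ (HB t).
exists d; split=> // s r Hs Hr Hsr; exists (M + 1); split; first lra.
move=> p x Hp; have /Rabs_le_between A := H p ltac:(apply: Rabs_def1; lra) x.
have /Rabs_le_between A' := HtM x; apply: Rabs_le; lra.
Qed.

Lemma CB_equicontinuous {n} (F : R -> pt n -> R) a b e : CB F -> a <= b -> 0 < e ->
  exists d, 0 < d /\ forall t x y, a <= t <= b -> dist x y < d -> Rabs (F t x - F t y) < e.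
Proof.
move=> [HB HF] Hab He.
apply: (interval_cover (fun a b => exists d, 0 < d /\ forall t x y, a <= t <= b ->
   dist x y < d -> Rabs (F t x - F t y) < e)) => //.
  move=> s c t Hc [d1 [Hd1 H1]] [d2 [Hd2 H2]].
  exists (Rmin d1 d2); split; first exact: Rmin_pos.
  move=> r x y Hr Hxy; case: (Rle_lt_dec r c) => Hrc.
    by apply: H1; [lra | apply: Rlt_le_trans Hxy (Rmin_l _ _)].
  by apply: H2; [lra | apply: Rlt_le_trans Hxy (Rmin_r _ _)].
move=> t Ht; have [|d [Hd H]] := HF t (e / 3); first lra.
have [|d' [Hd' H']] := proj2 (HB t) (e / 3); first lra.
exists d; split=> // s r Hs Hr Hsr; exists d'; split=> // p x y Hp Hxy.
have Hpt : Rabs (p - t) < d by apply: Rabs_def1; lra.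
have /Rabs_le_between A1 := H p Hpt x; have /Rabs_le_between A2 := H p Hpt y.
have /Rabs_def2 A3 := H' x y Hxy.
apply: Rabs_def1; lra.
Qed.

Lemma CB_comp {n} (F : R -> pt n -> R) (g : R -> R) : CB F ->
  (forall s t, Rabs (g s - g t) <= Rabs (s - t)) -> CB (fun t => F (g t)).
Proof.
move=> [HB HF] Hg; split=> // t e He; have [d [Hd H]] := HF (g t) e He.
exists d; split=> // s Hs; apply: H; exact: Rle_lt_trans (Hg s t) Hs.
Qed.

Lemma Rmax0_contract s t : Rabs (Rmax 0 s - Rmax 0 t) <= Rabs (s - t).
Proof.
rewrite /Rmax; destruct (Rle_dec 0 s), (Rle_dec 0 t);
  rewrite /Rabs; repeat destruct Rcase_abs; lra.
Qed.

Lemma CB_reflect {n} (F : R -> pt n -> R) c : CB F -> CB (fun t => F (c - t)).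
Proof.
move=> HF; apply: CB_comp => // s t.
have -> : c - s - (c - t) = - (s - t) by ring.
by rewrite Rabs_Ropp; lra.
Qed.

Lemma CB_inv_op {n} K (T : (pt n -> R) -> pt n -> R) (F : R -> pt n -> R) :
  inv_op K T -> CB F -> CB (fun t => T (F t)).
Proof.
move=> HT [HB HF]; split; first by move=> t; apply: (inv_op_BUC K).
have K0 : 0 <= K by case: HT.
move=> t e He; have [|d [Hd H]] := HF t (e / (K + 1)); first by apply: Rdiv_lt_0_compat; lra.
exists d; split=> // s Hs x.
apply: Rle_trans (inv_op_bound_minus K T _ _ _ x HT (HB s) (HB t) (H s Hs)) _.
have -> : K * (e / (K + 1)) = e - e / (K + 1) by field; lra.
have : 0 < e / (K + 1) by apply: Rdiv_lt_0_compat; lra.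
lra.
Qed.

Lemma CB_heat {n} D (F : R -> pt n -> R) : 0 < D -> CB F -> CB (fun r => heat D r (F r)).
Proof.
move=> HD [HB HF]; split; first by move=> t; apply: heat_BUC.
move=> t e He; have [|d [Hd H]] := HF t (e / 2); first lra.
have [|d' [Hd' H']] := heat_time D (F t) (e / 2) HD (HB t); first lra.
exists (Rmin d d'); split; first exact: Rmin_pos.
move=> s Hs x.
have A1 := heat_bound_minus D s (F s) (F t) _ x HD (HB s) (HB t) (H s (Rlt_le_trans _ _ _ Hs (Rmin_l _ _))).
have A2 := H' s t x (Rlt_le_trans _ _ _ Hs (Rmin_r _ _)).
move: A1 A2 => /Rabs_le_between A1 /Rabs_le_between A2.
apply: Rabs_le; lra.
Qed.

Lemma CB_continuous {n} (F : R -> pt n -> R) x t : CB F -> continuous (fun r => F r x) t.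
Proof.
move=> [_ HF]; apply: continuous_abs => e He; have [d [Hd H]] := HF t e He.
by exists d; split=> // s Hs; apply: H.
Qed.

Lemma CB_ex_RInt {n} (F : R -> pt n -> R) x a b : CB F -> ex_RInt (fun r => F r x) a b.
Proof. by move=> HF; apply: ex_RInt_continuous => z _; apply: CB_continuous. Qed.

Definition integ {n : nat} (F : R -> pt n -> R) (a b : R) : pt n -> R :=
  fun x => RInt (fun r => F r x) a b.

Lemma integ_Chasles {n} (F : R -> pt n -> R) a b c x : CB F ->
  integ F a c x = integ F a b x + integ F b c x.
Proof.
by move=> HF; rewrite /integ -(RInt_Chasles (fun r => F r x) a b c) //; apply: CB_ex_RInt.
Qed.

Lemma integ_bound {n} (F : R -> pt n -> R) a b M x : CB F -> a <= b ->
  (forall r, a <= r <= b -> Rabs (F r x) <= M) -> Rabs (integ F a b x) <= (b - a) * M.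
Proof. by move=> HF Hab H; apply: abs_RInt_le_const => //; apply: CB_ex_RInt. Qed.

Lemma integ_minus {n} (F G : R -> pt n -> R) a b x : CB F -> CB G ->
  integ (fun r y => F r y - G r y) a b x = integ F a b x - integ G a b x.
Proof.
move=> HF HG; rewrite /integ (RInt_minus (fun r => F r x) (fun r => G r x)) //; exact: CB_ex_RInt.
Qed.

Lemma CB_minus {n} (F G : R -> pt n -> R) : CB F -> CB G -> CB (fun r y => F r y - G r y).
Proof.
move=> [HB HF] [HB' HG]; split; first by move=> t; apply: BUC_minus.
move=> t e He; have [|d [Hd H]] := HF t (e / 2); first lra.
have [|d' [Hd' H']] := HG t (e / 2); first lra.
exists (Rmin d d'); split; first exact: Rmin_pos.
move=> s Hs x.
have /Rabs_le_between A1 := H s (Rlt_le_trans _ _ _ Hs (Rmin_l _ _)) x.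
have /Rabs_le_between A2 := H' s (Rlt_le_trans _ _ _ Hs (Rmin_r _ _)) x.
apply: Rabs_le; lra.
Qed.

Lemma CB_const {n} (f : pt n -> R) : BUC f -> CB (fun _ => f).
Proof.
move=> Hf; split=> // t e He; exists 1; split; first lra.
by move=> s _ x; rewrite Rminus_diag_eq // Rabs_R0; lra.
Qed.

Lemma integ_near {n} (F : R -> pt n -> R) a b f e x : CB F -> BUC f -> a <= b ->
  (forall r, a <= r <= b -> Rabs (F r x - f x) <= e) ->
  Rabs (integ F a b x - (b - a) * f x) <= (b - a) * e.
Proof.
move=> HF Hf Hab H.
have -> : (b - a) * f x = integ (fun _ => f) a b x by rewrite /integ RInt_const.
have Hc := CB_const f Hf.
by rewrite -integ_minus //; apply: integ_bound => //; apply: CB_minus.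
Qed.

Lemma integ_BUC {n} (F : R -> pt n -> R) a b : CB F -> a <= b -> BUC (integ F a b).
Proof.
move=> HF Hab; have [M [HM H]] := CB_bound F a b HF Hab; split.
  by exists ((b - a) * M) => x; apply: integ_bound => // r Hr; apply: H.
move=> e He; have He' : 0 < e / (b - a + 1) by apply: Rdiv_lt_0_compat; lra.
have [d [Hd Hs]] := CB_equicontinuous F a b _ HF Hab He'.
exists d; split=> // x y Hxy.
have -> : integ F a b x - integ F a b y = RInt (fun r => F r x - F r y) a b.
  by rewrite (RInt_minus (fun r => F r x) (fun r => F r y)) //; apply: CB_ex_RInt.
apply: (Rle_lt_trans _ ((b - a) * (e / (b - a + 1)))).
  apply: abs_RInt_le_const => //.
    by apply: (ex_RInt_minus (fun r => F r x) (fun r => F r y)); apply: CB_ex_RInt.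
  by move=> t Ht; apply: Rlt_le; apply: Hs.
have -> : (b - a) * (e / (b - a + 1)) = e - e / (b - a + 1) by field; lra.
lra.
Qed.

Lemma derive_zero_const (g : R -> R) a b : a <= b ->
  (forall e, 0 < e -> exists d, 0 < d /\
     forall r r', a <= r <= r' -> r' <= b -> r' - r < d -> Rabs (g r' - g r) <= e * (r' - r)) ->
  g b = g a.
Proof.
move=> Hab H; apply: Rminus_diag_uniq; apply: Rabs_eq_0; apply: Rle_antisym (Rabs_pos _).
apply: Rle_plus_epsilon => e He; rewrite Rplus_0_l.
have He' : 0 < e / (b - a + 1) by apply: Rdiv_lt_0_compat; lra.
have [d [Hd Hs]] := H _ He'.
have K := interval_cover (fun s t => a <= s <= t -> t <= b -> Rabs (g t - g s) <= e / (b - a + 1) * (t - s)) a b Hab.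
have : Rabs (g b - g a) <= e / (b - a + 1) * (b - a).
  apply: K; try lra.
    move=> s c t Hc H1 H2 Hst Ht.
    have /Rabs_le_between A1 := H1 ltac:(lra) ltac:(lra).
    have /Rabs_le_between A2 := H2 ltac:(lra) ltac:(lra).
    apply: Rabs_le; lra.
  move=> t Ht; exists d; split=> // s r Hs' Hr Hsr H1 H2; apply: Hs; lra.
have -> : e / (b - a + 1) * (b - a) = e - e / (b - a + 1) by field; lra.
lra.
Qed.

(** As functions of the upper limit, the two sides differ by a function whose increments are
    o(length): on a short interval F is nearly constant in time and both sides are nearly length
    times T (F r). No interchange of integrals is involved. *)
Lemma inv_op_integ {n} K (T : (pt n -> R) -> pt n -> R) (F : R -> pt n -> R) a b x :
  inv_op K T -> CB F -> a <= b ->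
  T (integ F a b) x = integ (fun r => T (F r)) a b x.
Proof.
move=> HT HF Hab; have K0 : 0 <= K by case: HT.
have HTF := CB_inv_op K T F HT HF.
pose g t := T (integ F a t) x - integ (fun r => T (F r)) a t x.
suff : g b = g a.
  rewrite /g; have -> : integ (fun r => T (F r)) a a x = 0 by rewrite /integ RInt_point.
  have -> : integ F a a = fun y => 0 * F a y.
    by apply: functional_extensionality => y; rewrite /integ RInt_point Rmult_0_l.
  rewrite (inv_op_scal K) //; last by case: HF.
  lra.
apply: derive_zero_const => // e He.
have He' : 0 < e / 2 / (K + 1) by apply: Rdiv_lt_0_compat; lra.
have [d [Hd H]] := CB_uniform F a b _ HF Hab He'.
exists d; split=> // r r' Hr Hr' Hrr.
have HFr : BUC (F r) by case: HF.
have Hi1 : BUC (integ F a r) by apply: integ_BUC => //; lra.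
have Hi2 : BUC (integ F r r') by apply: integ_BUC => //; lra.
have -> : g r' - g r = T (fun y => integ F r r' y - (r' - r) * F r y) x -
    (integ (fun p => T (F p)) r r' x - (r' - r) * T (F r) x).
  rewrite /g (integ_Chasles _ a r r') //.
  have -> : integ F a r' = fun y => integ F a r y + integ F r r' y.
    by apply: functional_extensionality => y; apply: integ_Chasles.
  rewrite (inv_op_plus K) // (inv_op_minus K) //; last exact: BUC_scal.
  rewrite (inv_op_scal K) //; ring.
have Hnear p y : r <= p <= r' -> Rabs (F p y - F r y) <= e / 2 / (K + 1).
  by move=> Hp; apply: H; [lra | rewrite Rabs_pos_eq; lra].
have A1 : Rabs (T (fun y => integ F r r' y - (r' - r) * F r y) x) <= K * ((r' - r) * (e / 2 / (K + 1))).
  case: HT => _ _ B _; apply: B; first by apply: BUC_minus => //; apply: BUC_scal.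
  by move=> y; apply: integ_near => //; [lra | move=> p Hp; apply: Hnear].
have A2 : Rabs (integ (fun p => T (F p)) r r' x - (r' - r) * T (F r) x) <= (r' - r) * (K * (e / 2 / (K + 1))).
  apply: integ_near => //; [exact: (inv_op_BUC K) | lra | move=> p Hp].
  by apply: inv_op_bound_minus => //; [case: HF | move=> y; apply: Hnear].
have E : K * (e / 2 / (K + 1)) <= e / 2.
  have -> : K * (e / 2 / (K + 1)) = e / 2 - e / 2 / (K + 1) by field; lra.
  lra.
have := Rmult_le_compat_l (r' - r) _ _ ltac:(lra) E.
move: A1 A2 => /Rabs_le_between A1 /Rabs_le_between A2 A3.
apply: Rabs_le; lra.
Qed.

(** * Mild solutions *)

(** The Duhamel integrand in terms of the elapsed time r = t - s: the smoothing singularity sits at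
    r = 0, and the recent past is the interval [0, d]. *)
Definition duh {n : nat} (D : R) (G : R -> pt n -> R) (t : R) : R -> pt n -> R :=
  fun r => heat D r (G (t - r)).

Definition mild {n : nat} (D : R) (u0 : pt n -> R) (G : R -> pt n -> R) (t : R) : pt n -> R :=
  fun x => heat D t u0 x + integ (duh D G t) 0 t x.

Lemma CB_duh {n} D (G : R -> pt n -> R) t : 0 < D -> CB G -> CB (duh D G t).
Proof. by move=> HD HG; apply: (CB_heat D (fun r => G (t - r))) => //; apply: CB_reflect. Qed.

Lemma duh_bound {n} D (G : R -> pt n -> R) t r M x : 0 < D -> CB G ->
  (forall y, Rabs (G (t - r) y) <= M) -> Rabs (duh D G t r x) <= M.
Proof. by move=> HD [HG _] HM; apply: heat_bound. Qed.

Lemma mild_BUC {n} D u0 (G : R -> pt n -> R) t : 0 < D -> BUC u0 -> CB G -> 0 <= t ->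
  BUC (mild D u0 G t).
Proof.
move=> HD Hu HG Ht; apply: BUC_plus; first exact: heat_BUC.
by apply: integ_BUC => //; apply: CB_duh.
Qed.

Lemma mild_0 {n} D u0 (G : R -> pt n -> R) : mild D u0 G 0 = u0.
Proof.
apply: functional_extensionality => x.
by rewrite /mild heat_0 /integ RInt_point Rplus_0_r.
Qed.

(** Restarting at time a: the part of the integral with elapsed time beyond t is S(t) applied to the
    Duhamel integral at time a, by the semigroup law and commutation with integrals. *)
Lemma mild_split {n} D u0 (G : R -> pt n -> R) a t x : 0 < D -> BUC u0 -> CB G ->
  0 <= a -> 0 <= t ->
  mild D u0 G (a + t) x = heat D t (mild D u0 G a) x + integ (duh D G (a + t)) 0 t x.
Proof.
move=> HD Hu HG Ha Ht.
have Hd := CB_duh D G (a + t) HD HG; have Hda := CB_duh D G a HD HG.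
rewrite /mild (inv_op_plus 1) //; first last.
- exact: integ_BUC.
- exact: heat_BUC.
- exact: heat_inv_op.
rewrite -heat_semigroup // (Rplus_comm t a) (integ_Chasles _ 0 t) //.
suff -> : integ (duh D G (a + t)) t (a + t) x = heat D t (integ (duh D G a) 0 a) x by ring.
rewrite (inv_op_integ 1) //; last exact: heat_inv_op.
rewrite /integ.
have := RInt_comp_lin (fun r => duh D G (a + t) r x) 1 t 0 a (CB_ex_RInt _ _ _ _ Hd).
rewrite Rmult_0_r Rplus_0_l Rmult_1_l => <-.
apply: RInt_ext => r; rewrite Rmin_left // Rmax_right // => Hr.
rewrite /scal /= /mult /= !Rmult_1_l /duh Rplus_comm.
have -> : a + t - (t + r) = a - r by ring.
by rewrite heat_semigroup //; [lra | case: HG].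
Qed.

Lemma mild_back {n} D u0 (G : R -> pt n -> R) t d x : 0 < D -> BUC u0 -> CB G ->
  0 <= d <= t ->
  mild D u0 G t x - heat D d (mild D u0 G (t - d)) x = integ (duh D G t) 0 d x.
Proof.
move=> HD Hu HG Hd; have := mild_split D u0 G (t - d) d x HD Hu HG ltac:(lra) ltac:(lra).
have -> : t - d + d = t by ring.
move=> ->; ring.
Qed.

Lemma mild_continuous {n} D u0 (G : R -> pt n -> R) : 0 < D -> BUC u0 -> CB G ->
  CB (fun t => mild D u0 G (Rmax 0 t)).
Proof.
move=> HD Hu HG; split; first by move=> t; apply: mild_BUC => //; apply: Rmax_l.
move=> t0 e He; set T := Rmax 0 t0 + 1.
have HT : 0 < T by rewrite /T; move: (Rmax_l 0 t0); lra.
have [M [HM HMG]] := CB_bound G 0 T HG ltac:(lra).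
have [|d1 [Hd1 H1]] := heat_time D u0 (e / 3) HD Hu; first lra.
have He2 : 0 < e / 3 / T by apply: Rdiv_lt_0_compat; lra.
have [d2 [Hd2 H2]] := CB_uniform G 0 T _ HG (Rlt_le _ _ HT) He2.
have He3 : 0 < e / 3 / (M + 1) by apply: Rdiv_lt_0_compat; lra.
have key a b x : 0 <= a <= b -> b <= T -> b - a < d1 -> b - a < d2 -> b - a < e / 3 / (M + 1) ->
    Rabs (mild D u0 G b x - mild D u0 G a x) <= e.
  (* The piece over [a, b] is short. Over [0, a] both integrands carry the same operator S(r), so
     only the time modulus of G is involved there. *)
  move=> Hab Hb B1 B2 B3; rewrite /mild (integ_Chasles _ 0 a); last exact: CB_duh.
  have C1 := H1 b a x ltac:(rewrite Rabs_pos_eq; lra).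
  have C2 : Rabs (integ (duh D G b) a b x) <= (b - a) * M.
    apply: integ_bound; [exact: CB_duh | lra | move=> r Hr].
    by apply: duh_bound => // y; apply: HMG; lra.
  have C3 : Rabs (integ (duh D G b) 0 a x - integ (duh D G a) 0 a x) <= (a - 0) * (e / 3 / T).
    rewrite -integ_minus; try exact: CB_duh.
    apply: integ_bound; [by apply: CB_minus; apply: CB_duh | lra | move=> r Hr].
    apply: heat_bound_minus => //; try (by case: HG).
    by move=> y; apply: H2; [lra | rewrite Rabs_pos_eq; lra].
  have C4 : (a - 0) * (e / 3 / T) <= e / 3.
    have {2}-> : e / 3 = T * (e / 3 / T) by field; lra.
    by apply: Rmult_le_compat_r; lra.
  have C5 : (b - a) * M <= e / 3.
    have {1}-> : e / 3 = e / 3 / (M + 1) * (M + 1) by field; lra.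
    by apply: Rmult_le_compat; lra.
  move: C1 C2 C3 => /Rabs_le_between C1 /Rabs_le_between C2 /Rabs_le_between C3.
  apply: Rabs_le; lra.
pose d := Rmin (Rmin d1 d2) (Rmin (e / 3 / (M + 1)) 1).
have Hd : 0 < d by repeat apply: Rmin_pos => //; lra.
have D1 : d <= d1 by apply: Rle_trans (Rmin_l _ _) (Rmin_l _ _).
have D2 : d <= d2 by apply: Rle_trans (Rmin_l _ _) (Rmin_r _ _).
have D3 : d <= e / 3 / (M + 1) by apply: Rle_trans (Rmin_r _ _) (Rmin_l _ _).
have D4 : d <= 1 by apply: Rle_trans (Rmin_r _ _) (Rmin_r _ _).
exists d; split=> // s Hs x.
have Hm : Rabs (Rmax 0 s - Rmax 0 t0) < d.
  exact: Rle_lt_trans (Rmax0_contract _ _) Hs.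
move: Hm => /Rabs_def2 Hm.
case: (Rle_lt_dec (Rmax 0 s) (Rmax 0 t0)) => Hst; last first.
  by apply: key; try (rewrite /T; lra); split; [exact: Rmax_l | lra].
by rewrite Rabs_minus_sym; apply: key; try (rewrite /T; lra); split; [exact: Rmax_l | lra].
Qed.

(** * Spatial regularity of mild solutions *)

(** The integrand is continuous and only its bound is singular, so no improper integral is needed:
    the primitive minus 2 A sqrt(s) is compared at the endpoints by the mean value theorem. *)
Lemma sqrt_singular_integral (f : R -> R) (A d : R) : 0 <= A -> 0 <= d ->
  (forall t, continuous f t) -> (forall r, 0 < r <= d -> Rabs (f r) <= A / sqrt r) ->
  Rabs (RInt f 0 d) <= 2 * A * sqrt d.
Proof.
move=> HA Hd Hc Hf.
suff key g : (forall t, continuous g t) -> (forall r, 0 < r <= d -> g r <= A / sqrt r) ->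
    RInt g 0 d <= 2 * A * sqrt d.
  have K1 := key f Hc (fun r Hr => Rle_trans _ _ _ (Rle_abs _) (Hf r Hr)).
  have K2 : RInt (fun r => - f r) 0 d <= 2 * A * sqrt d.
    apply: key => [t|r Hr]; first by apply: continuous_opp.
    by have /Rabs_le_between := Hf r Hr; lra.
  rewrite (RInt_opp f) /opp /= in K2; last by apply: ex_RInt_continuous.
  apply: Rabs_le; lra.
move=> Hg Hgr.
pose P s := RInt g 0 s.
have HP s : is_derive P s (g s).
  apply: (is_derive_RInt g P 0) => //.
  by apply: filter_forall => b; apply: RInt_correct; apply: ex_RInt_continuous.
(* The mean value point may be the endpoint 0, where sqrt has no derivative; the default value 0
   there still gives the required sign. *)
have := MVT_gen (fun s => P s - 2 * A * sqrt s) 0 d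
  (fun s => match Rlt_dec 0 s with left _ => g s - 2 * A * / (2 * sqrt s) | right _ => 0 end).
rewrite /= Rmin_left // Rmax_right //; case.
- move=> s Hs; case: Rlt_dec => H0; last lra.
  apply: is_derive_minus; first exact: HP.
  apply: is_derive_scal; have := is_derive_sqrt (fun s => s) s 1 (is_derive_id s) H0.
  by rewrite /scal /= /mult /= /Rdiv Rmult_1_l.
- move=> s Hs; apply: continuity_pt_minus.
    by apply/continuity_pt_filterlim; apply: ex_derive_continuous; exists (g s).
  by apply: continuity_pt_mult; [exact: continuity_pt_const | apply: continuity_pt_sqrt; lra].
move=> c [[Hc0 Hcd] E].
have P0 : P 0 = 0 by rewrite /P RInt_point.
rewrite sqrt_0 Rmult_0_r P0 in E.
suff : P d - 2 * A * sqrt d <= 0 by rewrite /P; lra.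
case: Rlt_dec E => H0 E; last lra.
have Hs := sqrt_lt_R0 _ H0.
have := Hgr c (conj H0 Hcd).
have -> : A / sqrt c = 2 * A * / (2 * sqrt c) by field; lra.
move=> K; have : (g c - 2 * A * / (2 * sqrt c)) * (d - 0) <= 0 by nra.
lra.
Qed.

(** Integrating the gradient bound M / sqrt(D r) over [0, d]. That the result vanishes with d is
    what drives the regularity theory. *)
Lemma duh_lips {n} D (G : R -> pt n -> R) t d M : 0 < D -> CB G -> 0 <= d <= t -> 0 <= M ->
  (forall r x, t - d <= r <= t -> Rabs (G r x) <= M) ->
  lips (2 * (M / sqrt D) * sqrt d) (integ (duh D G t) 0 d).
Proof.
move=> HD HG Hd HM H i r x.
have Hdu := CB_duh D G t HD HG.
have HsD := sqrt_lt_R0 _ HD.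
have HMD : 0 <= M / sqrt D by apply: Rmult_le_pos => //; apply: Rlt_le; apply: Rinv_0_lt_compat.
have -> : integ (duh D G t) 0 d (shift x i r) - integ (duh D G t) 0 d x =
    RInt (fun p => duh D G t p (shift x i r) - duh D G t p x) 0 d.
  rewrite (RInt_minus (fun p => duh D G t p (shift x i r)) (fun p => duh D G t p x)) //; exact: CB_ex_RInt.
have -> : 2 * (M / sqrt D) * sqrt d * Rabs r = 2 * (M / sqrt D * Rabs r) * sqrt d by ring.
apply: sqrt_singular_integral; [by apply: Rmult_le_pos => //; exact: Rabs_pos | lra | |].
  move=> p; apply: (continuous_minus (fun p => duh D G t p (shift x i r)) (fun p => duh D G t p x));
  exact: CB_continuous.
move=> p Hp; have Hsp := sqrt_lt_R0 _ (proj1 Hp).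
have := heat_lips D p (G (t - p)) M HD (proj1 Hp) (proj1 HG _) (fun y => H (t - p) y ltac:(lra)) i r x.
rewrite sqrt_mult; try lra.
by have -> : M / sqrt D * Rabs r / sqrt p = M / (sqrt D * sqrt p) * Rabs r by field; lra.
Qed.

(** A smooth g within e sqrt(D t) of f in sup norm gives, by [heat_lips], an approximant S(t) g
    within e in Lipschitz seminorm. *)
Lemma heat_BUC1 {n} D t (f : pt n -> R) : 0 < D -> 0 < t -> BUC f -> BUC1 (heat D t f).
Proof.
move=> HD Ht Hf; apply: (proj1 (BUC1_closure _ (heat_BUC D t f HD Hf) _)) => e He.
have Hs : 0 < sqrt (D * t) by apply: sqrt_lt_R0; apply: Rmult_lt_0_compat.
have [|g [Hg Hfg]] := BUC2_dense f (e * sqrt (D * t)) Hf; first exact: Rmult_lt_0_compat.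
have HgB : BUC g by case: Hg => [[]].
exists (heat D t g); split; first by apply: (inv_op_BUC1 1); [apply: heat_inv_op | case: Hg].
have -> : (fun x => heat D t f x - heat D t g x) = heat D t (fun x => f x - g x).
  apply: functional_extensionality => x; rewrite (inv_op_minus 1) //; exact: heat_inv_op.
have {1}-> : e = e * sqrt (D * t) / sqrt (D * t) by field; lra.
by apply: heat_lips => //; apply: BUC_minus.
Qed.

Lemma heat_Der_bound {n} D t (f : pt n -> R) i M x : 0 < D -> 0 < t -> BUC f ->
  (forall y, Rabs (f y) <= M) -> Rabs (Der i (heat D t f) x) <= M / sqrt (D * t).
Proof.
move=> HD Ht Hf HM; have [_ P] := BUC1_Der i _ (heat_BUC1 D t f HD Ht Hf).
by apply: (partial_le_lips i _ _ _ x P); apply: heat_lips.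
Qed.

Lemma heat_half {n} D t (f : pt n -> R) : 0 < D -> 0 < t -> BUC f ->
  heat D t f = heat D (t / 2) (heat D (t / 2) f).
Proof.
move=> HD Ht Hf; rewrite -heat_semigroup //; try lra.
by congr (heat D _ f); field.
Qed.

(** Half of the time produces one derivative, which is a BUC function on which the other half
    acts. *)
Lemma heat_BUC2 {n} D t (f : pt n -> R) : 0 < D -> 0 < t -> BUC f -> BUC2 (heat D t f).
Proof.
move=> HD Ht Hf; split; first exact: heat_BUC1.
have Ht2 : 0 < t / 2 by lra.
have H1 := heat_BUC1 D (t / 2) f HD Ht2 Hf.
move=> i; rewrite heat_half // (inv_op_Der 1) //; last exact: heat_inv_op.
by apply: heat_BUC1 => //; case: (BUC1_Der i _ H1).
Qed.

Lemma heat_Der2_bound {n} D t (f : pt n -> R) i j M x : 0 < D -> 0 < t -> BUC f ->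
  (forall y, Rabs (f y) <= M) ->
  Rabs (Der i (Der j (heat D t f)) x) <= M / sqrt (D * (t / 2)) / sqrt (D * (t / 2)).
Proof.
move=> HD Ht Hf HM; have Ht2 : 0 < t / 2 by lra.
have H1 := heat_BUC1 D (t / 2) f HD Ht2 Hf.
rewrite heat_half // (inv_op_Der 1 _ _ j) //; last exact: heat_inv_op.
apply: heat_Der_bound => //; first by case: (BUC1_Der j _ H1).
by move=> y; apply: heat_Der_bound.
Qed.

Lemma mild_BUC1 {n} D u0 (G : R -> pt n -> R) t : 0 < D -> BUC u0 -> CB G -> 0 < t ->
  BUC1 (mild D u0 G t).
Proof.
move=> HD Hu HG Ht; apply: (proj1 (BUC1_closure _ _ _)); first by apply: mild_BUC => //; lra.
move=> e He; have [M [HM HMG]] := CB_bound G 0 t HG ltac:(lra).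
have HsD := sqrt_lt_R0 _ HD.
pose k := e / (2 * (M / sqrt D) + 1).
have HMD : 0 <= M / sqrt D by apply: Rmult_le_pos => //; apply: Rlt_le; apply: Rinv_0_lt_compat.
have Hk : 0 < k by apply: Rdiv_lt_0_compat; lra.
pose d := Rmin t (k ^ 2).
have Hd : 0 < d by apply: Rmin_pos => //; apply: pow_lt.
have Hdt : d <= t by apply: Rmin_l.
have Hsd : sqrt d <= k.
  rewrite -(sqrt_pow2 k); last lra; apply: sqrt_le_1; try lra; first exact: pow2_ge_0.
  exact: Rmin_r.
exists (heat D d (mild D u0 G (t - d))); split.
  by apply: heat_BUC1 => //; apply: mild_BUC => //; lra.
have -> : (fun x => mild D u0 G t x - heat D d (mild D u0 G (t - d)) x) = integ (duh D G t) 0 d.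
  by apply: functional_extensionality => x; apply: mild_back => //; lra.
move=> i r x; apply: (Rle_trans _ _ _ (duh_lips D G t d M HD HG _ HM _ i r x)); first lra.
  by move=> p y Hp; apply: HMG; lra.
apply: Rmult_le_compat_r; first exact: Rabs_pos.
have := Rmult_le_compat_l (2 * (M / sqrt D)) _ _ ltac:(lra) Hsd.
have -> : 2 * (M / sqrt D) * k = e - k by rewrite /k; field; lra.
lra.
Qed.

Lemma small_sqrt (A e t : R) : 0 <= A -> 0 < e -> 0 < t ->
  exists d, 0 < d <= t /\ A * sqrt d <= e.
Proof.
move=> HA He Ht; pose k := e / (A + 1).
have Hk : 0 < k by apply: Rdiv_lt_0_compat; lra.
exists (Rmin t (k ^ 2)); split.
  split; last exact: Rmin_l.
  by apply: Rmin_pos => //; apply: pow_lt.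
have Hsd : sqrt (Rmin t (k ^ 2)) <= k.
  rewrite -(sqrt_pow2 k); last lra; apply: sqrt_le_1; first by apply: Rmin_glb; [lra | exact: pow2_ge_0].
    exact: pow2_ge_0.
  rewrite sqrt_pow2; [exact: Rmin_r | lra].
have := Rmult_le_compat_l A _ _ HA Hsd.
have -> : A * k = e - k by rewrite /k; field; lra.
lra.
Qed.

Lemma CB_shift {n} (F : R -> pt n -> R) i r : CB F -> CB (fun t x => F t (shift x i r)).
Proof.
move=> [HB HF]; split; first by move=> t; apply: BUC_shift.
move=> t e He; have [d [Hd H]] := HF t e He; exists d; split=> // s Hs x; exact: H.
Qed.

Lemma derive_le_increment (g : R -> R) l A : is_derive g 0 l ->
  (forall r, Rabs (g r - g 0) <= A * Rabs r) -> Rabs l <= A.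
Proof.
move=> H HL; apply: Rle_plus_epsilon => e He.
have /is_derive_Reals /(_ e He) [d Hd] := H.
have Hp := cond_pos d.
have := Hd (d / 2) ltac:(lra) ltac:(rewrite Rabs_pos_eq; lra).
rewrite Rplus_0_l => K.
have := HL (d / 2); set a := g _ - g _ in K *.
move=> K2; have : Rabs (a / (d / 2)) <= A.
  rewrite Rabs_div; last lra.
  apply/Rle_div_l => //; apply: Rabs_pos_lt; lra.
move: K => /Rabs_def2 [K3 K4] /Rabs_le_between K5.
apply: Rabs_le; lra.
Qed.

(** Mixed second differences are symmetric in the two directions, so the hypothesis also bounds the
    j-increment of an i-increment; dividing by r gives the claim. *)
Lemma lips_partial {n} (j : 'I_n) f g A : partial j f g ->
  (forall r, lips (A * Rabs r) (fun x => f (shift x j r) - f x)) -> lips A g.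
Proof.
move=> Hp HL i p x.
apply: (derive_le_increment (fun r => f (shift (shift x i p) j r) - f (shift x j r))).
  by apply: is_derive_minus; apply: Hp.
move=> r; rewrite !shift0.
have := HL r i p x; rewrite (shift_comm x i j) => K.
have -> : f (shift (shift x j r) i p) - f (shift x j r) - (f (shift x i p) - f x) =
   f (shift (shift x j r) i p) - f (shift x i p) - (f (shift x j r) - f x) by ring.
by have -> : A * Rabs p * Rabs r = A * Rabs r * Rabs p by ring.
Qed.

(* The increments of the Duhamel integral are Duhamel integrals of increments, so a Lipschitz
   source gains one more derivative. *)
Lemma duh_increment_lips {n} D (G : R -> pt n -> R) t d L j p :
  0 < D -> CB G -> 0 <= d <= t -> 0 <= L ->
  (forall r, t - d <= r <= t -> lips L (G r)) ->
  lips (2 * (L / sqrt D) * sqrt d * Rabs p)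
    (fun x => integ (duh D G t) 0 d (shift x j p) - integ (duh D G t) 0 d x).
Proof.
move=> HD HG Hd HL H.
pose G' r x := G r (shift x j p) - G r x.
have HG' : CB G' by apply: CB_minus => //; apply: CB_shift.
have HB r : BUC (G r) by case: HG.
have -> : (fun x => integ (duh D G t) 0 d (shift x j p) - integ (duh D G t) 0 d x) =
    integ (duh D G' t) 0 d.
  apply: functional_extensionality => x; have Hdu := CB_duh D G t HD HG.
  transitivity (RInt (fun r => duh D G t r (shift x j p) - duh D G t r x) 0 d).
    rewrite (RInt_minus (fun r => duh D G t r (shift x j p)) (fun r => duh D G t r x)) //; exact: CB_ex_RInt.
  apply: RInt_ext => r _; rewrite /duh /G' (inv_op_minus 1) //; first last.
  - exact: BUC_shift.
  - exact: heat_inv_op.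
  by rewrite (inv_op_shift 1) //; exact: heat_inv_op.
have -> : 2 * (L / sqrt D) * sqrt d * Rabs p = 2 * (L * Rabs p / sqrt D) * sqrt d.
  rewrite /Rdiv; ring.
apply: duh_lips => //; first by apply: Rmult_le_pos => //; exact: Rabs_pos.
by move=> r x Hr; apply: H.
Qed.

Lemma heat_Der_bound_minus {n} D t (f g : pt n -> R) i M x : 0 < D -> 0 < t -> BUC f -> BUC g ->
  (forall y, Rabs (f y - g y) <= M) ->
  Rabs (Der i (heat D t f) x - Der i (heat D t g) x) <= M / sqrt (D * t).
Proof.
move=> HD Ht Hf Hg HM.
have E := Der_minus _ _ i (heat_BUC1 D t f HD Ht Hf) (heat_BUC1 D t g HD Ht Hg).
have -> : Der i (heat D t f) x - Der i (heat D t g) x = Der i (heat D t (fun y => f y - g y)) x.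
  have -> : heat D t (fun y => f y - g y) = fun y => heat D t f y - heat D t g y.
    by apply: functional_extensionality => y; rewrite (inv_op_minus 1) //; exact: heat_inv_op.
  by rewrite E.
by apply: heat_Der_bound => //; apply: BUC_minus.
Qed.

Lemma heat_Der2_bound_minus {n} D t (f g : pt n -> R) i j M x : 0 < D -> 0 < t -> BUC f -> BUC g ->
  (forall y, Rabs (f y - g y) <= M) ->
  Rabs (Der i (Der j (heat D t f)) x - Der i (Der j (heat D t g)) x) <=
    M / sqrt (D * (t / 2)) / sqrt (D * (t / 2)).
Proof.
move=> HD Ht Hf Hg HM.
have Bf := heat_BUC2 D t f HD Ht Hf; have Bg := heat_BUC2 D t g HD Ht Hg.
have E := Der_minus _ _ j (proj1 Bf) (proj1 Bg).
have E2 := Der_minus _ _ i (proj2 Bf j) (proj2 Bg j).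
have -> : Der i (Der j (heat D t f)) x - Der i (Der j (heat D t g)) x =
    Der i (Der j (heat D t (fun y => f y - g y))) x.
  have -> : heat D t (fun y => f y - g y) = fun y => heat D t f y - heat D t g y.
    by apply: functional_extensionality => y; rewrite (inv_op_minus 1) //; exact: heat_inv_op.
  by rewrite E E2.
by apply: heat_Der2_bound => //; apply: BUC_minus.
Qed.

(** * Continuity in time of the derivatives, and the equation *)

(** Sup-norm continuity at a single time: derivatives of mild solutions are controlled only for t >
    0, so they do not form [CB] curves. *)
Definition ccont {n : nat} (F : R -> pt n -> R) (t : R) : Prop :=
  forall e, 0 < e -> exists d, 0 < d /\
    forall s, Rabs (s - t) < d -> forall x, Rabs (F s x - F t x) <= e.

Lemma ccont_closure {n} (F : R -> pt n -> R) t :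
  (forall e, 0 < e -> exists H d, [/\ 0 < d, ccont H t &
     forall s, Rabs (s - t) < d -> forall x, Rabs (F s x - H s x) <= e]) -> ccont F t.
Proof.
move=> HF e He; have [|H [d [Hd HH Hc]]] := HF (e / 3); first lra.
have [|d' [Hd' H']] := HH (e / 3); first lra.
exists (Rmin d d'); split; first exact: Rmin_pos.
move=> s Hs x.
have /Rabs_le_between A1 := Hc s (Rlt_le_trans _ _ _ Hs (Rmin_l _ _)) x.
have /Rabs_le_between A2 := H' s (Rlt_le_trans _ _ _ Hs (Rmin_r _ _)) x.
have /Rabs_le_between A3 := Hc t ltac:(rewrite Rminus_diag_eq // Rabs_R0; lra) x.
apply: Rabs_le; lra.
Qed.

Lemma ccont_lin {n} a (F G : R -> pt n -> R) t : ccont F t -> ccont G t ->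
  ccont (fun s x => a * F s x + G s x) t.
Proof.
move=> HF HG e He; have Ha : 0 < Rabs a + 1 by move: (Rabs_pos a); lra.
have [|d [Hd H]] := HF (e / 2 / (Rabs a + 1)); first by apply: Rdiv_lt_0_compat; lra.
have [|d' [Hd' H']] := HG (e / 2); first lra.
exists (Rmin d d'); split; first exact: Rmin_pos.
move=> s Hs x.
have A1 := H s (Rlt_le_trans _ _ _ Hs (Rmin_l _ _)) x.
have A2 := H' s (Rlt_le_trans _ _ _ Hs (Rmin_r _ _)) x.
have -> : a * F s x + G s x - (a * F t x + G t x) = a * (F s x - F t x) + (G s x - G t x) by ring.
apply: Rle_trans (Rabs_triang _ _) _; rewrite Rabs_mult.
have : Rabs a * Rabs (F s x - F t x) <= (Rabs a + 1) * (e / 2 / (Rabs a + 1)).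
  by apply: Rmult_le_compat; try apply: Rabs_pos; lra.
have -> : (Rabs a + 1) * (e / 2 / (Rabs a + 1)) = e / 2 by field; lra.
lra.
Qed.

Lemma ccont_const {n} (f : pt n -> R) t : ccont (fun _ => f) t.
Proof.
move=> e He; exists 1; split; first lra.
by move=> s _ x; rewrite Rminus_diag_eq // Rabs_R0; lra.
Qed.

Lemma ccont_sum {n m} (F : 'I_m -> R -> pt n -> R) t : (forall i, ccont (F i) t) ->
  ccont (fun s x => \big[Rplus/0]_(i < m) F i s x) t.
Proof.
elim: m F => [|m IH] F H.
  have -> : (fun s x => \big[Rplus/0]_(i < 0) F i s x) = fun _ (_ : pt n) => 0.
    by apply: functional_extensionality => s; apply: functional_extensionality => x; rewrite big_ord0.
  exact: ccont_const.
have -> : (fun s x => \big[Rplus/0]_(i < m.+1) F i s x) =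
          fun s x => 1 * F ord0 s x + \big[Rplus/0]_(i < m) F (lift ord0 i) s x.
  by apply: functional_extensionality => s; apply: functional_extensionality => x; rewrite big_ord_recl Rmult_1_l.
by apply: ccont_lin => //; apply: IH.
Qed.

(** Time 0 is excluded because the Lipschitz bound for a mild solution with merely BUC datum blows
    up there. *)
Definition loc_lips {n : nat} (G : R -> pt n -> R) : Prop :=
  forall a b, 0 < a <= b -> exists L, 0 <= L /\ forall t, a <= t <= b -> lips L (G t).

Lemma mild_curve {n} D u0 (G : R -> pt n -> R) t : 0 < D -> BUC u0 -> CB G -> 0 < t ->
  ccont (mild D u0 G) t.
Proof.
move=> HD Hu HG Ht e He; have [d [Hd H]] := proj2 (mild_continuous D u0 G HD Hu HG) t e He.
exists (Rmin d t); split; first exact: Rmin_pos.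
move=> s Hs x.
have Hs1 := Rlt_le_trans _ _ _ Hs (Rmin_l _ _).
have /Rabs_def2 Hs2 := Rlt_le_trans _ _ _ Hs (Rmin_r _ _).
have := H s Hs1 x; rewrite !Rmax_right; lra.
Qed.

Lemma mild_Der_back {n} D u0 (G : R -> pt n -> R) t d M i x :
  0 < D -> BUC u0 -> CB G -> 0 < d < t -> 0 <= M ->
  (forall r x, t - d <= r <= t -> Rabs (G r x) <= M) ->
  Rabs (Der i (mild D u0 G t) x - Der i (heat D d (mild D u0 G (t - d))) x) <=
    2 * (M / sqrt D) * sqrt d.
Proof.
move=> HD Hu HG Hd HM H.
have B1 := mild_BUC1 D u0 G t HD Hu HG ltac:(lra).
have B2 : BUC1 (heat D d (mild D u0 G (t - d))).
  by apply: heat_BUC1 => //; [lra | apply: mild_BUC => //; lra].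
apply: (partial_le_lips i (fun y => mild D u0 G t y - heat D d (mild D u0 G (t - d)) y)
   (fun y => Der i (mild D u0 G t) y - Der i (heat D d (mild D u0 G (t - d))) y)).
  by apply: partial_minus; [case: (BUC1_Der i _ B1) | case: (BUC1_Der i _ B2)].
have -> : (fun x => mild D u0 G t x - heat D d (mild D u0 G (t - d)) x) = integ (duh D G t) 0 d.
  by apply: functional_extensionality => y; apply: mild_back => //; lra.
by apply: duh_lips => //; lra.
Qed.

Lemma mild_Der_back_lips {n} D u0 (G : R -> pt n -> R) t d L j :
  0 < D -> BUC u0 -> CB G -> 0 < d < t -> 0 <= L ->
  (forall r, t - d <= r <= t -> lips L (G r)) ->
  lips (2 * (L / sqrt D) * sqrt d)
    (fun x => Der j (mild D u0 G t) x - Der j (heat D d (mild D u0 G (t - d))) x).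
Proof.
move=> HD Hu HG Hd HL H.
have B1 := mild_BUC1 D u0 G t HD Hu HG ltac:(lra).
have B2 : BUC1 (heat D d (mild D u0 G (t - d))).
  by apply: heat_BUC1 => //; [lra | apply: mild_BUC => //; lra].
apply: (lips_partial j (fun y => mild D u0 G t y - heat D d (mild D u0 G (t - d)) y)).
  by apply: partial_minus; [case: (BUC1_Der j _ B1) | case: (BUC1_Der j _ B2)].
move=> r.
have E : integ (duh D G t) 0 d = fun y => mild D u0 G t y - heat D d (mild D u0 G (t - d)) y.
  by apply: functional_extensionality => y; rewrite mild_back //; lra.
have := duh_increment_lips D G t d L j r HD HG ltac:(lra) HL H.
by rewrite E.
Qed.

Lemma mild_BUC2_approx {n} D u0 (G : R -> pt n -> R) t : 0 < D -> BUC u0 -> CB G ->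
  loc_lips G -> 0 < t ->
  BUC2 (mild D u0 G t) /\
  forall d L i j x, 0 < d < t -> 0 <= L -> (forall r, t - d <= r <= t -> lips L (G r)) ->
    Rabs (Der i (Der j (mild D u0 G t)) x - Der i (Der j (heat D d (mild D u0 G (t - d)))) x) <=
      2 * (L / sqrt D) * sqrt d.
Proof.
move=> HD Hu HG HLG Ht; have HsD := sqrt_lt_R0 _ HD.
have B1 := mild_BUC1 D u0 G t HD Hu HG Ht.
have B2 d : 0 < d < t -> BUC2 (heat D d (mild D u0 G (t - d))).
  by move=> Hd; apply: heat_BUC2 => //; [lra | apply: mild_BUC => //; lra].
have key j : BUC1 (Der j (mild D u0 G t)) /\ forall e g i x, BUC1 g ->
    lips e (fun x => Der j (mild D u0 G t) x - g x) ->
    Rabs (Der i (Der j (mild D u0 G t)) x - Der i g x) <= e.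
  apply: BUC1_closure; first by case: (BUC1_Der j _ B1).
  (* With d at most t/2, the window [t - d, t] stays where the source has Lipschitz constant [L]. *)
  move=> e He; have [L [HL HLt]] := HLG (t / 2) t ltac:(lra).
  have HLD : 0 <= L / sqrt D by apply: Rmult_le_pos => //; apply: Rlt_le; apply: Rinv_0_lt_compat.
  have [|||d [Hd Hde]] := small_sqrt (2 * (L / sqrt D)) e (t / 2); try lra.
  exists (Der j (heat D d (mild D u0 G (t - d)))); split.
    by apply: (proj2 (B2 d _)); lra.
  move=> i r x; apply: Rle_trans (mild_Der_back_lips D u0 G t d L j HD Hu HG _ HL _ i r x) _.
  - lra.
  - by move=> p Hp; apply: HLt; lra.
  - by apply: Rmult_le_compat_r => //; exact: Rabs_pos.
split; first by split=> // j; case: (key j).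
move=> d L i j x Hd HL H; apply: (proj2 (key j)); first exact: (proj2 (B2 d Hd)).
exact: mild_Der_back_lips.
Qed.

Lemma back_cont {n} D u0 (G : R -> pt n -> R) t d : 0 < D -> BUC u0 -> CB G -> 0 < d < t ->
  forall e, 0 < e -> exists d', 0 < d' /\ forall s, Rabs (s - t) < d' ->
    BUC (mild D u0 G (s - d)) /\
    forall x, Rabs (mild D u0 G (s - d) x - mild D u0 G (t - d) x) <= e.
Proof.
move=> HD Hu HG Hd e He.
have [d' [Hd' H']] := mild_curve D u0 G (t - d) HD Hu HG ltac:(lra) e He.
exists (Rmin d' (t - d)); split; first by apply: Rmin_pos => //; lra.
move=> s Hs; have /Rabs_def2 Hs2 := Rlt_le_trans _ _ _ Hs (Rmin_r _ _).
split; first by apply: mild_BUC => //; lra.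
apply: H'; have -> : s - d - (t - d) = s - t by ring.
exact: Rlt_le_trans Hs (Rmin_l _ _).
Qed.

(** For fixed d, differentiation after S(d) is bounded in sup norm, so s -> Der S(d) U(s - d)
    inherits continuity from U. The error of this approximation is uniform for s near t. *)
Lemma mild_Der_ccont {n} D u0 (G : R -> pt n -> R) t i : 0 < D -> BUC u0 -> CB G -> 0 < t ->
  ccont (fun s => Der i (mild D u0 G s)) t.
Proof.
move=> HD Hu HG Ht; apply: ccont_closure => e He.
have HsD := sqrt_lt_R0 _ HD.
have [M [HM HMG]] := CB_bound G 0 (t + t) HG ltac:(lra).
have HMD : 0 <= M / sqrt D by apply: Rmult_le_pos => //; apply: Rlt_le; apply: Rinv_0_lt_compat.
(* With d and |s - t| at most t/4, the time s - d remains positive and the window stays inside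
   [0, 2t]. *)
have [|||d [Hd Hde]] := small_sqrt (2 * (M / sqrt D)) e (t / 4); try lra.
exists (fun s => Der i (heat D d (mild D u0 G (s - d)))), (t / 4); split; first lra.
  move=> e' He'; have Hsq : 0 < sqrt (D * d) by apply: sqrt_lt_R0; apply: Rmult_lt_0_compat; lra.
  have [|d' [Hd' H']] := back_cont D u0 G t d HD Hu HG ltac:(lra) (e' * sqrt (D * d)).
    exact: Rmult_lt_0_compat.
  exists d'; split=> // s Hs x; have [HB Hx] := H' s Hs.
  apply: (Rle_trans _ (e' * sqrt (D * d) / sqrt (D * d))); last by right; field; lra.
  by apply: heat_Der_bound_minus => //; [lra | apply: mild_BUC => //; lra].
move=> s /Rabs_def2 Hs x; apply: Rle_trans Hde.
by apply: mild_Der_back => //; [lra | move=> r y Hr; apply: HMG; lra].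
Qed.

Lemma mild_Der2_ccont {n} D u0 (G : R -> pt n -> R) t i j : 0 < D -> BUC u0 -> CB G ->
  loc_lips G -> 0 < t ->
  ccont (fun s => Der i (Der j (mild D u0 G s))) t.
Proof.
move=> HD Hu HG HLG Ht; apply: ccont_closure => e He.
have HsD := sqrt_lt_R0 _ HD.
have [L [HL HLt]] := HLG (t / 4) (t + t) ltac:(lra).
have HLD : 0 <= L / sqrt D by apply: Rmult_le_pos => //; apply: Rlt_le; apply: Rinv_0_lt_compat.
have [|||d [Hd Hde]] := small_sqrt (2 * (L / sqrt D)) e (t / 4); try lra.
exists (fun s => Der i (Der j (heat D d (mild D u0 G (s - d))))), (t / 4); split; first lra.
  move=> e' He'; have Hsq : 0 < sqrt (D * (d / 2)) by apply: sqrt_lt_R0; apply: Rmult_lt_0_compat; lra.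
  have [|d' [Hd' H']] := back_cont D u0 G t d HD Hu HG ltac:(lra) (e' * sqrt (D * (d / 2)) * sqrt (D * (d / 2))).
    by apply: Rmult_lt_0_compat => //; apply: Rmult_lt_0_compat.
  exists d'; split=> // s Hs x; have [HB Hx] := H' s Hs.
  apply: (Rle_trans _ (e' * sqrt (D * (d / 2)) * sqrt (D * (d / 2)) / sqrt (D * (d / 2)) / sqrt (D * (d / 2))));
    last by right; field; lra.
  by apply: heat_Der2_bound_minus => //; [lra | apply: mild_BUC => //; lra].
move=> s /Rabs_def2 Hs x; apply: Rle_trans Hde.
apply: (proj2 (mild_BUC2_approx D u0 G s HD Hu HG HLG _)); try lra.
by move=> r Hr; apply: HLt; lra.
Qed.

Lemma mild_DLap_ccont {n} D u0 (G : R -> pt n -> R) t : 0 < D -> BUC u0 -> CB G ->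
  loc_lips G -> 0 < t -> ccont (fun s => DLap D (mild D u0 G s)) t.
Proof.
move=> HD Hu HG HLG Ht.
have H : ccont (fun s x => \big[Rplus/0]_(i < n) Der i (Der i (mild D u0 G s)) x) t.
  by apply: ccont_sum => i; apply: mild_Der2_ccont.
have := ccont_lin D _ _ t H (ccont_const (fun _ => 0) t).
congr ccont; apply: functional_extensionality => s; apply: functional_extensionality => x.
by rewrite /DLap Rplus_0_r.
Qed.

(** The semigroup only runs forward, so increments are estimated from an earlier a to a later b;
    letting either one be t gives both one-sided derivatives. *)
Lemma is_derive_two_sided (g : R -> R) t l :
  (forall e, 0 < e -> exists d, 0 < d /\ forall a b, t - d < a -> a < b -> b < t + d ->
     Rabs (g b - g a - (b - a) * l) <= (b - a) * e) -> is_derive g t l.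
Proof.
move=> H; apply/is_derive_Reals => e He.
have [|d [Hd Hab]] := H (e / 2); first lra.
exists (mkposreal d Hd) => r Hr0 /= /Rabs_def2 Hr.
have -> : (g (t + r) - g t) / r - l = (g (t + r) - g t - r * l) / r by field.
rewrite Rabs_div //; have Ha := Rabs_pos_lt _ Hr0.
apply: (Rle_lt_trans _ (e / 2)); last lra.
apply/Rle_div_l => //.
case: (Rtotal_order r 0) => [Hn|[//|Hp]].
  have := Hab (t + r) t ltac:(lra) ltac:(lra) ltac:(lra).
  rewrite (Rabs_left r) // => K; rewrite -Rabs_Ropp.
  have -> : - (g (t + r) - g t - r * l) = g t - g (t + r) - (t - (t + r)) * l by ring.
  by apply: Rle_trans K _; right; ring.
have := Hab t (t + r) ltac:(lra) ltac:(lra) ltac:(lra).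
rewrite (Rabs_pos_eq r); last lra.
have -> : t + r - t = r by ring.
by rewrite (Rmult_comm r (e / 2)).
Qed.

Lemma mild_time_derivative {n} D u0 (G : R -> pt n -> R) t x : 0 < D -> BUC u0 -> CB G ->
  loc_lips G -> 0 < t ->
  is_derive (fun s => mild D u0 G s x) t (DLap D (mild D u0 G t) x + G t x).
Proof.
move=> HD Hu HG HLG Ht; set U := mild D u0 G.
have HU s : 0 < s -> BUC2 (U s).
  by move=> Hs; apply: (proj1 (mild_BUC2_approx D u0 G s HD Hu HG HLG Hs)).
have HL s : 0 < s -> BUC (DLap D (U s)) by move=> Hs; apply: DLap_BUC; apply: HU.
apply: is_derive_two_sided => e He; have He4 : 0 < e / 4 by lra.
have [d1 [Hd1 H1]] := mild_DLap_ccont D u0 G t HD Hu HG HLG Ht (e / 4) He4.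
have [d2 [Hd2 H2]] := heat_time D (DLap D (U t)) (e / 4) HD (HL t Ht) He4.
have [d3 [Hd3 H3]] := proj2 HG t (e / 4) He4.
have [d4 [Hd4 H4]] := heat_time D (G t) (e / 4) HD (proj1 HG t) He4.
pose d := Rmin (Rmin d1 d2) (Rmin (Rmin d3 d4) t) / 2.
have Hd : 0 < d.
  have : 0 < Rmin (Rmin d1 d2) (Rmin (Rmin d3 d4) t) by repeat apply: Rmin_pos.
  rewrite /d; lra.
have [E1 E2 E3 E4 E5] : [/\ 2 * d <= d1, 2 * d <= d2, 2 * d <= d3, 2 * d <= d4 & 2 * d <= t].
  have F1 := Rmin_l (Rmin d1 d2) (Rmin (Rmin d3 d4) t).
  have F2 := Rmin_r (Rmin d1 d2) (Rmin (Rmin d3 d4) t).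
  have F3 := Rmin_l d1 d2; have F4 := Rmin_r d1 d2.
  have F5 := Rmin_l (Rmin d3 d4) t; have F6 := Rmin_r (Rmin d3 d4) t.
  have F7 := Rmin_l d3 d4; have F8 := Rmin_r d3 d4.
  rewrite /d; split; lra.
exists d; split=> // a b Ha Hab Hb.
have Ha0 : 0 < a by lra.
have Eb : U b x = heat D (b - a) (U a) x + integ (duh D G b) 0 (b - a) x.
  have := mild_split D u0 G a (b - a) x HD Hu HG ltac:(lra) ltac:(lra).
  by have -> : a + (b - a) = b by ring.
(* [heat_generator] starts from U(a) but is compared with the Laplacian at t: one e/4 pays for
   replacing a by t, the other for S(s) being near the identity. [A2] treats the source in the same
   way. *)
have A1 : Rabs (heat D (b - a) (U a) x - U a x - (b - a) * DLap D (U t) x) <= (b - a) * (e / 2).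
  apply: heat_generator => //; [exact: HU | lra | move=> s Hs].
  have B1 := heat_bound_minus D s (DLap D (U a)) (DLap D (U t)) (e / 4) x HD (HL a Ha0) (HL t Ht)
    (H1 a ltac:(apply: Rabs_def1; lra)).
  have := H2 s 0 x ltac:(rewrite Rabs_pos_eq; lra).
  rewrite heat_0 => B2; move: B1 B2 => /Rabs_le_between B1 /Rabs_le_between B2.
  apply: Rabs_le; lra.
have A2 : Rabs (integ (duh D G b) 0 (b - a) x - (b - a - 0) * G t x) <= (b - a - 0) * (e / 2).
  apply: integ_near; [exact: CB_duh | by case: HG | lra | move=> s Hs].
  have B1 := heat_bound_minus D s (G (b - s)) (G t) (e / 4) x HD (proj1 HG _) (proj1 HG _)
    (H3 (b - s) ltac:(apply: Rabs_def1; lra)).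
  have := H4 s 0 x ltac:(rewrite Rabs_pos_eq; lra).
  rewrite heat_0 /duh => B2; move: B1 B2 => /Rabs_le_between B1 /Rabs_le_between B2.
  apply: Rabs_le; lra.
rewrite Rminus_0_r in A2; rewrite Eb.
move: A1 A2 => /Rabs_le_between A1 /Rabs_le_between A2.
apply: Rabs_le; lra.
Qed.

(** The link between the two rounds of regularity: a fixed point is itself mild, so its reaction
    term is a locally Lipschitz source. *)
Lemma mild_loc_lips {n} D u0 (G : R -> pt n -> R) : 0 < D -> BUC u0 -> CB G ->
  loc_lips (mild D u0 G).
Proof.
move=> HD Hu HG a b Hab; have HsD := sqrt_lt_R0 _ HD.
have [M0 [HM0 HuM]] := BUC_bound _ Hu.
have [M [HM HMG]] := CB_bound G 0 b HG ltac:(lra).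
have Hsa : 0 < sqrt (D * a) by apply: sqrt_lt_R0; apply: Rmult_lt_0_compat; lra.
have HMD : 0 <= M / sqrt D by apply: Rmult_le_pos => //; apply: Rlt_le; apply: Rinv_0_lt_compat.
have HMa : 0 <= M0 / sqrt (D * a) by apply: Rmult_le_pos => //; apply: Rlt_le; apply: Rinv_0_lt_compat.
have Hsb := sqrt_pos b.
have HMb := Rmult_le_pos (2 * (M / sqrt D)) (sqrt b) ltac:(lra) Hsb.
exists (M0 / sqrt (D * a) + 2 * (M / sqrt D) * sqrt b); split; first lra.
move=> t Ht i r x; rewrite /mild.
have A1 := heat_lips D t u0 M0 HD ltac:(lra) Hu HuM i r x.
have A2 := duh_lips D G t t M HD HG ltac:(lra) HM (fun p y Hp => HMG p y ltac:(lra)) i r x.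
have Hr := Rabs_pos r.
have A3 : M0 / sqrt (D * t) * Rabs r <= M0 / sqrt (D * a) * Rabs r.
  apply: Rmult_le_compat_r => //; apply: Rmult_le_compat_l => //.
  apply: Rinv_le_contravar => //; apply: sqrt_le_1_alt; apply: Rmult_le_compat_l; lra.
have A4 : 2 * (M / sqrt D) * sqrt t * Rabs r <= 2 * (M / sqrt D) * sqrt b * Rabs r.
  apply: Rmult_le_compat_r => //; apply: Rmult_le_compat_l; first lra.
  by apply: sqrt_le_1_alt; lra.
move: A1 A2 => /Rabs_le_between A1 /Rabs_le_between A2.
apply: Rabs_le; lra.
Qed.

(** * Picard iteration *)

(** The boolean indexes the two equations of the system: [true] for u, [false] for v. *)
Definition src {n : nat} (F : bool -> R -> R -> R) (U : bool -> R -> pt n -> R) (b : bool)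
    (t : R) : pt n -> R :=
  fun x => F b (U true t x) (U false t x).

Definition lips2 (K : R) (F : bool -> R -> R -> R) : Prop :=
  forall b u v u' v', Rabs (F b u v - F b u' v') <= K * (Rabs (u - u') + Rabs (v - v')).

Lemma CB_src {n} K F (U : bool -> R -> pt n -> R) b : 0 < K -> lips2 K F ->
  (forall b, CB (U b)) -> CB (src F U b).
Proof.
move=> HK HF HU; split.
  move=> t; split.
    have [M [_ HM]] := BUC_bound _ (proj1 (HU true) t).
    have [N [_ HN]] := BUC_bound _ (proj1 (HU false) t).
    exists (Rabs (F b 0 0) + K * (M + N)) => x.
    have := HF b (U true t x) (U false t x) 0 0; rewrite !Rminus_0_r => H.
    have := Rmult_le_compat_l _ _ _ (Rlt_le _ _ HK) (Rplus_le_compat _ _ _ _ (HM x) (HN x)).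
    have := Rabs_triang (F b (U true t x) (U false t x) - F b 0 0) (F b 0 0).
    have -> : F b (U true t x) (U false t x) - F b 0 0 + F b 0 0 = F b (U true t x) (U false t x) by ring.
    rewrite /src; lra.
  move=> e He; have He' : 0 < e / 2 / K by apply: Rdiv_lt_0_compat; lra.
  have [d [Hd H]] := proj2 (proj1 (HU true) t) _ He'.
  have [d' [Hd' H']] := proj2 (proj1 (HU false) t) _ He'.
  exists (Rmin d d'); split; first exact: Rmin_pos.
  move=> x y Hxy; apply: Rle_lt_trans (HF b _ _ _ _) _.
  have A1 := H x y (Rlt_le_trans _ _ _ Hxy (Rmin_l _ _)).
  have A2 := H' x y (Rlt_le_trans _ _ _ Hxy (Rmin_r _ _)).
  have := Rmult_lt_compat_l _ _ _ HK (Rplus_lt_compat _ _ _ _ A1 A2).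
  by have -> : K * (e / 2 / K + e / 2 / K) = e by field; lra.
move=> t e He; have He' : 0 < e / 2 / K by apply: Rdiv_lt_0_compat; lra.
have [d [Hd H]] := proj2 (HU true) t _ He'.
have [d' [Hd' H']] := proj2 (HU false) t _ He'.
exists (Rmin d d'); split; first exact: Rmin_pos.
move=> s Hs x; apply: Rle_trans (HF b _ _ _ _) _.
have A1 := H s (Rlt_le_trans _ _ _ Hs (Rmin_l _ _)) x.
have A2 := H' s (Rlt_le_trans _ _ _ Hs (Rmin_r _ _)) x.
have := Rmult_le_compat_l _ _ _ (Rlt_le _ _ HK) (Rplus_le_compat _ _ _ _ A1 A2).
by have -> : K * (e / 2 / K + e / 2 / K) = e by field; lra.
Qed.

Lemma src_loc_lips {n} K F (U : bool -> R -> pt n -> R) b : 0 < K -> lips2 K F ->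
  (forall b, loc_lips (U b)) -> loc_lips (src F U b).
Proof.
move=> HK HF HU a c Hac.
have [L [HL H]] := HU true a c Hac; have [L' [HL' H']] := HU false a c Hac.
exists (K * (L + L')); split; first by apply: Rmult_le_pos; lra.
move=> t Ht i r x; apply: Rle_trans (HF b _ _ _ _) _.
rewrite Rmult_assoc; apply: Rmult_le_compat_l; first lra.
rewrite Rmult_plus_distr_r; apply: Rplus_le_compat; [exact: H | exact: H'].
Qed.

(** The gain 1/l of the exponentially weighted norm: the bound integrates to C (exp(l t) - 1). *)
Lemma integ_exp_bound {n} (H : R -> pt n -> R) t C l x : CB H -> 0 <= t -> 0 <= C ->
  (forall r, 0 <= r <= t -> Rabs (H r x) <= C * l * exp (l * (t - r))) ->
  Rabs (integ H 0 t x) <= C * exp (l * t).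
Proof.
move=> HH Ht HC Hb.
have I2 : is_RInt (fun r => C * l * exp (l * (t - r))) 0 t
    (minus (- C * exp (l * (t - t))) (- C * exp (l * (t - 0)))).
  apply: (is_RInt_derive (fun r => - C * exp (l * (t - r)))).
    by move=> r _; auto_derive => //; rewrite /Rminus; ring.
  move=> r _; apply: ex_derive_continuous; auto_derive => //.
have I1 := RInt_correct _ _ _ (CB_ex_RInt H x 0 t HH).
have := norm_RInt_le (fun r => H r x) (fun r => C * l * exp (l * (t - r))) 0 t _ _ Ht Hb I1 I2.
rewrite Rminus_diag_eq // Rmult_0_r exp_0 Rminus_0_r /minus /plus /opp /= => K.
apply: Rle_trans K _; lra.
Qed.

Fixpoint picard {n : nat} (D : bool -> R) (u0 : bool -> pt n -> R) (F : bool -> R -> R -> R)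
    (k : nat) : bool -> R -> pt n -> R :=
  match k with
  | 0%nat => fun b _ => u0 b
  | k'.+1 => fun b t => mild (D b) (u0 b) (src F (picard D u0 F k') b) (Rmax 0 t)
  end.

Lemma mild_diff {n} D u0 (G G' : R -> pt n -> R) t x : 0 < D -> CB G -> CB G' ->
  mild D u0 G t x - mild D u0 G' t x = integ (fun r y => duh D G t r y - duh D G' t r y) 0 t x.
Proof.
by move=> HD HG HG'; rewrite integ_minus; try exact: CB_duh; rewrite /mild; ring.
Qed.

(** In the norm weighted by exp(-4 K t) the iteration contracts by 1/2 on every [0, T], so the
    solution is global without gluing short intervals. *)
Lemma picard_fixed_point {n : nat} (D : bool -> R) (u0 : bool -> pt n -> R)
    (F : bool -> R -> R -> R) (K : R) :
  (forall b, 0 < D b) -> (forall b, BUC (u0 b)) -> 0 < K -> lips2 K F ->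
  exists U : bool -> R -> pt n -> R, (forall b, CB (U b)) /\
    forall b t, U b t = mild (D b) (u0 b) (src F U b) (Rmax 0 t).
Proof.
move=> HD Hu HK HF; set P := picard D u0 F.
have HCB k b : CB (P k b).
  elim: k b => [|k IH] b; first by apply: CB_const.
  by apply: mild_continuous => //; apply: (CB_src K).
have HCs k b : CB (src F (P k) b) by apply: (CB_src K).
(* The Lipschitz bound sees both components and gives a factor 2 K; against the rate 4 K of the
   weight this leaves 1/2. *)
have Hdiff T : 0 <= T -> exists B, 0 <= B /\ forall k b t x, 0 <= t <= T ->
    Rabs (P k.+1 b t x - P k b t x) <= B * (1 / 2) ^ k * exp (4 * K * t).
  move=> HT.
  have [B1 [HB1 H1]] := CB_bound _ 0 T (CB_minus _ _ (HCB 1%nat true) (HCB 0%nat true)) HT.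
  have [B2 [HB2 H2]] := CB_bound _ 0 T (CB_minus _ _ (HCB 1%nat false) (HCB 0%nat false)) HT.
  exists (B1 + B2); split; first lra.
  elim=> [|k IH] b t x Ht.
    have Hexp : 1 <= exp (4 * K * t).
      rewrite -exp_0; apply: exp_le; apply: Rmult_le_pos; lra.
    have H12 : Rabs (P 1%nat b t x - P 0%nat b t x) <= B1 + B2.
      by case: b; [have := H1 t x Ht | have := H2 t x Ht]; lra.
    rewrite Rmult_1_r; apply: Rle_trans H12 _.
    rewrite -{1}(Rmult_1_r (B1 + B2)); apply: Rmult_le_compat_l; lra.
  have -> : P k.+2 b t x - P k.+1 b t x =
     integ (fun r y => duh (D b) (src F (P k.+1) b) t r y - duh (D b) (src F (P k) b) t r y) 0 t x.
    by rewrite -(mild_diff (D b) (u0 b)) // /P /= Rmax_right //; lra.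
  have Hp : 0 <= (1 / 2) ^ k by apply: pow_le; lra.
  have -> : (B1 + B2) * (1 / 2) ^ k.+1 = (B1 + B2) * (1 / 2) ^ k / 2 by rewrite /=; field.
  apply: integ_exp_bound; [by apply: CB_minus; apply: CB_duh | lra | |].
    by apply: Rmult_le_pos; [apply: Rmult_le_pos | ]; lra.
  move=> r Hr; apply: heat_bound_minus => //; [by case: (HCs k.+1 b) | by case: (HCs k b) |].
  move=> y; rewrite /src; apply: Rle_trans (HF b _ _ _ _) _.
  have A1 := IH true (t - r) y ltac:(lra); have A2 := IH false (t - r) y ltac:(lra).
  have := Rmult_le_compat_l _ _ _ (Rlt_le _ _ HK) (Rplus_le_compat _ _ _ _ A1 A2); lra.
pose U b t x := real (Lim_seq (fun k => P k b (Rmax 0 t) x)).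
have Hlim T : 0 <= T -> exists C, 0 <= C /\ forall k b t x, 0 <= t <= T ->
    Rabs (P k b t x - U b t x) <= C * (1 / 2) ^ k.
  move=> HT; have [B [HB H]] := Hdiff T HT.
  pose C := 2 * (B * exp (4 * K * T)).
  have HC : 0 <= C by apply: Rmult_le_pos; [lra | apply: Rmult_le_pos => //; exact: Rlt_le (exp_pos _)].
  exists C; split=> // k b t x Ht.
  have Hstep j : Rabs (P j.+1 b t x - P j b t x) <= C / 2 * (1 / 2) ^ j.
    apply: Rle_trans (H j b t x Ht) _.
    have -> : C / 2 * (1 / 2) ^ j = B * (1 / 2) ^ j * exp (4 * K * T) by rewrite /C; field.
    apply: Rmult_le_compat_l; first by apply: Rmult_le_pos => //; apply: pow_le; lra.
    by apply: exp_le; apply: Rmult_le_compat_l; lra.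
  have Hjm j m : Rabs (P (m + j)%nat b t x - P j b t x) <= C * (1 / 2) ^ j - C * (1 / 2) ^ (m + j).
    elim: m => [|m IH]; first by rewrite add0n !Rminus_diag_eq // Rabs_R0; lra.
    rewrite addSn; have /Rabs_le_between A1 := Hstep (m + j)%nat; move/Rabs_le_between: IH => IH.
    have E : C * (1 / 2) ^ (m + j).+1 = C / 2 * (1 / 2) ^ (m + j) by rewrite /=; field.
    apply: Rabs_le; lra.
  have Hpow m : 0 <= C * (1 / 2) ^ m by apply: Rmult_le_pos => //; apply: pow_le; lra.
  have Hcauchy m j : Rabs (P m b t x - P j b t x) <= C * (1 / 2) ^ m + C * (1 / 2) ^ j.
    case: (leqP j m) => [Hjm'|/ltnW Hjm'].
      have := Hjm j (m - j)%nat; rewrite subnK // => /Rabs_le_between A.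
      have := Hpow m; have := Hpow j; move=> *; apply: Rabs_le; lra.
    have := Hjm m (j - m)%nat; rewrite subnK // => /Rabs_le_between A.
    have := Hpow m; have := Hpow j; move=> *; apply: Rabs_le; lra.
  have HL : is_lim_seq (fun m => C * (1 / 2) ^ m) 0.
    rewrite -(Rmult_0_r C); apply: (is_lim_seq_scal_l _ C 0); apply: is_lim_seq_geom.
    by rewrite Rabs_pos_eq; lra.
  have [_ E] := uniform_cauchy_limit (fun m (_ : unit) => P m b t x) _ tt HL Hcauchy.
  by rewrite /U Rmax_right; [exact: E | lra].
have Hhalf C e : 0 < e -> exists k, C * (1 / 2) ^ k <= e.
  move=> He; have HL : is_lim_seq (fun m => C * (1 / 2) ^ m) 0.
    rewrite -(Rmult_0_r C); apply: (is_lim_seq_scal_l _ C 0); apply: is_lim_seq_geom.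
    by rewrite Rabs_pos_eq; lra.
  have /is_lim_seq_spec /(_ (mkposreal e He)) [N HN] := HL.
  by exists N; have := HN N (le_n N); rewrite Rminus_0_r /= => /Rabs_def2; lra.
have HU0 b t : U b (Rmax 0 t) = U b t.
  by rewrite /U; apply: functional_extensionality => x; rewrite (Rmax_right 0 (Rmax 0 t)) //; exact: Rmax_l.
have HUCB b : CB (U b).
  split.
    move=> t; rewrite -HU0; apply: BUC_uniform_limit => e He.
    have [C [_ HC]] := Hlim (Rmax 0 t) (Rmax_l _ _).
    have [k Hk] := Hhalf C e He; exists (P k b (Rmax 0 t)); split; first by case: (HCB k b).
    move=> x; rewrite Rabs_minus_sym; apply: Rle_trans Hk; apply: HC.
    by split; [exact: Rmax_l | exact: Rle_refl].
  move=> t; apply: ccont_closure => e He.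
  have [|C [_ HC]] := Hlim (Rmax 0 t + 1); first by have := Rmax_l 0 t; lra.
  have [k Hk] := Hhalf C e He.
  exists (fun s => P k b (Rmax 0 s)), 1; split; first lra.
    by apply: (proj2 (CB_comp _ (Rmax 0) (HCB k b) Rmax0_contract)).
  move=> s Hs x; rewrite -HU0 Rabs_minus_sym; apply: Rle_trans Hk; apply: HC.
  split; first exact: Rmax_l.
  have /Rabs_le_between := Rle_trans _ _ _ (Rmax0_contract s t) (Rlt_le _ _ Hs); lra.
exists U; split=> // b t; apply: functional_extensionality => x; rewrite -HU0.
have : 0 <= Rmax 0 t := Rmax_l 0 t.
move: (Rmax 0 t) => s Hs.
apply: Rminus_diag_uniq; apply: Rabs_eq_0; apply: Rle_antisym (Rabs_pos _).
apply: Rle_plus_epsilon => e He; rewrite Rplus_0_l.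
have [C [HC0 HC]] := Hlim s Hs.
(* The limit is compared with an iterate (error C) and the Duhamel map of the limit with that of the
   preceding iterate (error s K 2 C), both times 2^-k. *)
have [k Hk] := Hhalf (C + s * (K * (2 * C))) e He.
have A1 := HC k.+1 b s x ltac:(lra).
have HsU : CB (src F U b) by apply: (CB_src K).
have A2 : Rabs (P k.+1 b s x - mild (D b) (u0 b) (src F U b) s x) <= (s - 0) * (K * (2 * (C * (1 / 2) ^ k))).
  have -> : P k.+1 b s x = mild (D b) (u0 b) (src F (P k) b) s x by rewrite /P /= Rmax_right.
  rewrite mild_diff //; apply: integ_bound => //; first by apply: CB_minus; apply: CB_duh.
  move=> r Hr; apply: heat_bound_minus => //; [by case: (HCs k b) | by case: HsU |].
  move=> y; apply: Rle_trans (HF b _ _ _ _) _; apply: Rmult_le_compat_l; first lra.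
  have B1 := HC k true (s - r) y ltac:(lra); have B2 := HC k false (s - r) y ltac:(lra); lra.
have A3 : C * (1 / 2) ^ k.+1 <= C * (1 / 2) ^ k.
  apply: Rmult_le_compat_l => //=.
  have : 0 <= (1 / 2) ^ k by apply: pow_le; lra.
  lra.
move: A1 A2 => /Rabs_le_between A1 /Rabs_le_between A2.
apply: Rabs_le; lra.
Qed.

(** * The maximum principle on the whole space *)

Definition in_box {n : nat} (r : R) (x : pt n) : Prop := forall i, Rabs (x i) <= r.

Definition upd {n : nat} (x : pt n) (k : 'I_n) (r : R) : pt n :=
  fun i => if i == k then r else x i.

Definition clip (r s : R) : R := Rmax (- r) (Rmin r s).

Lemma clip_abs r s : 0 <= r -> Rabs (clip r s) <= r.
Proof.
move=> Hr; apply: Rabs_le; rewrite /clip; split; first exact: Rmax_l.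
apply: Rmax_lub; [lra | exact: Rmin_l].
Qed.

Lemma clip_id r s : Rabs s <= r -> clip r s = s.
Proof. by move=> /Rabs_le_between H; rewrite /clip Rmin_right ?Rmax_right //; lra. Qed.

Lemma clip_contract r s t : Rabs (clip r s - clip r t) <= Rabs (s - t).
Proof.
rewrite /clip /Rmax /Rmin; destruct (Rle_dec r s), (Rle_dec r t);
  repeat (match goal with |- context [Rle_dec ?a ?b] => destruct (Rle_dec a b) end);
  rewrite /Rabs; repeat destruct Rcase_abs; lra.
Qed.

(** Extreme value theorem on a box, one coordinate at a time: the maximum over the coordinates in
    [L] is a continuous function of the next coordinate, to which the one-variable theorem
    applies. *)
Lemma box_partial_max {n} (f : pt n -> R) r (L : seq 'I_n) : 0 <= r ->
  (forall e, 0 < e -> exists d, 0 < d /\ forall x y, in_box r x -> in_box r y ->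
     (forall i, Rabs (x i - y i) < d) -> Rabs (f x - f y) <= e) ->
  forall x, in_box r x -> exists y, [/\ in_box r y, (forall i, i \notin L -> y i = x i) &
    forall y', in_box r y' -> (forall i, i \notin L -> y' i = x i) -> f y' <= f y].
Proof.
move=> Hr Hf; elim: L => [|k L IH] x Hx.
  exists x; split=> // y' _ Hy; right; congr f.
  by apply: functional_extensionality => i; apply: Hy.
pose ok x y := [/\ in_box r y, (forall i, i \notin L -> y i = x i) &
    forall y', in_box r y' -> (forall i, i \notin L -> y' i = x i) -> f y' <= f y].
have HY z : exists y, in_box r z -> ok z y.
  case: (classic (in_box r z)) => Hz; last by exists z.
  by have [y Hy] := IH z Hz; exists y.
pose Y z := proj1_sig (constructive_indefinite_description _ (HY z)).
have HYz z : in_box r z -> ok z (Y z).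
  exact: (proj2_sig (constructive_indefinite_description _ (HY z))).
have Hub s : in_box r (upd x k (clip r s)).
  by move=> i; rewrite /upd; case: (i == k) => //; apply: clip_abs.
pose m s := f (Y (upd x k (clip r s))).
have Hlow e d s t : (forall x y, in_box r x -> in_box r y ->
     (forall i, Rabs (x i - y i) < d) -> Rabs (f x - f y) <= e) -> 0 < d -> Rabs (s - t) < d ->
     m s - e <= m t.
  move=> H Hd Hst; have [B1 B2 B3] := HYz _ (Hub s); have [C1 C2 C3] := HYz _ (Hub t).
  (* The maximizer for s with coordinate k moved to its value for t: an admissible competitor for t
     that differs by at most |s - t|. *)
  pose y' i := if i \in L then Y (upd x k (clip r s)) i else upd x k (clip r t) i.
  have Hy' : in_box r y'.
    by move=> i; rewrite /y'; case: (i \in L); [exact: B1 | exact: Hub].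
  have E1 : f y' <= m t by apply: C3 => // i /negbTE Hi; rewrite /y' Hi.
  have E2 : Rabs (m s - f y') <= e.
    apply: H => // i; rewrite /y'; case Hi: (i \in L).
      by rewrite Rminus_diag_eq // Rabs_R0.
    rewrite B2 ?Hi // /upd; case: (i == k); last by rewrite Rminus_diag_eq // Rabs_R0.
    exact: Rle_lt_trans (clip_contract _ _ _) Hst.
  move: E2 => /Rabs_le_between; lra.
have Hcont s : continuity_pt m s.
  apply/continuity_pt_filterlim; apply: continuous_abs => e He.
  have [d [Hd H]] := Hf e He; exists d; split=> // t Hts.
  have A1 := Hlow e d t s H Hd Hts; have A2 := Hlow e d s t H Hd ltac:(by rewrite Rabs_minus_sym).
  by apply: Rabs_le; lra.
have [s [Hs Hsr]] := continuity_ab_maj m (- r) r ltac:(lra) (fun c _ => Hcont c).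
have [B1 B2 B3] := HYz _ (Hub s).
exists (Y (upd x k (clip r s))); split=> //.
  move=> i; rewrite in_cons negb_or => /andP [/negbTE Hik Hi].
  by rewrite B2 // /upd Hik.
move=> y' Hy' Hy'x; apply: (Rle_trans _ (m (y' k))); last first.
  by apply: Hs; apply/Rabs_le_between; apply: Hy'.
have [C1 C2 C3] := HYz _ (Hub (y' k)); apply: C3 => // i Hi.
rewrite /upd; case: (i =P k) => [->|/eqP Hik]; first by rewrite clip_id.
by apply: Hy'x; rewrite in_cons negb_or Hik.
Qed.

Lemma box_max {n} (f : pt n -> R) r : 0 <= r ->
  (forall e, 0 < e -> exists d, 0 < d /\ forall x y, in_box r x -> in_box r y ->
     (forall i, Rabs (x i - y i) < d) -> Rabs (f x - f y) <= e) ->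
  exists y, in_box r y /\ forall y', in_box r y' -> f y' <= f y.
Proof.
move=> Hr Hf; have [|y [Hy _ H]] := box_partial_max f r (enum 'I_n) Hr Hf (fun _ => 0).
  by move=> i; rewrite Rabs_R0.
by exists y; split=> // y' Hy'; apply: H => // i; rewrite mem_enum.
Qed.

Lemma cylinder_max {n} (g : R -> pt n -> R) r a b : 0 <= r -> a <= b ->
  (forall t e, a <= t <= b -> 0 < e -> exists d, 0 < d /\ forall x y, in_box r x -> in_box r y ->
     (forall i, Rabs (x i - y i) < d) -> Rabs (g t x - g t y) <= e) ->
  (forall t e, a <= t <= b -> 0 < e -> exists d, 0 < d /\ forall s x, a <= s <= b -> in_box r x ->
     Rabs (s - t) < d -> Rabs (g s x - g t x) <= e) ->
  exists t y, [/\ a <= t <= b, in_box r y &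
    forall t' y', a <= t' <= b -> in_box r y' -> g t' y' <= g t y].
Proof.
move=> Hr Hab Hx Ht.
pose c t := Rmax a (Rmin b t).
have Hc t : a <= c t <= b.
  by rewrite /c; split; [exact: Rmax_l | apply: Rmax_lub => //; exact: Rmin_l].
have Hcid t : a <= t <= b -> c t = t.
  by move=> H; rewrite /c Rmin_right ?Rmax_right //; lra.
have Hcc s t : Rabs (c s - c t) <= Rabs (s - t).
  rewrite /c /Rmax /Rmin; destruct (Rle_dec b s), (Rle_dec b t);
  repeat (match goal with |- context [Rle_dec ?a ?b] => destruct (Rle_dec a b) end);
  rewrite /Rabs; repeat destruct Rcase_abs; lra.
have HY t : exists y, in_box r y /\ forall y', in_box r y' -> g (c t) y' <= g (c t) y.
  by apply: box_max => // e He; apply: Hx.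
pose Y t := proj1_sig (constructive_indefinite_description _ (HY t)).
have HYt t : in_box r (Y t) /\ forall y', in_box r y' -> g (c t) y' <= g (c t) (Y t).
  exact: (proj2_sig (constructive_indefinite_description _ (HY t))).
pose m t := g (c t) (Y t).
have Hcont s : continuity_pt m s.
  apply/continuity_pt_filterlim; apply: continuous_abs => e He.
  have [d [Hd H]] := Ht (c s) e (Hc s) He; exists d; split=> // t Hts.
  have Hct := Rle_lt_trans _ _ _ (Hcc t s) Hts.
  have [B1 B2] := HYt s; have [C1 C2] := HYt t.
  have /Rabs_le_between A1 := H (c t) (Y s) (Hc t) B1 Hct.
  have /Rabs_le_between A2 := H (c t) (Y t) (Hc t) C1 Hct.
  have A3 := B2 _ C1; have A4 := C2 _ B1.
  apply: Rabs_le; rewrite /m; lra.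
have [s [Hs Hsab]] := continuity_ab_maj m a b Hab (fun c _ => Hcont c).
have [B1 B2] := HYt s.
exists (c s), (Y s); split=> // t' y' Ht' Hy'.
apply: Rle_trans (Hs t' Ht'); rewrite /m -{1}(Hcid t' Ht').
by apply: (proj2 (HYt t')).
Qed.

Lemma derive_max_left (g : R -> R) a t l : is_derive g t l -> a < t ->
  (forall s, a <= s <= t -> g s <= g t) -> 0 <= l.
Proof.
move=> H Hat Hm; apply: Rnot_lt_le => Hl.
have /is_derive_Reals /(_ (- l) ltac:(lra)) [d Hd] := H; have Hp := cond_pos d.
pose r := - Rmin (d / 2) (t - a).
have R1 := Rmin_l (d / 2) (t - a); have R2 := Rmin_r (d / 2) (t - a).
have R3 : 0 < Rmin (d / 2) (t - a) by apply: Rmin_pos; lra.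
have := Hd r ltac:(rewrite /r; lra) ltac:(rewrite /r Rabs_Ropp Rabs_pos_eq; lra).
move/Rabs_def2 => [K _].
have Hg := Hm (t + r) ltac:(rewrite /r; lra).
have : 0 <= (g (t + r) - g t) / r.
  have -> : (g (t + r) - g t) / r = (g t - g (t + r)) / (- r) by field; rewrite /r; lra.
  by apply: Rdiv_le_0_compat; [lra | rewrite /r; lra].
lra.
Qed.

Lemma derive_max_right (g : R -> R) l : is_derive g 0 l ->
  (forall s, g s <= g 0) -> l <= 0.
Proof.
move=> H Hm.
have H' : is_derive (fun s => g (- s)) 0 (- 1 * l).
  apply: (is_derive_comp g (fun s => - s)); first by rewrite Ropp_0.
  by auto_derive => //; ring.
have := derive_max_left (fun s => g (- s)) (-1) 0 _ H' ltac:(lra).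
rewrite Ropp_0 => K; have := K (fun s _ => Hm (- s)); lra.
Qed.

(** At the maximum p vanishes; if s > 0 then p > 0 just to the right of 0 and g would increase
    there. *)
Lemma second_derive_max (g p : R -> R) s :
  (forall r, is_derive g r (p r)) -> is_derive p 0 s -> (forall r, g r <= g 0) -> s <= 0.
Proof.
move=> Hg Hp Hm; apply: Rnot_lt_le => Hs.
have P0 : p 0 = 0.
  apply: Rle_antisym; first exact: (derive_max_right g).
  by apply: (derive_max_left g (-1) 0) => //; lra.
have /is_derive_Reals /(_ s Hs) [d Hd] := Hp; have Hdp := cond_pos d.
have Hpos r : 0 < r < d -> 0 < p r.
  move=> Hr; have := Hd r ltac:(lra) ltac:(rewrite Rabs_pos_eq; lra).
  rewrite P0 Rplus_0_l Rminus_0_r => /Rabs_def2 [_ K].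
  have {}K : 0 < p r / r by lra.
  have -> : p r = p r / r * r by field; lra.
  by apply: Rmult_lt_0_compat; lra.
have Hc r : continuity_pt g r.
  by apply/continuity_pt_filterlim; apply: ex_derive_continuous; exists (p r).
(* The mean value point of this first interval may be 0, where p vanishes; the strict increase comes
   from the second interval. *)
have := MVT_gen g 0 (d / 4) p; rewrite /= Rmin_left ?Rmax_right; try lra.
case=> [r _|r _|c1 [Hc1 E1]]; [exact: Hg | exact: Hc |].
have := MVT_gen g (d / 4) (d / 2) p; rewrite /= Rmin_left ?Rmax_right; try lra.
case=> [r _|r _|c2 [Hc2 E2]]; [exact: Hg | exact: Hc |].
have K2 : 0 < p c2 by apply: Hpos; lra.
have K1 : 0 <= p c1.
  by case: (Req_dec c1 0) => [->|H0]; [lra | apply: Rlt_le; apply: Hpos; lra].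
have := Hm (d / 2).
have := Rmult_le_pos _ _ K1 (ltac:(lra) : 0 <= d / 4 - 0).
have := Rmult_lt_0_compat _ _ K2 (ltac:(lra) : 0 < d / 2 - d / 4).
lra.
Qed.

Lemma dist_lt {n} (x y : pt n) d e : 0 < e -> d * (INR n + 1) = e ->
  (forall i, Rabs (x i - y i) < d) -> dist x y < e.
Proof.
move=> He Hde H; have Hn := pos_INR n.
have Hd : 0 < d.
  apply: Rnot_le_lt => Hd; have : d * (INR n + 1) <= 0; last lra.
  have := Rmult_le_compat_r (INR n + 1) _ _ ltac:(lra) Hd; lra.
rewrite /dist -(sqrt_pow2 e); last lra.
have Hs : \big[Rplus/0]_(i < n) ((x i - y i) ^ 2) <= INR n * d ^ 2.
  rewrite -sum_const; apply: sum_le => i.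
  rewrite -(Rabs_pos_eq d); last lra.
  rewrite -Rsqr_pow2 -Rsqr_pow2 -Rsqr_abs; apply: Rsqr_le_abs_1.
  by rewrite (Rabs_pos_eq d); [apply: Rlt_le | lra].
apply: sqrt_lt_1.
- by apply: sum_ge0 => i; exact: pow2_ge_0.
- exact: pow2_ge_0.
- apply: Rle_lt_trans Hs _; rewrite -Hde.
  have : 0 < d ^ 2 by apply: pow_lt.
  have : 0 <= d ^ 2 * INR n by apply: Rmult_le_pos => //; exact: pow2_ge_0.
  have : 0 <= d ^ 2 * INR n * INR n by apply: Rmult_le_pos => //; apply: Rmult_le_pos => //; exact: pow2_ge_0.
  have -> : (d * (INR n + 1)) ^ 2 = d ^ 2 * INR n * INR n + 2 * (d ^ 2 * INR n) + d ^ 2 by ring.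
  lra.
Qed.

(* The penalization eta (|x|^2 + (2nD+1) t) makes the supremum attained and the inequality strict. *)
Lemma max_principle {n} D a b (w W wt : R -> pt n -> R) (wx wxx : 'I_n -> R -> pt n -> R) :
  0 < D -> a <= b -> CB W -> (forall t, a <= t <= b -> w t = W t) ->
  (forall t x, a < t <= b -> is_derive (fun s => w s x) t (wt t x)) ->
  (forall i t x, a < t <= b -> is_derive (fun r => w t (shift x i r)) 0 (wx i t x)) ->
  (forall i t x, a < t <= b -> is_derive (fun r => wx i t (shift x i r)) 0 (wxx i t x)) ->
  (forall t x, a < t <= b -> 0 < w t x -> wt t x <= D * \big[Rplus/0]_(i < n) wxx i t x) ->
  (forall x, w a x <= 0) ->
  forall t x, a <= t <= b -> w t x <= 0.
Proof.
move=> HD Hab HW HwW Ht Hx Hxx Hineq Ha t0 x0 Ht0.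
apply: Rnot_lt_le => Hw0.
have [M [HM HWM]] := CB_bound W a b HW Hab.
have HwM t x : a <= t <= b -> w t x <= M.
  by move=> H; rewrite HwW //; apply: Rle_trans (Rle_abs _) (HWM t x H).
have Hn := pos_INR n.
pose psi (x : pt n) := \big[Rplus/0]_(i < n) (x i ^ 2).
have psi0 x : 0 <= psi x by apply: sum_ge0 => i; exact: pow2_ge_0.
pose c := 2 * INR n * D + 1.
have Hc : 0 < c.
  have : 0 <= 2 * INR n * D by apply: Rmult_le_pos; lra.
  rewrite /c; lra.
have Hba : 0 <= c * (b - a) by apply: Rmult_le_pos; lra.
(* Small enough that the penalty at (t0, x0) is at most half of w there, so the penalized function
   is still positive at that point. *)
pose eta := w t0 x0 / 2 / (psi x0 + c * (b - a) + 1).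
have Heta : 0 < eta.
  apply: Rdiv_lt_0_compat; first lra; have := psi0 x0; lra.
pose z t x := w t x - eta * (psi x + c * (t - a)).
have Hz0 : 0 < z t0 x0.
  have E : eta * (psi x0 + c * (b - a) + 1) = w t0 x0 / 2.
    rewrite /eta; field; have := psi0 x0; lra.
  have : eta * (psi x0 + c * (t0 - a)) <= eta * (psi x0 + c * (b - a) + 1).
    apply: Rmult_le_compat_l; first lra.
    have := Rmult_le_compat_l c (t0 - a) (b - a) ltac:(lra) ltac:(lra); lra.
  rewrite /z; lra.
(* Outside this box [psi] is at least r^2 >= M / eta, so the penalty exceeds the bound M of w; the
   summand 1 gives r^2 >= M / eta even for small M / eta. *)
pose r := M / eta + 1.
have HMe : 0 <= M / eta by apply: Rdiv_le_0_compat.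
have Hout t x : a <= t <= b -> ~ in_box r x -> z t x <= 0.
  move=> Htab /not_all_ex_not [i Hi].
  have {}Hi : r < Rabs (x i) by apply: Rnot_le_lt.
  have H1 : M / eta <= psi x.
    apply: Rle_trans (sum_term_le (fun j => x j ^ 2) i (fun j => pow2_ge_0 _)).
    have -> : x i ^ 2 = Rabs (x i) * Rabs (x i) by rewrite -Rabs_mult Rabs_pos_eq; [ring | nra].
    have : r * r <= Rabs (x i) * Rabs (x i) by apply: Rmult_le_compat; rewrite /r in Hi *; lra.
    have := Rmult_le_pos _ _ HMe HMe; rewrite /r; lra.
  have H2 : M <= eta * psi x.
    have := Rmult_le_compat_l eta _ _ (Rlt_le _ _ Heta) H1.
    by have -> : eta * (M / eta) = M by field; lra.
  have H3 : 0 <= eta * (c * (t - a)) by apply: Rmult_le_pos; [lra | apply: Rmult_le_pos; lra].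
  have := HwM t x Htab; rewrite /z; lra.
have [|||t1 [x1 [Ht1 Hx1 Hmax]]] := cylinder_max z r a b _ Hab.
- rewrite /r; lra.
- move=> t e Htab He.
  have [|d [Hd H]] := proj2 (proj1 HW t) (e / 2); first lra.
  have Hr1 : 0 < 2 * eta * r * (INR n + 1).
    have Hr0 : 0 < r by rewrite /r; lra.
    by apply: Rmult_lt_0_compat; [apply: Rmult_lt_0_compat => //; lra | lra].
  pose d1 := d / (INR n + 1); pose d2 := e / 2 / (2 * eta * r * (INR n + 1)).
  have Hd1 : 0 < d1 by apply: Rdiv_lt_0_compat; lra.
  have Hd2 : 0 < d2 by apply: Rdiv_lt_0_compat; lra.
  exists (Rmin d1 d2); split; first exact: Rmin_pos.
  move=> x y Bx By Hxy.
  have A1 : Rabs (w t x - w t y) < e / 2.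
    rewrite HwW //; apply: H; apply: (dist_lt x y d1) => //; first by rewrite /d1; field; lra.
    by move=> i; apply: Rlt_le_trans (Hxy i) (Rmin_l _ _).
  have A2 : Rabs (psi x - psi y) <= INR n * (2 * r * d2).
    rewrite /psi -sum_minus -sum_const; apply: Rle_trans (sum_abs_le _) _; apply: sum_le => i.
    have -> : x i ^ 2 - y i ^ 2 = (x i + y i) * (x i - y i) by ring.
    rewrite Rabs_mult; apply: Rmult_le_compat; try exact: Rabs_pos.
      apply: Rle_trans (Rabs_triang _ _) _; have := Bx i; have := By i; lra.
    by apply: Rlt_le; apply: Rlt_le_trans (Hxy i) (Rmin_r _ _).
  have A3 : eta * Rabs (psi x - psi y) <= e / 2.
    apply: Rle_trans (Rmult_le_compat_l _ _ _ (Rlt_le _ _ Heta) A2) _.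
    have -> : e / 2 = 2 * eta * r * (INR n + 1) * d2 by rewrite /d2; field; repeat split; rewrite /r; lra.
    have : 0 <= eta * r * d2 by apply: Rmult_le_pos; [apply: Rmult_le_pos; rewrite /r; lra | lra].
    lra.
  have -> : z t x - z t y = (w t x - w t y) + - (eta * (psi x - psi y)) by rewrite /z; ring.
  apply: Rle_trans (Rabs_triang _ _) _.
  rewrite Rabs_Ropp Rabs_mult (Rabs_pos_eq eta); lra.
- move=> t e Htab He; have [|d [Hd H]] := proj2 HW t (e / 2); first lra.
  have Hec : 0 < eta * c by apply: Rmult_lt_0_compat.
  have Hd2 : 0 < e / 2 / (eta * c) by apply: Rdiv_lt_0_compat; lra.
  exists (Rmin d (e / 2 / (eta * c))); split; first exact: Rmin_pos.
  move=> s x Hs _ Hst.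
  have A1 := H s (Rlt_le_trans _ _ _ Hst (Rmin_l _ _)) x.
  have A2 := Rlt_le _ _ (Rlt_le_trans _ _ _ Hst (Rmin_r _ _)).
  have -> : z s x - z t x = (W s x - W t x) + - (eta * c * (s - t)).
    by rewrite /z !HwW //; ring.
  apply: Rle_trans (Rabs_triang _ _) _.
  rewrite Rabs_Ropp Rabs_mult (Rabs_pos_eq (eta * c)); last lra.
  have := Rmult_le_compat_l _ _ _ (Rlt_le _ _ Hec) A2.
  have -> : eta * c * (e / 2 / (eta * c)) = e / 2 by field; lra.
  lra.
have Hz1 : 0 < z t1 x1.
  apply: (Rlt_le_trans _ _ _ Hz0); apply: Hmax => //.
  by case: (classic (in_box r x0)) => // Hb; case: (Rlt_not_le _ _ Hz0 (Hout t0 x0 Ht0 Hb)).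
have Hglob t x : a <= t <= b -> z t x <= z t1 x1.
  move=> Htab; case: (classic (in_box r x)) => Hb; first exact: Hmax.
  have := Hout t x Htab Hb; lra.
have Hat1 : a < t1.
  case: (Req_dec t1 a) => E; last lra.
  have := Ha x1; have : 0 <= eta * psi x1 by apply: Rmult_le_pos => //; lra.
  move: Hz1; rewrite /z E; lra.
(* The differential inequality is assumed only where w > 0, so positivity at the maximum point has
   to be secured first. *)
have Hw1 : 0 < w t1 x1.
  have : 0 <= eta * (psi x1 + c * (t1 - a)).
    apply: Rmult_le_pos; first lra.
    have := Rmult_le_pos c (t1 - a) ltac:(lra) ltac:(lra); have := psi0 x1; lra.
  move: Hz1; rewrite /z; lra.
have Ht1' : a < t1 <= b by lra.
have D1 : 0 <= wt t1 x1 - eta * c.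
  apply: (derive_max_left (fun s => z s x1) a t1) => //; last by move=> s Hs; apply: Hglob; lra.
  apply: is_derive_minus; first exact: Ht.
  by auto_derive => //; ring.
have D2 i : wxx i t1 x1 <= 2 * eta.
  suff : wxx i t1 x1 - 2 * eta <= 0 by lra.
  have Epsi s : psi (shift x1 i s) = psi x1 - x1 i ^ 2 + (x1 i + s) ^ 2.
    suff : psi (shift x1 i s) - psi x1 = (x1 i + s) ^ 2 - x1 i ^ 2 by lra.
    rewrite /psi -sum_minus (bigD1 i) //= big1 => [|j /negbTE Hj].
      by rewrite /shift eqxx; ring.
    by rewrite /shift Hj; ring.
  apply: (second_derive_max (fun s => z t1 (shift x1 i s))
    (fun s => wx i t1 (shift x1 i s) - 2 * eta * (x1 i + s))).
  - move=> s; rewrite /z; apply: is_derive_minus.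
      have Hs : partial i (w t1) (wx i t1) by move=> y; apply: Hx.
      exact: (partial_derive i (w t1) (wx i t1) x1 s Hs).
    apply: (is_derive_ext (fun s => eta * (psi x1 - x1 i ^ 2 + (x1 i + s) ^ 2 + c * (t1 - a)))).
      by move=> u; rewrite Epsi.
    by auto_derive => //; ring.
  - apply: is_derive_minus; first exact: Hxx.
    by auto_derive => //; ring.
  - by move=> s; rewrite shift0; apply: Hglob.
have D3 : \big[Rplus/0]_(i < n) wxx i t1 x1 <= INR n * (2 * eta).
  by rewrite -sum_const; apply: sum_le.
have D4 := Hineq t1 x1 Ht1' Hw1.
have D5 := Rmult_le_compat_l D _ _ (Rlt_le _ _ HD) D3.
(* Contradiction: eta c <= wt <= D times the sum of wxx <= 2 n D eta = eta (c - 1). *)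
rewrite /c in D1; lra.
Qed.

(** * Classical solutions *)

Lemma cont_pos_of_curve {n} (g : R -> pt n -> R) :
  (forall t, 0 < t -> BUC (g t) /\ ccont g t) -> cont_pos g.
Proof.
move=> H t x Ht e He; have [[_ Hu] Hc] := H t Ht.
have [|d [Hd Hs]] := Hc (e / 2); first lra.
have [|d' [Hd' Hs']] := Hu (e / 2); first lra.
exists (Rmin d d'); split; first exact: Rmin_pos.
move=> s y _ Hst Hyx.
have /Rabs_le_between A1 := Hs s (Rlt_le_trans _ _ _ Hst (Rmin_l _ _)) y.
have /Rabs_def2 A2 := Hs' y x (Rlt_le_trans _ _ _ Hyx (Rmin_r _ _)).
apply: Rabs_def1; lra.
Qed.

Lemma ccont_ext_pos {n} (F G : R -> pt n -> R) t : 0 < t ->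
  (forall s, 0 < s -> F s = G s) -> ccont G t -> ccont F t.
Proof.
move=> Ht E HG e He; have [d [Hd H]] := HG e He.
exists (Rmin d t); split; first exact: Rmin_pos.
move=> s Hs x; have /Rabs_def2 Hs' := Rlt_le_trans _ _ _ Hs (Rmin_r _ _).
rewrite !E; try lra; apply: H; exact: Rlt_le_trans Hs (Rmin_l _ _).
Qed.

Lemma mild_classical {n} D u0 (G U : R -> pt n -> R) : 0 < D -> BUC u0 -> CB G -> loc_lips G ->
  (forall t, U t = mild D u0 G (Rmax 0 t)) ->
  exists ut lap, C21 U ut lap /\ forall t x, 0 < t -> ut t x = D * lap t x + G t x.
Proof.
move=> HD Hu HG HL HU.
have E t : 0 < t -> U t = mild D u0 G t by move=> Ht; rewrite HU Rmax_right //; lra.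
have H2 t : 0 < t -> BUC2 (U t).
  by move=> Ht; rewrite E //; case: (mild_BUC2_approx D u0 G t HD Hu HG HL Ht).
have HB1 t i : 0 < t -> BUC (Der i (U t)) /\ partial i (U t) (Der i (U t)).
  by move=> Ht; apply: BUC1_Der; case: (H2 t Ht).
have HB2 t i j : 0 < t -> BUC (Der i (Der j (U t))) /\ partial i (Der j (U t)) (Der i (Der j (U t))).
  by move=> Ht; apply: BUC1_Der; case: (H2 t Ht).
pose lap t x := \big[Rplus/0]_(i < n) Der i (Der i (U t)) x.
exists (fun t x => D * lap t x + G t x), lap; split=> //.
exists (fun i t => Der i (U t)), (fun i j t => Der i (Der j (U t))).
have C2 i j t : 0 < t -> ccont (fun s => Der i (Der j (U s))) t.
  move=> Ht; apply: (ccont_ext_pos _ (fun s => Der i (Der j (mild D u0 G s)))) => //.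
    by move=> s Hs; rewrite E.
  exact: mild_Der2_ccont.
have Clap t : 0 < t -> ccont lap t by move=> Ht; apply: ccont_sum => i; apply: C2.
have Blap t : 0 < t -> BUC (lap t).
  by move=> Ht; apply: BUC_sum => i; case: (HB2 t i i Ht).
repeat split.
- apply: cont_pos_of_curve => t Ht; split; first by case: (H2 t Ht) => [[]].
  by apply: (ccont_ext_pos _ (mild D u0 G)) => //; apply: mild_curve.
- apply: cont_pos_of_curve => t Ht; split; first by apply: BUC_lin; [exact: Blap | case: HG].
  by apply: ccont_lin; [exact: Clap | exact: (proj2 HG t)].
- move=> i; apply: cont_pos_of_curve => t Ht; split; first by case: (HB1 t i Ht).
  apply: (ccont_ext_pos _ (fun s => Der i (mild D u0 G s))) => //.
    by move=> s Hs; rewrite E.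
  exact: mild_Der_ccont.
- move=> i j; apply: cont_pos_of_curve => t Ht; split; first by case: (HB2 t i j Ht).
  exact: C2.
- apply/is_derive_Reals.
  have := mild_time_derivative D u0 G t x HD Hu HG HL H; rewrite -E //.
  apply: is_derive_ext_loc; exists (mkposreal t H) => s /Rabs_def2 /= Hs.
  rewrite E //; rewrite /minus /plus /opp /= in Hs; lra.
- by move=> i; apply/is_derive_Reals; case: (HB1 t i H).
- by move=> i j; apply/is_derive_Reals; case: (HB2 t i j H).
Qed.

Lemma C_BUC_CB {n} (u : R -> pt n -> R) : C_BUC u -> CB (fun t => u (Rmax 0 t)).
Proof.
move=> [HB HC]; split; first by move=> t; apply: HB; exact: Rmax_l.
move=> t e He; have [d [Hd H]] := HC (Rmax 0 t) (Rmax_l _ _) e He.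
exists d; split=> // s Hs; apply: H; first exact: Rmax_l.
exact: Rle_lt_trans (Rmax0_contract _ _) Hs.
Qed.

Lemma CB_C_BUC {n} (u : R -> pt n -> R) : CB u -> C_BUC u.
Proof.
move=> [HB HC]; split=> // t _ e He; have [d [Hd H]] := HC t e He.
by exists d; split=> // s _ Hs x; apply: H.
Qed.

(** One statement for all uses: be = 0 gives sign and upper bounds, (al, be) = (1, -1) or (-1, 1)
    gives differences of solutions, and ka < 0 allows a source that makes the difference grow
    linearly in time. *)
Lemma comparison {n} D a b (u u' ut ut' lap lap' : R -> pt n -> R) al be ga ka :
  0 < D -> 0 <= a <= b -> C_BUC u -> C_BUC u' -> C21 u ut lap -> C21 u' ut' lap' ->
  (forall t x, a < t <= b -> 0 < al * u t x + be * u' t x + ga + ka * (t - a) ->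
     al * ut t x + be * ut' t x + ka <= D * (al * lap t x + be * lap' t x)) ->
  (forall x, al * u a x + be * u' a x + ga <= 0) ->
  forall t x, a <= t <= b -> al * u t x + be * u' t x + ga + ka * (t - a) <= 0.
Proof.
move=> HD Hab Hu Hu' [ux [uxx [_ [_ [_ [_ H]]]]]] [ux' [uxx' [_ [_ [_ [_ H']]]]]] Hineq Ha.
apply: (max_principle D a b (fun t x => al * u t x + be * u' t x + ga + ka * (t - a))
   (fun t x => al * u (Rmax 0 t) x + (be * u' (Rmax 0 t) x + (ga + ka * (t - a))))
   (fun t x => al * ut t x + be * ut' t x + ka)
   (fun i t x => al * ux i t x + be * ux' i t x)
   (fun i t x => al * uxx i i t x + be * uxx' i i t x)) => //.
- lra.
- have CBu := C_BUC_CB u Hu; have CBu' := C_BUC_CB u' Hu'.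
  have CBk : CB (fun t (_ : pt n) => ga + ka * (t - a)).
    split=> [t|t e He]; first exact: BUC_const.
    have Hk : 0 < Rabs ka + 1 by have := Rabs_pos ka; lra.
    exists (e / (Rabs ka + 1)); split; first exact: Rdiv_lt_0_compat.
    move=> s Hs _; have -> : ga + ka * (s - a) - (ga + ka * (t - a)) = ka * (s - t) by ring.
    rewrite Rabs_mult.
    have -> : e = (Rabs ka + 1) * (e / (Rabs ka + 1)) by field; lra.
    apply: Rmult_le_compat; try exact: Rabs_pos; lra.
  split=> t; first by apply: BUC_lin; [case: CBu | apply: BUC_lin; [case: CBu' | case: CBk]].
  by apply: ccont_lin; [exact: (proj2 CBu t) | apply: ccont_lin; [exact: (proj2 CBu' t) | exact: (proj2 CBk t)]].
- move=> t Ht; apply: functional_extensionality => x; rewrite Rmax_right; [ring | lra].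
- move=> t x Ht; have [/is_derive_Reals D1 _] := H t x ltac:(lra).
  have [/is_derive_Reals D2 _] := H' t x ltac:(lra).
  have -> : al * ut t x + be * ut' t x + ka = al * ut t x + be * ut' t x + 0 + ka * (1 - 0) by ring.
  apply: is_derive_plus; last first.
    apply: is_derive_scal; apply: is_derive_minus; [exact: is_derive_id | exact: is_derive_const].
  apply: is_derive_plus; last exact: is_derive_const.
  by apply: is_derive_plus; apply: is_derive_scal.
- move=> i t x Ht; have [_ [/(_ i) /is_derive_Reals D1 _]] := H t x ltac:(lra).
  have [_ [/(_ i) /is_derive_Reals D2 _]] := H' t x ltac:(lra).
  have -> : al * ux i t x + be * ux' i t x = al * ux i t x + be * ux' i t x + 0 + 0 by ring.
  apply: is_derive_plus; last exact: is_derive_const.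
  apply: is_derive_plus; last exact: is_derive_const.
  by apply: is_derive_plus; apply: is_derive_scal.
- move=> i t x Ht; have [_ [_ [/(_ i i) /is_derive_Reals D1 _]]] := H t x ltac:(lra).
  have [_ [_ [/(_ i i) /is_derive_Reals D2 _]]] := H' t x ltac:(lra).
  by apply: is_derive_plus; apply: is_derive_scal.
- move=> t x Ht Hw; have [_ [_ [_ E]]] := H t x ltac:(lra); have [_ [_ [_ E']]] := H' t x ltac:(lra).
  by rewrite sum_plus !sum_scal -E -E'; apply: Hineq.
- move=> x; have := Ha x; lra.
Qed.

(** * The Keener-Tyson nonlinearity *)

Definition react (eps h q u v : R) : R :=
  / eps * u * (1 - u) - h * v * ((u - q) / (u + q)).

(** The terms come from the logistic part, from |(u - q)/(u + q)| <= 5, and from the slope 2q/(u +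
    q)^2 <= 8/q, both for u >= -q/2. The final 1 makes the constant serve the linear v-equation
    too. *)
Definition lip_const (eps h q B : R) : R := / eps * (1 + 2 * B) + 5 * h + 8 * h * B / q + 1.

Lemma lip_const_ge1 eps h q B : 0 < eps -> 0 < h -> 0 < q -> 0 <= B -> 1 <= lip_const eps h q B.
Proof.
move=> He Hh Hq HB; rewrite /lip_const.
have := Rmult_le_pos (/ eps) (1 + 2 * B) (Rlt_le _ _ (Rinv_0_lt_compat _ He)) ltac:(lra).
have : 0 <= 8 * h * B / q.
  by apply: Rdiv_le_0_compat => //; apply: Rmult_le_pos => //; lra.
lra.
Qed.

(** Splitting the product as (v - v') phi(u) + v' (phi(u) - phi(u')) requires a bound on v'
    alone. *)
Lemma react_lipschitz eps h q B u v u' v' : 0 < eps -> 0 < h -> 0 < q -> 0 <= B ->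
  - (q / 2) <= u <= B -> - (q / 2) <= u' <= B -> q / 2 <= B -> Rabs v' <= B ->
  Rabs (react eps h q u v - react eps h q u' v') <=
    lip_const eps h q B * (Rabs (u - u') + Rabs (v - v')).
Proof.
move=> He Hh Hq HB Hu Hu' HqB Hv'.
have Hie := Rinv_0_lt_compat _ He.
have Hiq := Rinv_0_lt_compat _ Hq.
pose phi w := (w - q) / (w + q).
have Hphi : Rabs (phi u) <= 5.
  have Hi : 0 < / (u + q) by apply: Rinv_0_lt_compat; lra.
  have Ei : (u + q) * / (u + q) = 1 by apply: Rinv_r; lra.
  have E : phi u = 1 - 2 * q * / (u + q) by rewrite /phi; field; lra.
  have Hq2 : q * / (u + q) <= 2.
    have := Rmult_le_compat_r (/ (u + q)) q (2 * (u + q)) ltac:(lra) ltac:(lra); lra.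
  have Hq0 : 0 <= q * / (u + q) by apply: Rmult_le_pos; lra.
  rewrite E; apply: Rabs_le; lra.
have Hdphi : Rabs (phi u - phi u') <= 8 / q * Rabs (u - u').
  have E : phi u - phi u' = 2 * q * / (u + q) * / (u' + q) * (u - u').
    by rewrite /phi; field; lra.
  have Hi : 0 < / (u + q) <= 2 * / q.
    split; first by apply: Rinv_0_lt_compat; lra.
    have -> : 2 * / q = / (q / 2) by field; lra.
    by apply: Rinv_le_contravar; lra.
  have Hi' : 0 < / (u' + q) <= 2 * / q.
    split; first by apply: Rinv_0_lt_compat; lra.
    have -> : 2 * / q = / (q / 2) by field; lra.
    by apply: Rinv_le_contravar; lra.
  have Hc : 0 <= 2 * q * / (u + q) * / (u' + q) <= 8 / q.
    split; first by apply: Rmult_le_pos; [apply: Rmult_le_pos | ]; lra.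
    have -> : 8 / q = 2 * q * (2 * / q) * (2 * / q) by field; lra.
    apply: Rmult_le_compat; [by apply: Rmult_le_pos; lra | lra | | lra].
    by apply: Rmult_le_compat_l; lra.
  rewrite E Rabs_mult Rabs_pos_eq; last lra.
  by apply: Rmult_le_compat_r; [exact: Rabs_pos | lra].
have E : react eps h q u v - react eps h q u' v' =
   / eps * ((1 - u - u') * (u - u')) - h * ((v - v') * phi u + v' * (phi u - phi u')).
  by rewrite /react -/(phi u) -/(phi u'); ring.
set x := Rabs (u - u') in Hdphi *; set y := Rabs (v - v').
have Hx : 0 <= x by exact: Rabs_pos.
have Hy : 0 <= y by exact: Rabs_pos.
have A1 : Rabs (/ eps * ((1 - u - u') * (u - u'))) <= / eps * (1 + 2 * B) * x.
  rewrite Rabs_mult (Rabs_pos_eq (/ eps)); last lra.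
  rewrite Rabs_mult -/x -Rmult_assoc; apply: Rmult_le_compat_r => //.
  by apply: Rmult_le_compat_l; [lra | apply: Rabs_le; lra].
have A2 : Rabs ((v - v') * phi u) <= y * 5.
  by rewrite Rabs_mult; apply: Rmult_le_compat_l.
have A3 : Rabs (v' * (phi u - phi u')) <= B * (8 / q * x).
  by rewrite Rabs_mult; apply: Rmult_le_compat => //; exact: Rabs_pos.
have A4 : Rabs (h * ((v - v') * phi u + v' * (phi u - phi u'))) <= h * (y * 5 + B * (8 / q * x)).
  rewrite Rabs_mult (Rabs_pos_eq h); last lra.
  apply: Rmult_le_compat_l; first lra.
  apply: Rle_trans (Rabs_triang _ _) _; lra.
rewrite E; apply: Rle_trans (Rabs_triang _ _) _; rewrite Rabs_Ropp.
have Hk : 0 <= 8 * h * B / q.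
  by apply: Rdiv_le_0_compat => //; apply: Rmult_le_pos => //; lra.
have H1 : h * (B * (8 / q * x)) = 8 * h * B / q * x by field; lra.
have H2 := Rmult_le_pos _ _ (Rmult_le_pos (/ eps) (1 + 2 * B) ltac:(lra) ltac:(lra)) Hy.
have H3 := Rmult_le_pos _ _ Hk Hy.
have H4 := Rmult_le_pos _ _ (Rlt_le _ _ Hh) Hx.
rewrite /lip_const; lra.
Qed.

Definition trunc (M s : R) : R := Rmax 0 (Rmin M s).

Lemma trunc_range M s : 0 <= M -> 0 <= trunc M s <= M.
Proof.
move=> HM; rewrite /trunc; split; first exact: Rmax_l.
by apply: Rmax_lub => //; exact: Rmin_l.
Qed.

Lemma trunc_contract M s t : Rabs (trunc M s - trunc M t) <= Rabs (s - t).
Proof.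
apply: Rle_trans (Rmax0_contract _ _) _.
rewrite /Rmin; destruct (Rle_dec M s), (Rle_dec M t);
  rewrite /Rabs; repeat destruct Rcase_abs; lra.
Qed.

Lemma trunc_id M s : 0 <= s <= M -> trunc M s = s.
Proof. by move=> H; rewrite /trunc Rmin_right ?Rmax_right //; lra. Qed.

Lemma trunc_low M s : 0 <= M -> s <= 0 -> trunc M s = 0.
Proof. by move=> HM H; rewrite /trunc Rmin_right ?Rmax_left //; lra. Qed.

Lemma trunc_high M s : 0 <= M -> M <= s -> trunc M s = M.
Proof. by move=> HM H; rewrite /trunc Rmin_left ?Rmax_right //; lra. Qed.

(** The arguments are truncated instead of the value, so u + q never vanishes in the quotient; the
    v-equation is linear and stays as it is. *)
Definition Ftrunc (eps h q M N : R) (b : bool) (u v : R) : R :=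
  if b then react eps h q (trunc M u) (trunc N v) else u - v.

Lemma Ftrunc_lips2 eps h q M N : 0 < eps -> 0 < h -> 0 < q -> q <= 1 -> 1 <= M -> M <= N ->
  lips2 (lip_const eps h q N) (Ftrunc eps h q M N).
Proof.
move=> He Hh Hq Hq1 HM HMN b u v u' v'.
have HK : 1 <= lip_const eps h q N by apply: lip_const_ge1 => //; lra.
case: b => /=; last first.
  have -> : u - v - (u' - v') = (u - u') + - (v - v') by ring.
  apply: Rle_trans (Rabs_triang _ _) _; rewrite Rabs_Ropp.
  have H := Rplus_le_le_0_compat _ _ (Rabs_pos (u - u')) (Rabs_pos (v - v')).
  have := Rmult_le_compat_r _ _ _ H HK; lra.
have R1 := trunc_range M u ltac:(lra); have R2 := trunc_range M u' ltac:(lra).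
have R3 := trunc_range N v' ltac:(lra).
apply: Rle_trans (react_lipschitz eps h q N _ _ _ _ He Hh Hq _ _ _ _ _) _; try lra.
  by rewrite Rabs_pos_eq; lra.
apply: Rmult_le_compat_l; first lra.
by apply: Rplus_le_compat; apply: trunc_contract.
Qed.

(** * Uniqueness *)

Lemma geom_zero x C : (forall k, Rabs x <= C * (1 / 2) ^ k) -> x = 0.
Proof.
move=> H; apply: Rabs_eq_0; apply: Rle_antisym (Rabs_pos _).
have HL : is_lim_seq (fun m => C * (1 / 2) ^ m) 0.
  rewrite -(Rmult_0_r C); apply: (is_lim_seq_scal_l _ C 0); apply: is_lim_seq_geom.
  by rewrite Rabs_pos_eq; lra.
exact: (is_lim_seq_le _ _ (Finite _) (Finite _) H (is_lim_seq_const _) HL).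
Qed.

Lemma half_step K m c t s r : 0 <= K -> 0 <= m -> s <= t <= r -> (r - s) * (4 * K) <= 1 ->
  c + - (2 * K * m) * (t - s) <= 0 -> c <= m / 2.
Proof.
move=> HK Hm Ht Hr Hc.
have H1 : (t - s) * (4 * K) <= 1.
  by apply: Rle_trans Hr; apply: Rmult_le_compat_r; lra.
have := Rmult_le_compat_r m _ _ Hm H1; lra.
Qed.

(** If the differences are at most m on [s, r], their sources are at most 2 K m, and comparison with
    a linear function of time bounds them by 2 K m (t - s) <= m/2. Iterating from the crude bound 2
    B forces them to vanish. *)
Lemma short_time_uniqueness {n} eps h d q B s r (u v u' v' ut vt ut' vt' lu lv lu' lv' : R -> pt n -> R) :
  0 < eps -> 0 < h -> 0 < d -> 0 < q -> q / 2 <= B -> 0 <= s <= r ->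
  (r - s) * (4 * lip_const eps h q B) <= 1 ->
  C_BUC u -> C_BUC v -> C_BUC u' -> C_BUC v' ->
  C21 u ut lu -> C21 v vt lv -> C21 u' ut' lu' -> C21 v' vt' lv' ->
  (forall t x, 0 < t -> ut t x = lu t x + react eps h q (u t x) (v t x) /\
                        vt t x = d * lv t x - v t x + u t x) ->
  (forall t x, 0 < t -> ut' t x = lu' t x + react eps h q (u' t x) (v' t x) /\
                        vt' t x = d * lv' t x - v' t x + u' t x) ->
  (forall t x, s <= t <= r -> [/\ - (q / 2) <= u t x <= B, - (q / 2) <= u' t x <= B,
                                  Rabs (v t x) <= B & Rabs (v' t x) <= B]) ->
  (forall x, u' s x = u s x /\ v' s x = v s x) ->
  forall t x, s <= t <= r -> u' t x = u t x /\ v' t x = v t x.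
Proof.
move=> He Hh Hd Hq HqB Hsr Hr Cu Cv Cu' Cv' Du Dv Du' Dv' E E' Hb H0.
have HB : 0 <= B by lra.
set K := lip_const eps h q B in Hr *.
have HK : 1 <= K by apply: lip_const_ge1.
have key k : forall t x, s <= t <= r ->
    Rabs (u t x - u' t x) <= 2 * B * (1 / 2) ^ k /\ Rabs (v t x - v' t x) <= 2 * B * (1 / 2) ^ k.
  elim: k => [|k IH] t x Ht.
    have [A1 A2 /Rabs_le_between A3 /Rabs_le_between A4] := Hb t x Ht.
    by split; rewrite Rmult_1_r; apply: Rabs_le; lra.
  set m := 2 * B * (1 / 2) ^ k in IH.
  have Hm : 0 <= m by apply: Rmult_le_pos; [lra | apply: pow_le; lra].
  have -> : 2 * B * (1 / 2) ^ k.+1 = m / 2 by rewrite /m /=; field.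
  have Hreact p y : s < p <= r ->
      Rabs (react eps h q (u p y) (v p y) - react eps h q (u' p y) (v' p y)) <= 2 * K * m.
    move=> Hp; have [A1 A2 A3 A4] := Hb p y ltac:(lra).
    have [B1 B2] := IH p y ltac:(lra).
    apply: Rle_trans (react_lipschitz eps h q B _ _ _ _ He Hh Hq HB A1 A2 HqB A4) _.
    have := Rmult_le_compat_l K _ _ ltac:(lra) (Rplus_le_compat _ _ _ _ B1 B2).
    rewrite -/K; lra.
  have Hlin p y : s < p <= r -> Rabs ((u p y - u' p y) - (v p y - v' p y)) <= 2 * K * m.
    move=> Hp; have [/Rabs_le_between B1 /Rabs_le_between B2] := IH p y ltac:(lra).
    have := Rmult_le_compat_r m _ _ Hm HK => ?; apply: Rabs_le; lra.
  have Uab al be : al = 1 /\ be = -1 \/ al = -1 /\ be = 1 ->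
      al * u t x + be * u' t x <= m / 2.
    move=> Hab; apply: (half_step K m _ t s r) => //; first lra.
    rewrite -[al * _ + _]Rplus_0_r.
    apply: (comparison 1 s r u u' ut ut' lu lu' al be 0 (- (2 * K * m))) => //; first lra.
      move=> p y Hp _; have [-> _] := E p y ltac:(lra); have [-> _] := E' p y ltac:(lra).
      have /Rabs_le_between := Hreact p y Hp; case: Hab => [] [-> ->]; lra.
    by move=> y; have [-> _] := H0 y; case: Hab => [] [-> ->]; lra.
  have Vab al be : al = 1 /\ be = -1 \/ al = -1 /\ be = 1 ->
      al * v t x + be * v' t x <= m / 2.
    move=> Hab; apply: (half_step K m _ t s r) => //; first lra.
    rewrite -[al * _ + _]Rplus_0_r.
    apply: (comparison d s r v v' vt vt' lv lv' al be 0 (- (2 * K * m))) => //.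
      move=> p y Hp _; have [_ ->] := E p y ltac:(lra); have [_ ->] := E' p y ltac:(lra).
      have /Rabs_le_between := Hlin p y Hp; case: Hab => [] [-> ->]; lra.
    by move=> y; have [_ ->] := H0 y; case: Hab => [] [-> ->]; lra.
  have P1 : 1 = 1 /\ -1 = -1 \/ 1 = -1 /\ -1 = 1 by left.
  have P2 : -1 = 1 /\ 1 = -1 \/ -1 = -1 /\ 1 = 1 by right.
  have := Uab _ _ P1; have := Uab _ _ P2; have := Vab _ _ P1; have := Vab _ _ P2.
  by move=> *; split; apply: Rabs_le; lra.
move=> t x Ht; split.
  have := geom_zero (u t x - u' t x) (2 * B) (fun k => proj1 (key k t x Ht)); lra.
have := geom_zero (v t x - v' t x) (2 * B) (fun k => proj2 (key k t x Ht)); lra.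
Qed.

Lemma C_BUC_bound {n} (u : R -> pt n -> R) T : C_BUC u -> 0 <= T ->
  exists M, 0 <= M /\ forall t x, 0 <= t <= T -> Rabs (u t x) <= M.
Proof.
move=> Hu HT; have [M [HM H]] := CB_bound _ 0 T (C_BUC_CB u Hu) HT.
exists M; split=> // t x Ht; have := H t x Ht; rewrite Rmax_right //; lra.
Qed.

Lemma BZ_equations {n} eps h d q (u0 v0 : pt n -> R) u v : BZ_classical eps h d q u0 v0 u v ->
  exists ut lu vt lv, [/\ C21 u ut lu, C21 v vt lv,
    forall t x, 0 < t -> ut t x = lu t x + react eps h q (u t x) (v t x) /\
                         vt t x = d * lv t x - v t x + u t x,
    forall x, u 0 x = u0 x & forall x, v 0 x = v0 x].
Proof.
move=> [ut [lu [vt [lv [H1 [H2 [H3 [H4 H5]]]]]]]].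
exists ut, lu, vt, lv; split=> // t x Ht; have [_ [E1 E2]] := H3 t x Ht.
by split=> //; rewrite E1 /react; ring.
Qed.

(** Only u is assumed nonnegative. At a time of agreement u' = u >= 0, and continuity in sup norm
    keeps u' >= -q/2 for a while, uniformly in x. *)
Lemma BZ_unique {n} eps h d q (u0 v0 : pt n -> R) u v u' v' :
  0 < eps -> 0 < h -> 0 < d -> 0 < q ->
  BZ_classical eps h d q u0 v0 u v -> C_BUC u -> C_BUC v ->
  (forall t x, 0 <= t -> 0 <= u t x) ->
  BZ_classical eps h d q u0 v0 u' v' -> C_BUC u' -> C_BUC v' ->
  forall t x, 0 <= t -> u' t x = u t x /\ v' t x = v t x.
Proof.
move=> He Hh Hd Hq S1 Cu Cv Hu S2 Cu' Cv' T x HT; move: x.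
have [ut [lu [vt [lv [Du Dv E U0 V0]]]]] := BZ_equations _ _ _ _ _ _ _ _ S1.
have [ut' [lu' [vt' [lv' [Du' Dv' E' U0' V0']]]]] := BZ_equations _ _ _ _ _ _ _ _ S2.
have [B1 [HB1 Hb1]] := C_BUC_bound u T Cu HT; have [B2 [HB2 Hb2]] := C_BUC_bound v T Cv HT.
have [B3 [HB3 Hb3]] := C_BUC_bound u' T Cu' HT; have [B4 [HB4 Hb4]] := C_BUC_bound v' T Cv' HT.
pose B := B1 + B2 + B3 + B4 + q.
set K := lip_const eps h q B.
have HK : 1 <= K by apply: lip_const_ge1 => //; rewrite /B; lra.
pose Q t := forall x, u' t x = u t x /\ v' t x = v t x.
have Q0 : Q 0 by move=> x; rewrite U0 U0' V0 V0'.
suff : Q 0 -> forall t, 0 <= t <= T -> Q t by move=> /(_ Q0 T); apply; lra.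
(* The interval property is an implication, agreement at s propagating to all of [s, r]; in this
   form it concatenates. *)
apply: (interval_cover (fun s r => Q s -> forall t, s <= t <= r -> Q t)) => //.
  move=> s c t Hc H1 H2 Qs p Hp; case: (Rle_lt_dec p c) => Hpc; first by apply: H1 => //; lra.
  by apply: H2; [apply: H1 => //; lra | lra].
move=> t Ht.
(* Two times of the window are each within q/4 of time t in sup norm, so u' changes by at most q/2
   between them. *)
have [|d1 [Hd1 H1]] := proj2 Cu' t (proj1 Ht) (q / 4); first lra.
have HiK : 0 < / (4 * K) by apply: Rinv_0_lt_compat; lra.
exists (Rmin d1 (/ (4 * K))); split; first exact: Rmin_pos.
move=> s r Hs Hr Hsr Qs p Hp.
have Hsr1 := Rlt_le_trans _ _ _ Hsr (Rmin_l _ _).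
have Hsr2 := Rlt_le_trans _ _ _ Hsr (Rmin_r _ _).
move=> x; apply: (short_time_uniqueness eps h d q B s r u v u' v' ut vt ut' vt' lu lv lu' lv') => //.
- rewrite /B; lra.
- lra.
- have := Rmult_le_compat_r (4 * K) _ _ ltac:(lra) (Rlt_le _ _ Hsr2).
  by rewrite Rinv_l //; lra.
- move=> w y Hw.
  have /Rabs_le_between A1 := Hb1 w y ltac:(lra); have /Rabs_le_between A2 := Hb2 w y ltac:(lra).
  have /Rabs_le_between A3 := Hb3 w y ltac:(lra); have /Rabs_le_between A4 := Hb4 w y ltac:(lra).
  have /Rabs_le_between C1 := H1 w ltac:(lra) ltac:(apply: Rabs_def1; lra) y.
  have /Rabs_le_between C2 := H1 s ltac:(lra) ltac:(apply: Rabs_def1; lra) y.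
  have Us : 0 <= u' s y by rewrite (proj1 (Qs y)); apply: Hu; lra.
  have Uw := Hu w y ltac:(lra).
  by split; rewrite /B; try (apply: Rabs_le); lra.
Qed.

(** * Existence and invariant bounds *)

Lemma BZ_exists {n} eps h d q (u0 v0 : pt n -> R) :
  0 < eps -> 0 < h -> 0 < d -> 0 < q -> q < 1 -> BUC u0 -> BUC v0 ->
  (forall x, 0 <= u0 x) -> (forall x, 0 <= v0 x) ->
  exists u v, [/\ BZ_classical eps h d q u0 v0 u v, C_BUC u, C_BUC v &
    forall t x, 0 <= t -> 0 <= u t x /\ 0 <= v t x].
Proof.
move=> He Hh Hd Hq Hq1 Hu0 Hv0 Pu0 Pv0.
have [Mu [HMu HuM]] := BUC_bound _ Hu0; have [Mv [HMv HvM]] := BUC_bound _ Hv0.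
(* M >= 1 > q makes both reaction terms nonpositive at u = M when v >= 0; N dominates both v0 and
   the source u <= M of the v-equation. *)
pose M := Mu + 1; pose N := M + Mv.
have HM : 1 <= M by rewrite /M; lra.
have HMN : M <= N by rewrite /N; lra.
set F := Ftrunc eps h q M N; set K := lip_const eps h q N.
have HF : lips2 K F by apply: Ftrunc_lips2 => //; lra.
have HK : 0 < K.
  by apply: (Rlt_le_trans _ 1); [lra | apply: lip_const_ge1 => //; lra].
pose D (b : bool) := if b then 1 else d; pose w0 (b : bool) := if b then u0 else v0.
have HD b : 0 < D b by case: b => //=; lra.
have Hw0 b : BUC (w0 b) by case: b.
have [U [HU EU]] := picard_fixed_point D w0 F K HD Hw0 HK HF.
have HG b : CB (src F U b) by apply: (CB_src K).
have HUL b : loc_lips (U b).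
  move=> a c Hac; have [L [HL H]] := mild_loc_lips (D b) (w0 b) _ (HD b) (Hw0 b) (HG b) a c Hac.
  exists L; split=> // t Ht; rewrite EU Rmax_right; [exact: H | lra].
have HGL b : loc_lips (src F U b) by apply: (src_loc_lips K).
have [ut [lu [Du Eu]]] := mild_classical _ _ _ _ (HD true) (Hw0 true) (HG true) (HGL true) (EU true).
have [vt [lv [Dv Ev]]] := mild_classical _ _ _ _ (HD false) (Hw0 false) (HG false) (HGL false) (EU false).
set u := U true in Du; set v := U false in Dv.
have {}Eu t x : 0 < t -> ut t x = lu t x + react eps h q (trunc M (u t x)) (trunc N (v t x)).
  by move=> Ht; rewrite Eu // Rmult_1_l.
have {}Ev t x : 0 < t -> vt t x = d * lv t x + (u t x - v t x) by move=> Ht; rewrite Ev.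
have I0 b : U b 0 = w0 b by rewrite EU Rmax_left; [exact: mild_0 | lra].
have Cu : C_BUC u := CB_C_BUC _ (HU true).
have Cv : C_BUC v := CB_C_BUC _ (HU false).
(* Where u < 0 the truncated reaction is its value h v at u = 0, with v truncated and hence
   nonnegative. Both bounds on u thus come before any information on v. *)
have u_ge0 t x : 0 <= t -> 0 <= u t x.
  move=> Ht; suff : -1 * u t x + 0 * u t x + 0 + 0 * (t - 0) <= 0 by lra.
  apply: (comparison 1 0 t u u ut ut lu lu) => //; try lra.
    move=> s y Hs Hy; rewrite Eu; last lra.
    rewrite (trunc_low M); try lra.
    have := trunc_range N (v s y) ltac:(lra) => Hc.
    have -> : react eps h q 0 (trunc N (v s y)) = h * trunc N (v s y) by rewrite /react; field; lra.
    have := Rmult_le_pos h (trunc N (v s y)) ltac:(lra) ltac:(lra); lra.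
  by move=> y; rewrite /u I0 /=; have := Pu0 y; lra.
have u_leM t x : 0 <= t -> u t x <= M.
  move=> Ht; suff : 1 * u t x + 0 * u t x + - M + 0 * (t - 0) <= 0 by lra.
  apply: (comparison 1 0 t u u ut ut lu lu) => //; try lra.
    move=> s y Hs Hy; rewrite Eu; last lra.
    rewrite (trunc_high M); try lra.
    have Hc := trunc_range N (v s y) ltac:(lra).
    have Hie := Rinv_0_lt_compat _ He.
    have R1 : / eps * M * (1 - M) <= 0.
      have : 0 <= / eps * M * (M - 1) by apply: Rmult_le_pos; [apply: Rmult_le_pos; lra | lra].
      lra.
    have R2 : 0 <= h * trunc N (v s y) * ((M - q) / (M + q)).
      apply: Rmult_le_pos; first by apply: Rmult_le_pos; lra.
      by apply: Rdiv_le_0_compat; lra.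
    rewrite /react; lra.
  by move=> y; rewrite /u I0 /=; have /Rabs_le_between := HuM y; rewrite /M; lra.
have v_ge0 t x : 0 <= t -> 0 <= v t x.
  move=> Ht; suff : -1 * v t x + 0 * v t x + 0 + 0 * (t - 0) <= 0 by lra.
  apply: (comparison d 0 t v v vt vt lv lv) => //; try lra.
    by move=> s y Hs Hy; rewrite Ev; [have := u_ge0 s y ltac:(lra); lra | lra].
  by move=> y; rewrite /v I0 /=; have := Pv0 y; lra.
have v_leN t x : 0 <= t -> v t x <= N.
  move=> Ht; suff : 1 * v t x + 0 * v t x + - N + 0 * (t - 0) <= 0 by lra.
  apply: (comparison d 0 t v v vt vt lv lv) => //; try lra.
    by move=> s y Hs Hy; rewrite Ev; [have := u_leM s y ltac:(lra); lra | lra].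
  by move=> y; rewrite /v I0 /=; have /Rabs_le_between := HvM y; rewrite /N; lra.
exists u, v; split=> //; last by move=> t x Ht; split; [exact: u_ge0 | exact: v_ge0].
exists ut, lu, vt, lv; split=> //; split=> //; split; last by split=> x; rewrite /u /v I0.
move=> t x Ht; have Hu := u_ge0 t x ltac:(lra); have Hu' := u_leM t x ltac:(lra).
have Hv := v_ge0 t x ltac:(lra); have Hv' := v_leN t x ltac:(lra).
split; first lra; split; last by rewrite Ev //; ring.
by rewrite Eu // !trunc_id // /react; ring.
Qed.

Theorem theorem1 (n : nat) (eps h d q : R)
  (Heps : 0 < eps) (Hh : 0 < h) (Hd : 0 < d) (Hq0 : 0 < q) (Hq1 : q < 1)
  (u0 v0 : pt n -> R) (Hu0 : BUC u0) (Hv0 : BUC v0)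
  (Hu0p : forall x, 0 <= u0 x) (Hv0p : forall x, 0 <= v0 x) :
  exists u v : R -> pt n -> R,
    BZ_classical eps h d q u0 v0 u v /\ C_BUC u /\ C_BUC v /\
    (forall t x, 0 <= t -> 0 <= u t x /\ 0 <= v t x) /\
    (forall u' v' : R -> pt n -> R,
       BZ_classical eps h d q u0 v0 u' v' -> C_BUC u' -> C_BUC v' ->
       forall t x, 0 <= t -> u' t x = u t x /\ v' t x = v t x).
Proof.
have [u [v [Sol Cu Cv P]]] := BZ_exists eps h d q u0 v0 Heps Hh Hd Hq0 Hq1 Hu0 Hv0 Hu0p Hv0p.
exists u, v; do 4 (split; first by []).
move=> u' v' Sol' Cu' Cv'; apply: (BZ_unique eps h d q u0 v0) => // t x Ht.
exact: (proj1 (P t x Ht)).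
Qed.
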